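(* Every circle domain $\Omega\subset\hat{\mathbb C}$ with $\infty\in\Omega$ has a $43$-quasiround exhaustion $(\Omega_j)_{j\in\mathbb N}$.
   Context: $\hat{\mathbb C}$ is the Riemann sphere. A domain in $\hat{\mathbb C}$ is a circle domain if each connected component of its boundary is a point or a circle. An exhaustion of a domain $\Omega\subset\hat{\mathbb C}$ is a sequence of domains $\Omega_j\subset\Omega$, $j\in\mathbb N$, each bounded by finitely many disjoint Jordan curves in $\Omega$, such that $\Omega_j\subset\Omega_{j+1}$ for all $j$ and $\Omega=\bigcup_{j\in\mathbb N}\Omega_j$. For $K\ge 1$, a set $A\subset\mathbb C$ is $K$-quasiround if there are $z_A\in\mathbb C$ and $r_A>0$ such that $\overline{\mathbb D}(z_A,r_A)\subset A\subset\overline{\mathbb D}(z_A,Kr_A)$, where $\overline{\mathbb D}(z,r)$ is the closed Euclidean disk. A domain $G\subset\hat{\mathbb C}$ is $K$-quasiround if every connected component of $\hat{\mathbb C}\setminus G$ with positive diameter is $K$-quasiround (in particular a subset of $\mathbb C$). A sequence of domains (in particular an exhaustion) is $K$-quasiround if each of its members is $K$-quasiround. *)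

(* Defs.v *)
From HB Require Import structures.
From mathcomp Require Import all_boot all_order all_algebra.
From mathcomp Require Import all_classical all_reals all_analysis.
From mathcomp Require Export complex.
Set Implicit Arguments.
Unset Strict Implicit.
Unset Printing Implicit Defensive.
Import Order.TTheory GRing.Theory Num.Theory.
Import numFieldNormedType.Exports.

Local Open Scope classical_set_scope.
Local Open Scope ring_scope.
Local Open Scope complex_scope.

(* The alias R[i]^o is what carries the topology of the modulus on R[i]; the
   point at infinity is None, and Some is the inclusion of the plane. *)
Notation sphere R := (one_point_compactification (R[i]^o)).

Section Sphere.
Variable R : realType.
Implicit Types (A : set R[i]^o) (C E G J Omega : set (sphere R)) (K : R).

Definition infty : sphere R := None.

(* In the order of R[i], x <= r%:C forces x to be real, so the conditions on
   `|z| : R[i] below are the usual ones. *)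
Definition closed_disk (z : R[i]^o) (r : R) : set R[i]^o :=
  [set w | `|w - z| <= r%:C].

Definition euclidean_circle (z : R[i]^o) (r : R) : set R[i]^o :=
  [set w | `|w - z| = r%:C].

Definition line (a b : R[i]^o) : set R[i]^o :=
  range (fun t : R => a + t%:C * b).

(* The circles of the sphere are the Euclidean circles and the lines completed
   by the point at infinity. *)
Definition circle C : Prop :=
  (exists z r, 0 < r /\ C = Some @` euclidean_circle z r) \/
  (exists a b, b != 0 /\ C = Some @` line a b `|` [set infty]).

Definition chordal_dist (x y : sphere R) : R :=
  let m (z : R[i]) : R := complex.Re `|z| in
  match x, y with
  | Some z, Some w =>
      2 * m (z - w) / (Num.sqrt (1 + m z ^+ 2) * Num.sqrt (1 + m w ^+ 2))
  | Some z, None | None, Some z => 2 / Num.sqrt (1 + m z ^+ 2)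
  | None, None => 0
  end.

Definition diameter E : \bar R :=
  ereal_sup [set (chordal_dist x y)%:E | x in E & y in E].

Definition boundary G : set (sphere R) := closure G `\` interior G.

Definition is_component E C : Prop :=
  exists2 x, E x & C = connected_component E x.

Definition domain G : Prop := [/\ G !=set0, open G & connected G].

Definition circle_domain Omega : Prop :=
  domain Omega /\
  forall C, is_component (boundary Omega) C ->
    (exists p, C = [set p]) \/ circle C.

Definition jordan_curve J : Prop :=
  exists f : R[i]^o -> sphere R,
    [/\ {within euclidean_circle 0 1, continuous f},
        set_inj (euclidean_circle 0 1) f &
        J = f @` euclidean_circle 0 1].

(* n = 0 is allowed, and needed: when Omega = setT, compactness makes the
   members of any exhaustion eventually equal to setT, whose boundary is empty. *)
Definition bounded_by_jordan_curves_in Omega G : Prop :=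
  exists (n : nat) (J : 'I_n -> set (sphere R)),
    [/\ forall k, jordan_curve (J k) /\ J k `<=` Omega,
        trivIset setT J &
        boundary G = \bigcup_k J k].

Definition exhaustion Omega (Omega_ : nat -> set (sphere R)) : Prop :=
  [/\ forall j, [/\ domain (Omega_ j), Omega_ j `<=` Omega &
                    bounded_by_jordan_curves_in Omega (Omega_ j)],
      forall j, Omega_ j `<=` Omega_ j.+1 &
      Omega = \bigcup_j Omega_ j].

(* No condition 1 <= K is needed: it follows from the two inclusions. *)
Definition quasiround K A : Prop :=
  exists z r, [/\ 0 < r, closed_disk z r `<=` A & A `<=` closed_disk z (K * r)].

Definition quasiround_domain K G : Prop :=
  forall E, is_component (~` G) E -> (0 < diameter E)%E ->
    exists2 A, E = Some @` A & quasiround K A.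

Definition quasiround_sequence K (Omega_ : nat -> set (sphere R)) : Prop :=
  forall j, quasiround_domain K (Omega_ j).

End Sphere.

Arguments infty {R}.

(* Main.v *)
Require Import Defs.
From HB Require Import structures.
From mathcomp Require Import all_boot all_order all_algebra.
From mathcomp Require Import all_classical all_reals all_analysis.
From mathcomp Require Import finmap zify ring lra.
Set Implicit Arguments.
Unset Strict Implicit.
Unset Printing Implicit Defensive.
Import Order.TTheory GRing.Theory Num.Theory.
Import numFieldNormedType.Exports.
Local Open Scope classical_set_scope.
Local Open Scope ring_scope.

(** The member of the exhaustion at scale eps is the complement of a finite
union of tiny hexagons of a honeycomb, grouped so that every piece is round.

Let S be the frontier of Omega. It is compact and its components are points or
circles. By compactness S falls into finitely many clusters, each containing
one component C of S and lying in a thin neighbourhood of C ([clusters_exist]).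
A cluster is big if C has radius at least eps: the disc bounded by C then makes
it almost round by itself. The other clusters are small, of diameter about
2 eps. They may be thin dust, arbitrarily close to each other and to the big
ones, and have to be gathered into fat sets without cutting any of them.

To do so, divide the plane into square cells of side about 6 eps. The core of a
cell is out of reach of the small clusters that meet another cell. Every big
cluster, and every core that meets no big cluster, receives a label of its own.
The labels then spread over the whole plane in four stages, one for each parity
class of cells: at a stage, every connected piece of the part of a cell that is
not yet labelled touches a labelled point of that cell, and copies its label
([extend_labelling]). Clusters are never cut, the class of a label stays
connected, and because there are only four stages a label travels at most
across four neighbouring cells ([coarse_labelling]). This bounds the distance
from a point of a class to the set where its label was born by
sqrt 2 * 28.46 eps < 41 eps, whereas that set surrounds a disc of radius
r >= eps; so the class lies in a disc of radius r + 41 eps + small <= 43 r. For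
a label born in a core, the inner radius is eps and the outer radius is again
less than 43 eps ([all_round]).

Removing the outermost layer of hexagons makes the classes pairwise
non-adjacent; the classes that contain points of S are kept and their holes are
filled. A discrete form of Janiszewski's theorem ([janiszewski]) says that the
union of these filled classes does not separate the plane, and two filled
classes are either nested or apart ([fill_nested]). Hence the complement of the
union is connected and the components of the union are maximal filled classes,
which are round. In a honeycomb exactly three hexagons meet at a vertex, so the
boundary of any finite union of hexagons has one edge entering and one edge
leaving each of its vertices: it consists of disjoint simple closed polygons
([boundary_curves]).

The resulting domain contains infinity and avoids the boundary of Omega, and by
connectedness it lies in Omega ([connected_in_omega]); in this way only the
boundary components of Omega matter, and no information on the components of
its complement is required. Since the removed set lies within 100 eps of the
complement of Omega ([level]), letting eps decrease to 0 fast enough yields an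
increasing sequence that exhausts Omega ([exhausting_sequence]). *)

(** * Linked points and the triangular lattice *)

Section Linked.
Context {T : Type}.
Implicit Types (e : T -> T -> Prop) (A B : set T).

(** Reachability inside A by steps of e, encoded as membership in every set that
contains x and is stable under such steps; this makes induction along a path
immediate. *)
Definition linked e A x y : Prop :=
  A x /\ forall B : set T, B x -> (forall u v, B u -> A v -> e u v -> B v) -> B y.

Lemma linked_refl e A x : A x -> linked e A x x.
Proof. by split. Qed.

Lemma linked_l e A x y : linked e A x y -> A x. Proof. by case. Qed.

Lemma linked_r e A x y : linked e A x y -> A y.
Proof. by case=> Ax; apply. Qed.

Lemma linked_trans e A y x z : linked e A x y -> linked e A y z -> linked e A x z.
Proof.
move=> [Ax xy] [Ay yz]; split=> // B Bx Bs.
by apply: yz => //; apply: xy.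
Qed.

Lemma linked_step e A x y : A x -> A y -> e x y -> linked e A x y.
Proof. by move=> Ax Ay xy; split=> // B Bx /(_ _ _ Bx Ay xy). Qed.

Lemma linked_ind e A x (P : T -> Prop) : P x ->
  (forall u v, linked e A x u -> P u -> A v -> e u v -> P v) ->
  forall y, linked e A x y -> P y.
Proof.
move=> Px Ps y xy.
suff [//] : linked e A x y /\ P y.
case: (xy) => Ax /(_ [set y | linked e A x y /\ P y]); apply=> /=.
  by split=> //; exact: linked_refl.
move=> u v [xu Pu] Av uv; split; last exact: Ps uv.
apply: (linked_trans xu); apply: linked_step => //; exact: linked_r xu.
Qed.

Lemma linked_sym e A x y : (forall u v, e u v -> e v u) ->
  linked e A x y -> linked e A y x.
Proof.
move=> es xy; have Ax := linked_l xy; move: y xy.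
apply: linked_ind; first exact: linked_refl.
move=> u v xu ux Av uv; apply: linked_trans ux.
by apply: linked_step => //; [exact: linked_r xu | exact: es].
Qed.

Lemma linked_sub e A B x y : (linked e A x `<=` B) ->
  linked e A x y -> linked e B x y.
Proof.
move=> AB xy; have Bx := AB _ (linked_refl e (linked_l xy)); move: y xy.
apply: linked_ind; first exact: linked_refl.
move=> u v xu ux Av uv; apply: (linked_trans ux); apply: linked_step => //.
  exact: linked_r ux.
apply: AB; apply: (linked_trans xu); apply: linked_step => //.
exact: linked_r xu.
Qed.

Lemma linked_subset e A B x y : A `<=` B ->
  linked e A x y -> linked e B x y.
Proof. by move=> AB; apply: linked_sub => z /linked_r /AB. Qed.

(** A path that leaves B has a first step out of B. Every argument that pushes a
path until it meets an obstacle uses this. *)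
Lemma linked_frontier e A B x y : B x -> ~ B y -> linked e A x y ->
  exists u v, [/\ linked e A x u, B u, A v, ~ B v & e u v].
Proof.
move=> Bx nBy xy; apply: contrapT => H; apply: nBy.
move: y xy; apply: linked_ind => // u v xu Bu Av uv; apply: contrapT => nBv.
by apply: H; exists u, v.
Qed.

End Linked.

Definition site := (int * int)%type.

(** Sites are the vertices of the triangular lattice, drawn on the square lattice
with the antidiagonals added; [nb] is adjacency or equality. Triples of pairwise
adjacent sites are the vertices of the dual honeycomb. *)
Definition nb (s t : site) : Prop :=
  [/\ -1 <= t.1 - s.1 <= 1, -1 <= t.2 - s.2 <= 1
    & -1 <= (t.1 - s.1) + (t.2 - s.2) <= 1].

Lemma nb_refl s : nb s s. Proof. by rewrite /nb; split; lia. Qed.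

Lemma nb_sym s t : nb s t -> nb t s.
Proof. by move=> [H1 H2 H3]; split; lia. Qed.

Lemma int_primitive (g : int -> bool) :
  exists2 F : int -> bool, F 0 = false & forall i, F (i + 1) = F i (+) g i.
Proof.
pose up := fix up (n : nat) := if n is m.+1 then up m (+) g m%:Z else false.
pose dn := fix dn (n : nat) := if n is m.+1 then dn m (+) g (- m.+1%:Z) else false.
exists (fun i => match i with Posz n => up n | Negz n => dn n.+1 end) => //.
case=> [n|n].
  by rewrite -[Posz n + 1]/(Posz (n + 1)) addn1.
have -> : Negz n + 1 = - n%:Z by lia.
case: n => [|n] /=.
  by rewrite (_ : Negz 0 = -1%:Z) //; case: (g _).
rewrite (_ : Negz n.+1 = - n.+2%:Z) //.
by case: (dn n); case: (g (- n.+1%:Z)); case: (g (- n.+2%:Z)).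
Qed.

Lemma int_succ_ind (P : int -> Prop) : P 0 ->
  (forall i, P i <-> P (i + 1)) -> forall i, P i.
Proof.
move=> P0 PS; case=> [n|n].
  elim: n => // n IHn.
  by rewrite -(addn1 n) PoszD; apply: (PS _).1.
elim: n => [|n IHn]; apply: (PS _).2; first by rewrite (_ : _ + 1 = 0).
by rewrite (_ : _ + 1 = Negz n) //; lia.
Qed.

(** The first cohomology group of the triangulated plane with coefficients in
Z/2 vanishes: sum c along the horizontal axis and then along the vertical line.
The two triangles of a unit square show that the value does not depend on the
route, which gives the horizontal and the diagonal steps. *)
Lemma potential (c : site -> site -> bool) :
  (forall s t u, nb s t -> nb t u -> nb s u -> c s u = c s t (+) c t u) ->
  exists f : site -> bool, forall s t, nb s t -> f t = f s (+) c s t.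
Proof.
move=> cl.
have c0 s : c s s = false.
  have := cl s s s (nb_refl s) (nb_refl s) (nb_refl s).
  by case: (c s s).
have cC s t : nb s t -> c t s = c s t.
  move=> st; have := cl s t s st (nb_sym st) (nb_refl s).
  by rewrite c0; case: (c s t); case: (c t s).
have [F0 _ F0S] := int_primitive (fun i => c (i, 0) (i + 1, 0)).
have /choice[V Vp] (i : int) : exists F : int -> bool,
    F 0 = false /\ forall j, F (j + 1) = F j (+) c (i, j) (i, j + 1).
  by have [F ? ?] := int_primitive (fun j => c (i, j) (i, j + 1)); exists F.
pose f (s : site) := F0 s.1 (+) V s.1 s.2.
have fV i j : f (i, j + 1) = f (i, j) (+) c (i, j) (i, j + 1).
  by rewrite /f /= (Vp i).2 addbA.
have sq i j : c (i, j) (i, j + 1) (+) c (i, j + 1) (i + 1, j + 1) =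
              c (i, j) (i + 1, j) (+) c (i + 1, j) (i + 1, j + 1).
  have n1 : nb (i, j) (i + 1, j) by split => /=; lia.
  have n2 : nb (i + 1, j) (i, j + 1) by split => /=; lia.
  have n3 : nb (i, j) (i, j + 1) by split => /=; lia.
  have n4 : nb (i + 1, j) (i + 1, j + 1) by split => /=; lia.
  have n5 : nb (i, j + 1) (i + 1, j + 1) by split => /=; lia.
  have e1 := cl _ _ _ n1 n2 n3; have e2 := cl _ _ _ n2 n5 n4.
  by rewrite e1 e2 addbA.
have fH i j : f (i + 1, j) = f (i, j) (+) c (i, j) (i + 1, j).
  move: j; apply: int_succ_ind.
    by rewrite /f /= F0S (Vp i).1 (Vp (i + 1)).1 !addbF.
  move=> j; rewrite !fV.
  move: (sq i j); case: (c (i, j) (i, j + 1)); case: (c (i, j + 1) _);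
  case: (c (i, j) (i + 1, j)); case: (c (i + 1, j) _) => //=;
  by case: (f (i + 1, j)); case: (f (i, j)).
exists f.
have step s t : nb s t -> nb t s -> f t = f s (+) c s t -> f s = f t (+) c t s.
  by move=> st ts ->; rewrite (cC s t st); case: (f s); case: (c s t).
have fD i j : f (i, j + 1) = f (i + 1, j) (+) c (i + 1, j) (i, j + 1).
  have n1 : nb (i, j) (i + 1, j) by split => /=; lia.
  have n2 : nb (i + 1, j) (i, j + 1) by split => /=; lia.
  have n3 : nb (i, j) (i, j + 1) by split => /=; lia.
  rewrite fV fH (cl _ _ _ n1 n2 n3).
  by case: (f (i, j)); case: (c (i, j) (i + 1, j)); case: (c (i + 1, j) _).
move=> [i j] [k l] st; have [/= h1 h2 h3] := st.
have H : [\/ (k = i + 1 /\ l = j), (k = i /\ l = j + 1),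
   (i = k + 1 /\ l = j + 1) | [\/ (i = k + 1 /\ l = j), (k = i /\ j = l + 1),
   (k = i + 1 /\ j = l + 1) | (k = i /\ l = j)]].
  have [ek|[ek|ek]] : k = i \/ k = i + 1 \/ k = i - 1 by lia.
  - have [el|[el|el]] : l = j \/ l = j + 1 \/ l = j - 1 by lia.
    + by apply: Or44; apply: Or44.
    + by apply: Or42.
    + by apply: Or44; apply: Or42; lia.
  - have [el|el] : l = j \/ l = j - 1 by lia.
    + by apply: Or41.
    + by apply: Or44; apply: Or43; lia.
  - have [el|el] : l = j \/ l = j + 1 by lia.
    + by apply: Or44; apply: Or41; lia.
    + by apply: Or43; lia.
case: H => [[-> ->]|[-> ->]|[ei ->]|[[ei ->]|[-> ej]|[ek ej]|[-> ->]]].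
- exact: fH.
- exact: fV.
- by rewrite ei; apply: fD.
- rewrite ei; apply: step; [split => /=; lia|split => /=; lia|exact: fH].
- rewrite ej; apply: step; [split => /=; lia|split => /=; lia|exact: fV].
- rewrite ek ej; apply: step; [split => /=; lia|split => /=; lia|exact: fD].
- by rewrite c0 addbF.
Qed.

(** Janiszewski's theorem for the triangular lattice. If V, the part reachable
from u outside both sets, missed o, then the edges between V and A would form a
closed 1-cochain, because A and B have no edge in common, hence the coboundary
of some f. A path from u to o outside A uses no such edge, so f agrees at u and
o; along a path outside B, f changes exactly when V is left, so f differs. *)
Lemma janiszewski (A B : set site) (u o : site) :
  (forall a b, A a -> B b -> ~ nb a b) ->
  linked nb (~` A) u o -> linked nb (~` B) u o ->
  linked nb (~` (A `|` B)) u o.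
Proof.
move=> AB uA uB; pose V := linked nb (~` (A `|` B)) u.
have [//|nVo] := pselect (V o).
have Vu : V u.
  apply: linked_refl => -[]; [exact: linked_l uA|exact: linked_l uB].
have VA x : V x -> ~ A x by move=> Vx ?; apply: (linked_r Vx); left.
have VB x : V x -> ~ B x by move=> Vx ?; apply: (linked_r Vx); right.
have Vs x y : nb x y -> V x -> ~ A y -> ~ B y -> V y.
  move=> xy Vx nA nB; apply: (linked_trans Vx); apply: linked_step => //.
    exact: linked_r Vx.
  by case.
pose c x y := (`[< V x >] && `[< A y >]) || (`[< A x >] && `[< V y >]).
have [f fE] : exists f : site -> bool, forall s t, nb s t -> f t = f s (+) c s t.
  apply: potential => x y z xy yz xz; rewrite /c.
  have [[yx zy] zx] := (nb_sym xy, nb_sym yz, nb_sym xz).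
  have := Vs _ _ xy; have := Vs _ _ yz; have := Vs _ _ xz.
  have := Vs _ _ yx; have := Vs _ _ zy; have := Vs _ _ zx.
  have := AB x y; have := AB x z; have := AB y z.
  have := AB y x; have := AB z x; have := AB z y.
  have := VA x; have := VA y; have := VA z.
  have := VB x; have := VB y; have := VB z.
  case: (asboolP (V x)) => vx; case: (asboolP (V y)) => vy;
  case: (asboolP (V z)) => vz; case: (asboolP (A x)) => ax;
  case: (asboolP (A y)) => ay; case: (asboolP (A z)) => az //=; tauto.
have fA x : linked nb (~` A) u x -> f x = f u.
  move: x; apply: linked_ind => // x y ux <- nAy xy; rewrite (fE _ _ xy) /c.
  rewrite (asboolF nAy) (asboolF (linked_r ux)) andbF /=.
  by rewrite addbF.
have fB x : linked nb (~` B) u x -> f x = f u (+) ~~ `[< V x >].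
  move: x; apply: linked_ind; first by rewrite (asboolT Vu) addbF.
  move=> x y ux ihx nBy xy; rewrite (fE _ _ xy) ihx -addbA; congr (_ (+) _).
  have nBx := linked_r ux; rewrite /c.
  have := Vs _ _ xy; have := Vs _ _ (nb_sym xy); have := VA x; have := VA y.
  case: (asboolP (V x)) => vx; case: (asboolP (V y)) => vy;
  case: (asboolP (A x)) => ax; case: (asboolP (A y)) => ay //=; tauto.
have := fA _ uA; rewrite (fB _ uB) (asboolF nVo) /=.
by case: (f u).
Qed.

(** * Filling sets of sites *)

(** Adjacency or equality in the square lattice: the l^1 distance is at most 1,
written with linear inequalities only. *)
Definition adj4 (s t : site) : Prop :=
  -1 <= (t.1 - s.1) + (t.2 - s.2) <= 1 /\ -1 <= (t.1 - s.1) - (t.2 - s.2) <= 1.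

Lemma adj4_sym s t : adj4 s t -> adj4 t s.
Proof. by move=> [H1 H2]; split; lia. Qed.

Lemma adj4_nb s t : adj4 s t -> nb s t.
Proof. by move=> [H1 H2]; split; lia. Qed.

Lemma linked_rel T (e e' : T -> T -> Prop) A x y : (forall u v, e u v -> e' u v) ->
  linked e A x y -> linked e' A x y.
Proof.
move=> ee xy; have Ax := linked_l xy; move: y xy; apply: linked_ind.
  exact: linked_refl.
move=> u v xu xu' Av uv; apply: (linked_trans xu'); apply: linked_step => //.
  exact: linked_r xu.
exact: ee.
Qed.

Lemma linked_row (A : set site) (j a b : int) : a <= b ->
  (forall i, a <= i <= b -> A (i, j)) -> linked adj4 A (a, j) (b, j).
Proof.
move=> ab; have [n ->] : exists n : nat, b = a + n%:Z.
  by exists (absz (b - a)); lia.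
elim: n => [|n IHn] H.
  by rewrite addr0; apply: linked_refl; apply: H; lia.
have IH : linked adj4 A (a, j) (a + n%:Z, j) by apply: IHn => i ?; apply: H; lia.
apply: (linked_trans IH); apply: linked_step; last by split => /=; lia.
  exact: linked_r IH.
by apply: H; lia.
Qed.

Lemma linked_col (A : set site) (i a b : int) : a <= b ->
  (forall j, a <= j <= b -> A (i, j)) -> linked adj4 A (i, a) (i, b).
Proof.
move=> ab; have [n ->] : exists n : nat, b = a + n%:Z.
  by exists (absz (b - a)); lia.
elim: n => [|n IHn] H.
  by rewrite addr0; apply: linked_refl; apply: H; lia.
have IH : linked adj4 A (i, a) (i, a + n%:Z) by apply: IHn => k ?; apply: H; lia.
apply: (linked_trans IH); apply: linked_step; last by split => /=; lia.
  exact: linked_r IH.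
by apply: H; lia.
Qed.

Lemma linked_row' (A : set site) (j a b : int) :
  (forall i, a <= i <= b \/ b <= i <= a -> A (i, j)) -> linked adj4 A (a, j) (b, j).
Proof.
move=> H; have [ab|ab] : a <= b \/ b <= a by lia.
  by apply: linked_row => // i ?; apply: H; left.
apply: linked_sym; first exact: adj4_sym.
by apply: linked_row => // i ?; apply: H; right.
Qed.

Lemma linked_col' (A : set site) (i a b : int) :
  (forall j, a <= j <= b \/ b <= j <= a -> A (i, j)) -> linked adj4 A (i, a) (i, b).
Proof.
move=> H; have [ab|ab] : a <= b \/ b <= a by lia.
  by apply: linked_col => // j ?; apply: H; left.
apply: linked_sym; first exact: adj4_sym.
by apply: linked_col => // j ?; apply: H; right.
Qed.

Lemma linked_box (A : set site) (a b c d : int) :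
  (forall s : site, A s <-> a <= s.1 <= b /\ c <= s.2 <= d) ->
  forall s t, A s -> A t -> linked adj4 A s t.
Proof.
move=> HA [i j] [k l] /HA /= [h1 h2] /HA /= [h3 h4].
apply: (@linked_trans _ _ _ (k, j)).
  by apply: linked_row' => m Hm; apply/HA => /=; lia.
by apply: linked_col' => m Hm; apply/HA => /=; lia.
Qed.

Definition outside (N : int) (s : site) : Prop :=
  [\/ s.1 < - N, N < s.1 | s.2 < - N \/ N < s.2].

(** The outside of a box is connected: slide to the line of a side of the box and
turn around it through its corners. *)
Lemma linked_outside (N : int) s t : 0 <= N ->
  outside N s -> outside N t -> linked nb (outside N) s t.
Proof.
move=> N0; suff H u : outside N u -> linked adj4 (outside N) u (N + 1, N + 1).
  move=> os ot; apply: linked_rel adj4_nb _.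
  apply: (linked_trans (H _ os)); apply: linked_sym; first exact: adj4_sym.
  exact: H.
(* rotate around the box through its corners *)
pose Q := linked adj4 (outside N).
have c1 j : Q (N + 1, j) (N + 1, N + 1).
  by apply: linked_col' => m _; apply: Or32 => /=; lia.
have c2 i : Q (i, N + 1) (N + 1, N + 1).
  by apply: linked_row' => m _; apply: Or33; right => /=; lia.
have c3 j : Q (- N - 1, j) (- N - 1, N + 1).
  by apply: linked_col' => m _; apply: Or31 => /=; lia.
have c4 i : Q (i, - N - 1) (N + 1, - N - 1).
  by apply: linked_row' => m _; apply: Or33; left => /=; lia.
case: u => i j [/= h|/= h|/= [h|h]].
- apply: (@linked_trans _ _ _ (- N - 1, j)).
    by apply: linked_row' => m Hm; apply: Or31 => /=; lia.
  exact: linked_trans (c3 _) (c2 _).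
- apply: (@linked_trans _ _ _ (N + 1, j)).
    by apply: linked_row' => m Hm; apply: Or32 => /=; lia.
  exact: c1.
- apply: (@linked_trans _ _ _ (i, - N - 1)).
    by apply: linked_col' => m Hm; apply: Or33; left => /=; lia.
  exact: linked_trans (c4 _) (c1 _).
- apply: (@linked_trans _ _ _ (i, N + 1)).
    by apply: linked_col' => m Hm; apply: Or33; right => /=; lia.
  exact: c2.
Qed.

Lemma linked_setT s t : linked nb setT s t.
Proof.
apply: linked_rel adj4_nb _; case: s t => [i j] [k l].
apply: (@linked_trans _ _ _ (k, j)); first exact: linked_row'.
exact: linked_col'.
Qed.

Section Fill.
Variable o : site.

(** For a finite set P and a far away base site o, this is P together with its
bounded complementary parts. *)
Definition fill (P : set site) : set site := [set u | ~ linked nb (~` P) u o].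

Definition sconnected (P : set site) := forall x y, P x -> P y -> linked nb P x y.

Lemma sub_fill P : P `<=` fill P.
Proof. by move=> x Px xo; exact: (linked_l xo). Qed.

(** A site of a hole of P cannot get away without touching P, and until then it
stays in the hole. *)
Lemma fill_reach P u : fill P u -> P !=set0 ->
  exists2 w, P w & linked nb (fill P) u w.
Proof.
move=> Fu [p Pp]; have [Pu|nPu] := pselect (P u).
  by exists u => //; apply: linked_refl.
pose V := linked nb (~` P) u.
have nVp : ~ V p by move=> h; exact: (linked_r h).
have Vu : V u by apply: linked_refl.
have [v [w [_ Vv _ nVw vw]]] := linked_frontier Vu nVp (linked_setT u p).
have Pw : P w.
  apply: contrapT => nPw; apply: nVw; apply: (linked_trans Vv).
  by apply: linked_step => //; exact: linked_r Vv.
exists w => //.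
have VF z : V z -> fill P z by move=> Vz zo; apply: Fu; apply: linked_trans zo.
apply: (@linked_trans _ _ _ v); last first.
  by apply: linked_step => //; [exact: VF | exact: sub_fill].
by apply: linked_sub Vv => z; exact: VF.
Qed.

Lemma fill_connected P : sconnected P -> sconnected (fill P).
Proof.
move=> cP x y Fx Fy; have [P0|] := pselect (P !=set0); last first.
  move=> /set0P/negP/negPn/eqP P0; exfalso; apply: Fx; rewrite P0 setC0.
  exact: linked_setT.
have [v Pv xv] := fill_reach Fx P0.
have [w Pw yw] := fill_reach Fy P0.
apply: (linked_trans xv); apply: (@linked_trans _ _ _ w); last first.
  by apply: linked_sym yw; exact: nb_sym.
by apply: linked_subset (cP _ _ Pv Pw); exact: sub_fill.
Qed.

Lemma fill_trans P Q : P `<=` fill Q -> fill P `<=` fill Q.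
Proof.
move=> PQ u Fu uo; apply: Fu; apply: linked_sub (uo) => z uz Pz.
apply: (PQ _ Pz); apply: linked_trans uo.
by apply: linked_sym uz; exact: nb_sym.
Qed.

Lemma fill_edge P x y : fill P x -> ~ fill P y -> nb x y -> P x.
Proof.
move=> Px nPy xy; apply: contrapT => nP; apply: Px.
have /contrapT yo := nPy; apply: linked_trans (yo); apply: linked_step => //.
exact: linked_l yo.
Qed.

(** Each of the connected sets P and Q lies entirely inside or entirely outside
the fill of the other. If both are outside, a common point of the fills would
connect to Q within the fill of Q, hence outside P, and would escape with Q; and
an edge between the fills would join P to Q by [fill_edge]. *)
Lemma fill_nested P Q : sconnected P -> sconnected Q -> Q !=set0 ->
  (forall a b, P a -> Q b -> ~ nb a b) ->
  [\/ fill P `<=` fill Q, fill Q `<=` fill P |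
      forall a b, fill P a -> fill Q b -> ~ nb a b].
Proof.
move=> cP cQ Q0 PQ.
have QP a b : Q a -> P b -> ~ nb a b by move=> ? ? /nb_sym; apply: PQ.
have dich (A B : set site) : sconnected A -> (forall a b, A a -> B b -> ~ nb a b) ->
    A `<=` fill B \/ (forall a, A a -> ~ fill B a).
  move=> cA AB; have [[a [Aa Fa]]|H] := pselect (exists a, A a /\ fill B a).
    left=> x Ax xo; apply: Fa; apply: linked_trans xo.
    apply: linked_subset (cA _ _ Aa Ax) => z Az Bz.
    exact: AB Az Bz (nb_refl z).
  by right=> a Aa Fa; apply: H; exists a.
have [?|PnQ] := dich _ _ cP PQ; first by apply: Or31; apply: fill_trans.
have [?|QnP] := dich _ _ cQ QP; first by apply: Or32; apply: fill_trans.
have disj a : fill P a -> ~ fill Q a.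
  move=> Fa Ga; have nPa : ~ P a by move=> /PnQ.
  have nQa : ~ Q a by move=> /QnP.
  have [w Qw aw] := fill_reach Ga Q0.
  apply: (QnP _ Qw) => wo; apply: Fa; apply: linked_trans wo.
  by apply: linked_subset aw => z Gz /PnQ.
apply: Or33 => a b Fa Gb ab.
have Pa : P a by apply: fill_edge Fa _ ab => /disj.
have Qb : Q b by apply: fill_edge Gb _ (nb_sym ab); exact: disj.
exact: PQ Pa Qb ab.
Qed.

(** Repetitions are allowed in the family: two members that touch are equal. *)
Lemma janiszewski_bigcup (P : nat -> set site) n u :
  (forall i k a b, P i a -> P k b -> nb a b -> P i = P k) ->
  (forall i, (i < n)%N -> linked nb (~` P i) u o) ->
  linked nb (~` \bigcup_(i in `I_n) P i) u o.
Proof.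
move=> sep; elim: n => [|n IHn] H.
  by rewrite II0 bigcup_set0 setC0; exact: linked_setT.
have IH : linked nb (~` \bigcup_(i in `I_n) P i) u o.
  by apply: IHn => i ilt; apply: H; rewrite ltnW.
have -> : \bigcup_(i in `I_n.+1) P i = \bigcup_(i in `I_n) P i `|` P n.
  by rewrite bigcup_mkord big_ord_recr /= -bigcup_mkord.
have [[i [ilt Pin]]|nP] := pselect (exists i, (i < n)%N /\ P i = P n).
  rewrite -Pin setUidl //; exact: (@bigcup_sup _ _ i).
apply: janiszewski => //; last exact: H.
move=> a b [i ilt Pia] Pnb ab; apply: nP; exists i; split=> //.
exact: sep Pia Pnb ab.
Qed.

End Fill.

Lemma ex_maximal (n : nat) (D : nat -> Prop) (le : nat -> nat -> Prop) :
  (forall i, le i i) -> (forall j i k, le i j -> le j k -> le i k) ->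
  (exists2 i, (i < n)%N & D i) ->
  exists i, [/\ (i < n)%N, D i & forall k, (k < n)%N -> D k -> le i k -> le k i].
Proof.
move=> lexx letr; elim: n => [[] //|n IHn] [i ilt Di].
have [[j jlt Dj]|H] := pselect (exists2 i, (i < n)%N & D i); last first.
  have ein : i = n.
    by apply/eqP; rewrite eqn_leq -ltnS ilt leqNgt; apply/negP => ?; apply: H; exists i.
  exists i; split=> // k; rewrite ltnS leq_eqVlt => /orP[/eqP-> _|klt Dk].
    by rewrite ein.
  by case: H; exists k.
have [m [mlt Dm mmax]] := IHn (ex_intro2 _ _ j jlt Dj).
have [[Dn lmn]|H] := pselect (D n /\ le m n).
  exists n; split=> // k; rewrite ltnS leq_eqVlt => /orP[/eqP-> //|klt Dk lnk].
  exact: letr (mmax _ klt Dk (letr _ _ _ lmn lnk)) lmn.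
exists m; split=> //; first by rewrite ltnW.
move=> k; rewrite ltnS leq_eqVlt => /orP[/eqP-> Dn lmn|]; last exact: mmax.
by case: H.
Qed.

(** A maximal fill among those containing u is a connected component of the union
of all fills: whatever touches it is nested with it by [fill_nested]. *)
Lemma fill_maximal (o : site) (P : nat -> set site) n u :
  (forall i k a b, P i a -> P k b -> nb a b -> P i = P k) ->
  (forall i, (i < n)%N -> sconnected (P i) /\ P i !=set0) ->
  (exists2 i, (i < n)%N & fill o (P i) u) ->
  exists i, [/\ (i < n)%N, fill o (P i) u &
    forall v w k, (k < n)%N -> fill o (P i) v -> fill o (P k) w -> nb v w ->
      fill o (P i) w].
Proof.
move=> sep conn exu.
have [||i [ilt Fi imax]] := @ex_maximal n (fun i => fill o (P i) u)
    (fun i k => fill o (P i) `<=` fill o (P k)) _ _ exu.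
- by move=> i.
- by move=> j i k ij jk; apply: subset_trans ij jk.
exists i; split=> // v w k klt Fv Fw vw.
have [[ci i0] [ck k0]] := (conn _ ilt, conn _ klt).
have [Pik|Pik] := pselect (P i = P k); first by rewrite Pik.
have nonadj a b : P i a -> P k b -> ~ nb a b.
  by move=> ? ? ab; apply: Pik; apply: sep ab.
have [ik|ki|H] := fill_nested o ci ck k0 nonadj.
- by apply: (imax k klt (ik _ Fi) ik).
- exact: ki.
- by case: (H _ _ Fv Fw vw).
Qed.

(** * Spreading labels without cutting atoms *)

Section Extend.
Context {X J K : Type} (e : X -> X -> Prop) (atom : K -> set X).
Hypothesis esym : forall x y, e x y -> e y x.
Hypothesis atom_linked : forall k x y, atom k x -> atom k y -> linked e (atom k) x y.

Definition linked_classes (lam : X -> option J) := forall x y j,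
  lam x = Some j -> lam y = Some j -> linked e [set z | lam z = Some j] x y.

Definition atom_constant (lam : X -> option J) :=
  forall k x y, atom k x -> atom k y -> lam x = lam y.

(** One stage of the spreading of labels. The sets H i are connected, pairwise
disjoint and meet the labelled part, so every connected piece Y of the
unlabelled part of H i is adjacent to a labelled point of H i. All points of Y
copy the label of the same such point, which keeps the classes connected; a
connected atom that is still unlabelled lies in a single piece, so it is not
cut. *)
Lemma extend_labelling (I : Type) (lam : X -> option J) (Col : set I) (H : I -> set X) :
  linked_classes lam -> atom_constant lam ->
  (forall i i' x, Col i -> Col i' -> H i x -> H i' x -> i = i') ->
  (forall i x y, Col i -> H i x -> H i y -> linked e (H i) x y) ->
  (forall i, Col i -> exists x j, H i x /\ lam x = Some j) ->
  (forall i k x y, Col i -> H i x -> lam x = None -> atom k x -> atom k y -> H i y) ->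
  exists lam' : X -> option J,
  [/\ linked_classes lam', atom_constant lam',
      (forall x j, lam x = Some j -> lam' x = Some j),
      (forall i x, Col i -> H i x -> exists j, lam' x = Some j) &
      (forall x j, lam' x = Some j -> lam x = Some j \/
         exists i y, [/\ Col i, H i x, H i y & lam y = Some j])].
Proof.
move=> clam alam Hdisj Hlink Hdom Hsat.
pose free i := H i `&` [set x | lam x = None].
pose Y i := linked e (free i).
(* The label copied by a piece is chosen as a function of the piece, seen as a
   set, so that all its points agree. *)
pose Q (p : I * set X) j := exists y z, [/\ H p.1 y, lam y = Some j, p.2 z & e z y].
have /choice[g gP] (p : I * set X) : exists w : option J,
    (exists j, Q p j) -> exists2 j, w = Some j & Q p j.
  have [[j Qj]|nQ] := pselect (exists j, Q p j); first by exists (Some j) => _; exists j.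
  by exists None.
have /choice[lam' lamP] (x : X) : exists w : option J,
    [/\ forall j, lam x = Some j -> w = Some j,
        lam x = None -> forall i, Col i -> H i x -> w = g (i, Y i x) &
        lam x = None -> (forall i, Col i -> ~ H i x) -> w = None].
  case: (lam x) => [j|]; first by exists (Some j).
  have [[i [Ci Hi]]|nH] := pselect (exists i, Col i /\ H i x).
    exists (g (i, Y i x)); split=> // [_ i' Ci' Hi'|_ /(_ i Ci)//].
    by rewrite (Hdisj _ _ _ Ci' Ci Hi' Hi).
  by exists None; split=> // _ i Ci Hi; case: nH; exists i.
have new i x : Col i -> H i x -> lam x = None ->
    exists j, lam' x = Some j /\ Q (i, Y i x) j.
  move=> Ci Hi nx; have [_ /(_ nx i Ci Hi) -> _] := lamP x.
  have Yx : Y i x x by apply: linked_refl.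
  have [y [j [Hy yj]]] := Hdom _ Ci.
  have nYy : ~ Y i x y by move=> h; have [_ /=] := linked_r h; rewrite yj.
  have [u [v [_ Yu Hv nYv uv]]] := linked_frontier Yx nYy (Hlink _ _ _ Ci Hi Hy).
  suff [j' vj'] : exists j', lam v = Some j'.
    have [|w -> Qw] := gP (i, Y i x); first by exists j', v, u.
    by exists w.
  case E : (lam v) => [j'|]; first by exists j'.
  case: nYv; apply: (linked_trans Yu); apply: linked_step => //.
  exact: linked_r Yu.
have Yeq i x y : Y i x y -> Y i x = Y i y.
  move=> xy; apply/seteqP; split=> z; last exact: linked_trans.
  by apply: linked_trans; apply: linked_sym xy.
have YlamE i x y : Col i -> Y i x y -> lam' x = lam' y.
  move=> Ci xy; have [Hx nx] := linked_l xy; have [Hy ny] := linked_r xy.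
  have [_ /(_ nx i Ci Hx) -> _] := lamP x; have [_ /(_ ny i Ci Hy) -> _] := lamP y.
  by rewrite (Yeq _ _ _ xy).
exists lam'; split.
- have anchor x j : lam' x = Some j ->
      exists2 y, lam y = Some j & linked e [set z | lam' z = Some j] x y.
    case E : (lam x) => [j'|].
      have [/(_ _ E) ex _ _] := lamP x; rewrite ex => -[jj].
      by exists x; [rewrite E jj | apply: linked_refl; rewrite /= ex jj].
    have [[i [Ci Hi]] xj|nH] := pselect (exists i, Col i /\ H i x); last first.
      have [_ _ ->//] := lamP x; move=> i Ci Hi; case: nH; by exists i.
    have [j' [xj' [y [z [/= Hy yj Yz zy]]]]] := new _ _ Ci Hi E.
    move: xj' yj; rewrite xj => -[<-] yj; exists y => //.
    have sub w : Y i x w -> lam' w = Some j by move=> /(YlamE _ _ _ Ci) <-.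
    apply: (@linked_trans _ _ _ z); first by apply: linked_sub Yz => w /sub.
    apply: linked_step => //=; first exact: sub.
    by have [/(_ _ yj)] := lamP y.
  move=> x y j xj yj; have [x' x'j xx'] := anchor _ _ xj.
  have [y' y'j yy'] := anchor _ _ yj; apply: (linked_trans xx').
  apply: (@linked_trans _ _ _ y'); last exact: linked_sym yy'.
  apply: linked_subset (clam _ _ _ x'j y'j) => z /= zj.
  by have [/(_ _ zj)] := lamP z.
- move=> k x y kx ky; have xy := alam _ _ _ kx ky.
  case E : (lam x) => [j|].
    have yE : lam y = Some j by rewrite -xy.
    by have [/(_ _ E) -> _ _] := lamP x; have [/(_ _ yE) -> _ _] := lamP y.
  have [[i [Ci Hi]]|nH] := pselect (exists i, Col i /\ H i x).
    apply: (YlamE i) => //; apply: linked_sub (atom_linked kx ky) => z xz.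
    have kz := linked_r xz; split; first exact: Hsat kx kz.
    by rewrite /= -(alam _ _ _ kx kz).
  have [_ _ -> //] := lamP x; last by move=> i Ci Hi; apply: nH; exists i.
  have [_ _ -> //] := lamP y; first by rewrite -xy.
  move=> i Ci Hi; apply: nH; exists i; split=> //.
  by apply: Hsat ky kx => //; rewrite -xy.
- by move=> x j xj; have [/(_ _ xj)] := lamP x.
- move=> i x Ci Hi; case E : (lam x) => [j|].
    by exists j; have [/(_ _ E)] := lamP x.
  by have [j [-> _]] := new _ _ Ci Hi E; exists j.
- move=> x j; case E : (lam x) => [j'|].
    by have [/(_ _ E) -> _ _] := lamP x; left.
  have [[i [Ci Hi]] xj|nH] := pselect (exists i, Col i /\ H i x); last first.
    by have [_ _ ->//] := lamP x; move=> i Ci Hi; case: nH; exists i.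
  have [j' [xj' [y [z [/= Hy yj Yz zy]]]]] := new _ _ Ci Hi E.
  by move: xj' yj; rewrite xj => -[<-] yj; right; exists i, y.
Qed.

End Extend.

(** Closeness in the sup norm. *)
Definition within (n : int) (x y : site) : Prop :=
  - n <= x.1 - y.1 <= n /\ - n <= x.2 - y.2 <= n.

Section Coarse.
Context {K : Type} (atom : K -> set site) (l d : int).
Hypothesis d_ge0 : 0 <= d.
Hypothesis ld : 2 * d + 3 <= l.
Hypothesis atom_linked :
  forall k x y, atom k x -> atom k y -> linked adj4 (atom k) x y.
Hypothesis atom_disjoint : forall k k' x, atom k x -> atom k' x -> k = k'.

Definition small k := forall x y, atom k x -> atom k y -> within d x y.

Definition cell (c : site) : set site :=
  [set x : site | c.1 * l <= x.1 <= c.1 * l + l - 1 /\ c.2 * l <= x.2 <= c.2 * l + l - 1].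

Definition core (c : site) : set site :=
  [set x : site | c.1 * l + d + 1 <= x.1 <= c.1 * l + l - d - 2 /\
           c.2 * l + d + 1 <= x.2 <= c.2 * l + l - d - 2].

Definition hull (C : set site) : set site :=
  C `|` [set x | exists k y, [/\ small k, atom k x, atom k y & C y]].

Definition alive c := forall k x, atom k x -> core c x -> small k.

(** Where a label is born: a big atom for the label [inl], the core of a cell
without big atoms for the label [inr]. *)
Definition base (j : K + site) : set site :=
  match j with
  | inl k => [set x | ~ small k /\ atom k x]
  | inr c => [set x | alive c /\ hull (core c) x]
  end.

Lemma core_cell c : core c `<=` cell c.
Proof. by move=> x [h1 h2]; split; lia. Qed.

Lemma hullP C x : hull C x -> exists2 y, C y & within d x y.
Proof.
move=> [Cx|[k [y [sk kx ky Cy]]]]; last by exists y => //; apply: sk kx ky.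
by exists x => //; rewrite /within; lia.
Qed.

Lemma hull_sub C D : C `<=` D -> hull C `<=` hull D.
Proof.
move=> CD x [/CD ?|[k [y [? ? ? /CD ?]]]]; first by left.
by right; exists k, y.
Qed.

Lemma hull_linked C : (forall x y, C x -> C y -> linked adj4 C x y) ->
  forall x y, hull C x -> hull C y -> linked adj4 (hull C) x y.
Proof.
move=> Clink; have anchor x : hull C x -> exists2 y, C y & linked adj4 (hull C) x y.
  move=> [Cx|[k [y [sk kx ky Cy]]]].
    by exists x => //; apply: linked_refl; left.
  exists y => //; apply: linked_sub (atom_linked kx ky) => z yz; have kz := linked_r yz.
  by right; exists k, y.
move=> x y /anchor[x' Cx' xx'] /anchor[y' Cy' yy'].
apply: (linked_trans xx'); apply: (@linked_trans _ _ _ y').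
  by apply: linked_subset (Clink _ _ Cx' Cy'); left.
by apply: linked_sym yy'; exact: adj4_sym.
Qed.

Lemma hull_saturated C k x y : small k -> hull C x -> atom k x -> atom k y -> hull C y.
Proof.
move=> sk [Cx|[k' [z [sk' k'x k'z Cz]]]] kx ky; first by right; exists k, x.
have kk := atom_disjoint kx k'x; rewrite kk in ky.
by right; exists k', z.
Qed.

Lemma cell_linked c x y : cell c x -> cell c y -> linked adj4 (cell c) x y.
Proof. exact: (@linked_box (cell c) _ _ _ _ (fun s => iff_refl _)). Qed.

Lemma core_linked c x y : core c x -> core c y -> linked adj4 (core c) x y.
Proof. exact: (@linked_box (core c) _ _ _ _ (fun s => iff_refl _)). Qed.

Lemma cell_near c c' x x' : cell c x -> cell c' x' ->
  within (l - 1) x x' -> within 1 c c'.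
Proof. by move=> [h1 h2] [h3 h4] [h5 h6]; split; nia. Qed.

(** The cells are wider than 2d + 1, so only neighbouring cells are met by the
same small atom. *)
Lemma hull_cell_near c c' x : hull (cell c) x -> hull (cell c') x -> within 1 c c'.
Proof.
move=> /hullP[y cy [h1 h2]] /hullP[z cz [h3 h4]].
by apply: (cell_near cy cz); split; lia.
Qed.

Lemma hull_core_eq c c' x : hull (core c) x -> hull (core c') x -> c = c'.
Proof.
move=> /hullP[y [cy1 cy2] [h1 h2]] /hullP[z [cz1 cz2] [h3 h4]].
have e1 : c.1 = c'.1 by nia.
have e2 : c.2 = c'.2 by nia.
by move: e1 e2; case: c {cy1 cy2}; case: c' {cz1 cz2} => ? ? ? ? /= -> ->.
Qed.

Lemma hull_cell_dist c c' x y : hull (cell c) x -> hull (cell c') y -> within 3 c c' ->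
  within (4 * l + 2 * d) x y.
Proof.
move=> /hullP[x' [a1 a2] [b1 b2]] /hullP[y' [c1 c2] [e1 e2]] [f1 f2].
have g1 : - 3 * l <= c.1 * l - c'.1 * l <= 3 * l by nia.
have g2 : - 3 * l <= c.2 * l - c'.2 * l <= 3 * l by nia.
by split; lia.
Qed.

(** The cell c' meets the hull of the core of c0, hence is a neighbour of c0, so
that x belongs to a cell at distance at most 4 from c0. *)
Lemma hull_core_dist c0 c c' x b : hull (cell c) x -> hull (cell c') b -> within 3 c c' ->
  hull (core c0) b ->
  c0.1 * l - 4 * l - d <= x.1 <= c0.1 * l + 5 * l + d /\
  c0.2 * l - 4 * l - d <= x.2 <= c0.2 * l + 5 * l + d.
Proof.
move=> /hullP[x' [a1 a2] [b1 b2]] hb [f1 f2] hb0.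
have [i1 i2] := hull_cell_near hb (hull_sub (@core_cell c0) hb0).
have g1 : - 4 * l <= c.1 * l - c0.1 * l <= 4 * l by nia.
have g2 : - 4 * l <= c.2 * l - c0.2 * l <= 4 * l by nia.
by split; lia.
Qed.

(** A small atom does not reach two cores, and a core with a big atom is the base
of no label. *)
Lemma base_inj j j' x : base j x -> base j' x -> j = j'.
Proof.
case: j => [k|c]; case: j' => [k'|c'] /=.
- by move=> [_ kx] [_ k'x]; rewrite (atom_disjoint kx k'x).
- move=> [bk kx] [ac [cx|[k2 [y [sk kx2 ky cy]]]]]; case: bk; first exact: ac kx cx.
  by rewrite (atom_disjoint kx kx2).
- move=> [ac [cx|[k2 [y [sk kx2 ky cy]]]]] [bk kx]; case: bk; first exact: ac kx cx.
  by rewrite (atom_disjoint kx kx2).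
- by move=> [_ h1] [_ h2]; rewrite (hull_core_eq h1 h2).
Qed.

Lemma base_saturated j k x y : base j x -> atom k x -> atom k y -> base j y.
Proof.
case: j => [k'|c] /=.
  by move=> [bk k'x] kx ky; split=> //; rewrite (atom_disjoint k'x kx).
move=> [ac hx] kx ky; split=> //; apply: hull_saturated (hx) (kx) ky.
case: hx => [cx|[k2 [z [sk kx2 kz cz]]]]; first exact: ac kx cx.
by rewrite (atom_disjoint kx kx2).
Qed.

Lemma base_linked j x y : base j x -> base j y -> linked adj4 (base j) x y.
Proof.
case: j => [k|c] /=.
  by move=> [bk kx] [_ ky]; apply: linked_subset (atom_linked kx ky) => z.
move=> [ac hx] [_ hy].
by apply: linked_subset (hull_linked (@core_linked c) hx hy) => z.
Qed.

(** After n + 1 stages every label has travelled across a chain of at most n + 1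
successive neighbouring cells. *)
Definition reached (n : int) (lam : site -> option (K + site)) :=
  forall x j, lam x = Some j -> base j x \/
    exists c c' b, [/\ hull (cell c) x, hull (cell c') b, base j b & within n c c'].

Definition good (n : int) (lam : site -> option (K + site)) :=
  [/\ linked_classes adj4 lam, atom_constant atom lam, reached n lam &
      forall x j, base j x -> lam x = Some j].

Lemma good_initial : exists lam, good (-1) lam.
Proof.
have /choice[lam lamP] (x : site) : exists w : option (K + site),
    (forall j, base j x -> w = Some j) /\ (forall j, w = Some j -> base j x).
  have [[j bj]|nb] := pselect (exists j, base j x).
    exists (Some j); split=> [j' bj'|j' [<-]//]; by rewrite (base_inj bj bj').
  by exists None; split=> // j bj; case: nb; exists j.
exists lam; split.
- move=> x y j /(lamP _).2 bx /(lamP _).2 by_.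
  by apply: linked_subset (base_linked bx by_) => z bz /=; apply: (lamP _).1.
- move=> k x y kx ky; case E : (lam x) => [j|].
    by rewrite ((lamP y).1 j) //; apply: base_saturated kx ky; apply: (lamP _).2.
  case E' : (lam y) => [j|] //; have := base_saturated ((lamP y).2 _ E') ky kx.
  by move=> /(lamP _).1; rewrite E.
- by move=> x j /(lamP _).2; left.
- by move=> x j; apply: (lamP _).1.
Qed.

(** Two different cells of the same parity class are not neighbours, so their
hulls are disjoint. *)
Definition colour (p q : int) : set site :=
  [set c : site | (exists m, c.1 = 2 * m + p) /\ (exists m, c.2 = 2 * m + q)].

(** Each hull of a cell meets the initially labelled part: its core is labelled
if it meets no big atom, and otherwise contains a point of a big atom. A newly
labelled x in the hull of c copies from some y in that hull; if y had itself got
its label in the hull of c1, then y shows that c and c1 are neighbours. *)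
Lemma good_stage (n : int) lam p q : -1 <= n -> good n lam ->
  exists lam', [/\ good (n + 1) lam', forall x j, lam x = Some j -> lam' x = Some j &
    forall c x, colour p q c -> cell c x -> exists j, lam' x = Some j].
Proof.
move=> n1 [cl ac rl bl].
have [||||lam' [cl' ac' ext def new]] := @extend_labelling _ _ _ _ _ adj4_sym
    atom_linked _ _ (colour p q) (fun c => hull (cell c)) cl ac.
- move=> c c' x [[m1 e1] [m2 e2]] [[m3 e3] [m4 e4]] hx hx'.
  have [h1 h2] := hull_cell_near hx hx'.
  have : c.1 = c'.1 by lia.
  have : c.2 = c'.2 by lia.
  by clear; case: c; case: c' => ? ? ? ? /= -> ->.
- move=> c x y _; exact: hull_linked (@cell_linked c) x y.
- move=> c _; pose x0 : site := (c.1 * l + d + 1, c.2 * l + d + 1).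
  have cx0 : core c x0 by split => /=; lia.
  have [a|na] := pselect (alive c).
    exists x0, (inr c); split; first by left; apply: core_cell.
    by apply: bl; split=> //; left.
  have [k [x [kx cx bk]]] : exists k x, [/\ atom k x, core c x & ~ small k].
    apply: contrapT => H; apply: na => k x kx cx; apply: contrapT => bk.
    by apply: H; exists k, x.
  exists x, (inl k); split; first by left; apply: core_cell.
  by apply: bl; split.
- move=> c k x y _ hx nx kx ky; apply: hull_saturated (hx) (kx) (ky).
  apply: contrapT => bk; have : lam x = Some (inl k) by apply: bl; split.
  by rewrite nx.
exists lam'; split=> //; last by move=> c x pc cx; apply: (def c) => //; left.
split=> //; last by move=> x j /bl /ext.
move=> x j /new[/rl[|[c [c' [b [hx hb bb [h1 h2]]]]]]|[c [y [pc hx hy yj]]]].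
- by left.
- right; exists c, c', b; split=> //; by split; lia.
- right; have [by_|[c1 [c' [b [hy1 hb bb [h1 h2]]]]]] := rl _ _ yj.
    by exists c, c, y; split=> //; split; lia.
  exists c, c', b; split=> //.
  by have [h3 h4] := hull_cell_near hy hy1; split; lia.
Qed.

(** Four stages, one for each parity class, label every site. *)
Lemma coarse_labelling : exists lam : site -> K + site,
  [/\ forall x y, lam x = lam y -> linked adj4 [set z | lam z = lam x] x y,
      forall k x y, atom k x -> atom k y -> lam x = lam y,
      forall j x, base j x -> lam x = j &
      forall x, base (lam x) x \/ exists c c' b,
        [/\ hull (cell c) x, hull (cell c') b, base (lam x) b & within 3 c c']].
Proof.
have [lam0 g0] := good_initial.
have [//|lam1 [g1 e1 d1]] := good_stage 0 0 _ g0.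
have [//|lam2 [g2 e2 d2]] := good_stage 0 1 _ g1.
have [//|lam3 [g3 e3 d3]] := good_stage 1 0 _ g2.
have [//|lam4 [g4 e4 d4]] := good_stage 1 1 _ g3.
have tot x : exists j, lam4 x = Some j.
  have l0 : 0 < l by lia.
  pose c : site := ((x.1 %/ l)%Z, (x.2 %/ l)%Z).
  have cx : cell c x.
    have := divz_eq x.1 l; have := divz_eq x.2 l.
    have := modz_ge0 x.1 (lt0r_neq0 l0); have := modz_ge0 x.2 (lt0r_neq0 l0).
    have := ltz_pmod x.1 l0; have := ltz_pmod x.2 l0.
    by move=> *; split; rewrite /c /=; lia.
  have par (m : int) : (exists k, m = 2 * k + 0) \/ (exists k, m = 2 * k + 1).
    have [h|h] : (m %% 2)%Z = 0 \/ (m %% 2)%Z = 1 by lia.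
      by left; exists (m %/ 2)%Z; lia.
    by right; exists (m %/ 2)%Z; lia.
  have [p1|p1] := par c.1; have [p2|p2] := par c.2.
  - by have [j xj] := d1 c x (conj p1 p2) cx; exists j; apply/e4/e3/e2.
  - by have [j xj] := d2 c x (conj p1 p2) cx; exists j; apply/e4/e3.
  - by have [j xj] := d3 c x (conj p1 p2) cx; exists j; apply/e4.
  - by have [j xj] := d4 c x (conj p1 p2) cx; exists j.
have /choice[lam lamE] := tot.
have [cl ac rl bl] := g4; exists lam; split.
- move=> x y xy; apply: linked_subset (cl x y (lam x) (lamE x) _) => [z /=|].
    by rewrite lamE => -[].
  by rewrite lamE xy.
- by move=> k x y kx ky; have := ac _ _ _ kx ky; rewrite !lamE => -[].
- by move=> j x /bl; rewrite lamE => -[].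
- by move=> x; apply: rl.
Qed.

End Coarse.

(** * Hexagons and boundary darts *)

Lemma site_eq (s t : site) : s.1 = t.1 -> s.2 = t.2 -> s = t.
Proof. by case: s; case: t => ? ? ? ? /= -> ->. Qed.

(** The two sites adjacent to both ends of an edge from s to t. *)
Definition left (s t : site) : site :=
  (s.1 + s.2 - t.2, t.1 + t.2 - s.1).
Definition right (s t : site) : site :=
  (t.1 + t.2 - s.2, s.1 + s.2 - t.1).

(** An edge of the triangular lattice lies in exactly two triangles. *)
Lemma nb_third s t u : nb s t -> s <> t -> nb s u -> nb t u -> u <> s -> u <> t ->
  u = left s t \/ u = right s t.
Proof.
move=> [h1 h2 h3] st [h4 h5 h6] [h7 h8 h9] us ut.
have st' : s.1 <> t.1 \/ s.2 <> t.2.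
  by apply: contrapT => H; apply: st; apply: site_eq; lia.
have us' : u.1 <> s.1 \/ u.2 <> s.2.
  by apply: contrapT => H; apply: us; apply: site_eq; lia.
have ut' : u.1 <> t.1 \/ u.2 <> t.2.
  by apply: contrapT => H; apply: ut; apply: site_eq; lia.
have [h|h] : (u.1 = s.1 + s.2 - t.2 /\ u.2 = t.1 + t.2 - s.1) \/
  (u.1 = t.1 + t.2 - s.2 /\ u.2 = s.1 + s.2 - t.1) by lia.
  by left; apply: site_eq => /=; lia.
by right; apply: site_eq => /=; lia.
Qed.

Section Darts.
Variable F : set site.

(** An edge of the lattice from a site outside F to a site of F. Its dual edge,
the common side of the two hexagons, belongs to the boundary of F and is
oriented so as to have F on its right. *)
Definition dart (p : site * site) : Prop := [/\ nb p.1 p.2, ~ F p.1 & F p.2].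

(** Follow the boundary of F: at the vertex shared by the hexagons s, t and
[left s t], the next side depends on whether the third hexagon belongs to F. *)
Definition next (p : site * site) : site * site :=
  if `[< F (left p.1 p.2) >] then (p.1, left p.1 p.2) else (left p.1 p.2, p.2).

Definition prev (p : site * site) : site * site :=
  if `[< F (right p.1 p.2) >] then (p.1, right p.1 p.2) else (right p.1 p.2, p.2).

Lemma dart_neq p : dart p -> p.1 <> p.2.
Proof. by move=> [_ nF Ft] e; apply: nF; rewrite e. Qed.

Lemma right_left s t : right s (left s t) = t.
Proof. by apply: site_eq => /=; lia. Qed.
Lemma right_left2 s t : right (left s t) t = s.
Proof. by apply: site_eq => /=; lia. Qed.
Lemma left_right s t : left s (right s t) = t.
Proof. by apply: site_eq => /=; lia. Qed.
Lemma left_right2 s t : left (right s t) t = s.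
Proof. by apply: site_eq => /=; lia. Qed.

Lemma next_dart p : dart p -> dart (next p).
Proof.
case: p => s t [/= st nFs Ft]; rewrite /next /=.
case: asboolP => Fu; split => //=; move: st => [h1 h2 h3]; split => /=; lia.
Qed.

Lemma nextK p : dart p -> prev (next p) = p.
Proof.
case: p => s t [/= st nFs Ft]; rewrite /next /=.
have [Fu|nFu] := pselect (F (left s t)).
  by rewrite asboolT // /prev /= right_left asboolT.
by rewrite asboolF // /prev /= right_left2 asboolF.
Qed.

Lemma prevK p : dart p -> next (prev p) = p.
Proof.
case: p => s t [/= st nFs Ft]; rewrite /prev /=.
have [Fu|nFu] := pselect (F (right s t)).
  by rewrite asboolT // /next /= left_right asboolT.
by rewrite asboolF // /next /= left_right2 asboolF.
Qed.

Lemma next_neq p : dart p -> next p <> p.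
Proof.
move=> dp; have /= := dart_neq dp; case: p dp => s t [/= [h1 h2 h3] nFs Ft] st.
have st' : s.1 <> t.1 \/ s.2 <> t.2.
  by apply: contrapT => H; apply: st; apply: site_eq; lia.
rewrite /next /=; case: asboolP => Fu [].
  by move=> e; move: (congr1 fst e) (congr1 snd e) => /=; lia.
by move=> e; move: (congr1 fst e) (congr1 snd e) => /=; lia.
Qed.

(** Two darts whose four ends are pairwise adjacent cannot have four different
ends, since cliques of the lattice have at most three elements; they are thus
consecutive around a triangle. *)
Lemma dart_meet p q : dart p -> dart q -> p <> q ->
  nb p.1 q.1 -> nb p.1 q.2 -> nb p.2 q.1 -> nb p.2 q.2 -> q = next p \/ p = next q.
Proof.
move=> dp dq pq n1 n2 n3 n4; suff H : q = next p \/ q = prev p.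
  by have [->|->] := H; [left | right; rewrite prevK].
have pp := dart_neq dp; have qq := dart_neq dq.
case: p q dp dq pq pp qq n1 n2 n3 n4 => [s t] [s' t'] [/= st nFs Ft] [/= st' nFs' Ft'] pq.
rewrite /= => pp qq ss' st2 ts' tt'; rewrite /next /prev /=.
have [ess|nss] := pselect (s' = s).
  rewrite ess in pq *; have ntt : t' <> t by move=> e; apply: pq; rewrite e.
  have nts : t' <> s by move=> e; apply: nFs; rewrite -e.
  by have [<-|<-] := nb_third st pp st2 tt' nts ntt; rewrite (asboolT Ft'); [left|right].
have nst : s' <> t by move=> e; apply: nFs'; rewrite e.
have [ett|ntt] := pselect (t' = t).
  rewrite ett in pq *.
  by have [<-|<-] := nb_third st pp ss' ts' nss nst; rewrite (asboolF nFs'); [left|right].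
have nts : t' <> s by move=> e; apply: nFs; rewrite -e.
exfalso; move: st' => [h1 h2 h3].
have h4 : s'.1 <> t'.1 \/ s'.2 <> t'.2.
  by apply: contrapT => H; apply: qq; apply: site_eq; lia.
by move: h1 h2 h3 h4; have [->|->] := nb_third st pp ss' ts' nss nst;
   have [->|->] := nb_third st pp st2 tt' nts ntt => /=; move: (st) => [? ? ?]; lia.
Qed.

End Darts.

Section Hexagons.
Context {R : realType}.
Implicit Types (q : R * R) (s t u : site) (r : R).

(** The Voronoi cell of s for the quadratic form x^2 + xy + y^2, whose symmetry
group permutes the six neighbours: a tiling of the plane by hexagons in which
hexagons meet exactly when their sites are adjacent. Working with this affine
image of the regular honeycomb keeps the coordinates integral. *)
Definition hex s : set (R * R) := [set q : R * R |
  [/\ -1 <= 2 * (q.1 - s.1%:~R) + (q.2 - s.2%:~R) <= 1,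
      -1 <= (q.1 - s.1%:~R) + 2 * (q.2 - s.2%:~R) <= 1 &
      -1 <= (q.1 - s.1%:~R) - (q.2 - s.2%:~R) <= 1]].

Definition centre s : R * R := (s.1%:~R, s.2%:~R).

Lemma hex_centre s : hex s (centre s).
Proof. by split => /=; lra. Qed.

(** Among the corners of the unit square around q, the one to choose depends on
the side of the diagonal on which q lies and on two of the three slopes. *)
Lemma hex_cover q : exists s, hex s q.
Proof.
have /andP[i1] := floor_itv q.1; have /andP[j1] := floor_itv q.2.
set i := Num.floor q.1; set j := Num.floor q.2; rewrite !intrD => j2 i2.
have [fg|gf] := leP (q.2 - j%:~R) (q.1 - i%:~R).
- have [h|h] := leP (2 * (q.1 - i%:~R) + (q.2 - j%:~R)) 1.
    by exists (i, j); split => /=; lra.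
  have [h'|h'] := leP ((q.1 - i%:~R) + 2 * (q.2 - j%:~R)) 2.
    by exists (i + 1, j); split; rewrite /= ?intrD; lra.
  by exists (i + 1, j + 1); split; rewrite /= ?intrD; lra.
- have [h|h] := leP ((q.1 - i%:~R) + 2 * (q.2 - j%:~R)) 1.
    by exists (i, j); split => /=; lra.
  have [h'|h'] := leP (2 * (q.1 - i%:~R) + (q.2 - j%:~R)) 2.
    by exists (i, j + 1); split; rewrite /= ?intrD; lra.
  by exists (i + 1, j + 1); split; rewrite /= ?intrD; lra.
Qed.

Lemma hex_nb s t q : hex s q -> hex t q -> nb s t.
Proof.
move=> [/andP[a1 a2] /andP[b1 b2] /andP[c1 c2]] [/andP[d1 d2] /andP[e1 e2] /andP[f1 f2]].
have h1 : 2 * t.1 + t.2 <= 2 * s.1 + s.2 + 2.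
  by rewrite -(ler_int R) !(intrD, intrM); lra.
have h2 : 2 * s.1 + s.2 <= 2 * t.1 + t.2 + 2.
  by rewrite -(ler_int R) !(intrD, intrM); lra.
have h3 : t.1 + 2 * t.2 <= s.1 + 2 * s.2 + 2.
  by rewrite -(ler_int R) !(intrD, intrM); lra.
have h4 : s.1 + 2 * s.2 <= t.1 + 2 * t.2 + 2.
  by rewrite -(ler_int R) !(intrD, intrM); lra.
have h5 : t.1 - t.2 <= s.1 - s.2 + 2.
  by rewrite -(ler_int R) !(intrD, intrM, intrN, mulrNz); lra.
have h6 : s.1 - s.2 <= t.1 - t.2 + 2.
  by rewrite -(ler_int R) !(intrD, intrM, intrN, mulrNz); lra.
by clear -h1 h2 h3 h4 h5 h6; split; lia.
Qed.

(** The honeycomb vertex dual to a triangle is its centroid. *)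
Definition corner s t u : R * R :=
  ((s.1%:~R + t.1%:~R + u.1%:~R) / 3, (s.2%:~R + t.2%:~R + u.2%:~R) / 3).

Definition start (p : site * site) := corner p.1 p.2 (right p.1 p.2).
Definition stop (p : site * site) := corner p.1 p.2 (left p.1 p.2).

Definition edge (p : site * site) : set (R * R) := hex p.1 `&` hex p.2.

Definition point_on (a b : R * R) r : R * R := a + r *: (b - a).

Lemma point_onE a b r q : q = point_on a b r <->
  q.1 = a.1 + r * (b.1 - a.1) /\ q.2 = a.2 + r * (b.2 - a.2).
Proof. by case: q => x y; split=> [[-> ->]|/= [-> ->]]. Qed.

Lemma nb_dirs s t : nb s t -> s <> t ->
  [\/ (t.1 = s.1 + 1 /\ t.2 = s.2), (t.1 = s.1 /\ t.2 = s.2 + 1),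
      (t.1 = s.1 - 1 /\ t.2 = s.2 + 1) | [\/ (t.1 = s.1 - 1 /\ t.2 = s.2),
      (t.1 = s.1 /\ t.2 = s.2 - 1) | (t.1 = s.1 + 1 /\ t.2 = s.2 - 1)]].
Proof.
move=> [h1 h2 h3] st.
have st' : s.1 <> t.1 \/ s.2 <> t.2.
  by apply: contrapT => H; apply: st; apply: site_eq; lia.
have : (t.1 = s.1 + 1 /\ t.2 = s.2) \/ (t.1 = s.1 /\ t.2 = s.2 + 1) \/
      (t.1 = s.1 - 1 /\ t.2 = s.2 + 1) \/ (t.1 = s.1 - 1 /\ t.2 = s.2) \/
      (t.1 = s.1 /\ t.2 = s.2 - 1) \/ (t.1 = s.1 + 1 /\ t.2 = s.2 - 1) by lia.
by move=> [?|[?|[?|[?|[?|?]]]]]; [apply: Or41|apply: Or42|apply: Or43|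
  apply/Or44/Or31|apply/Or44/Or32|apply/Or44/Or33].
Qed.

(** Reduces statements about adjacent hexagons to six concrete cases. *)
Lemma nb_real s t : nb s t -> s <> t -> exists a b : R,
  [/\ t.1%:~R = s.1%:~R + a, t.2%:~R = s.2%:~R + b &
  [\/ (a = 1 /\ b = 0), (a = 0 /\ b = 1), (a = -1 /\ b = 1) |
  [\/ (a = -1 /\ b = 0), (a = 0 /\ b = -1) | (a = 1 /\ b = -1)]]].
Proof.
move=> st nst; have H := nb_dirs st nst.
pose X := s.1%:~R : R; pose Y := s.2%:~R : R.
case: H => [[e f]|[e f]|[e f]|[[e f]|[e f]|[e f]]]; rewrite e f !(intrD, mulrNz).
- by exists 1, 0; split; [| rewrite addr0 | apply: Or41].
- by exists 0, 1; split; [rewrite addr0 | | apply: Or42].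
- by exists (-1), 1; split; [| | apply: Or43].
- by exists (-1), 0; split; [| rewrite addr0 | apply/Or44/Or31].
- by exists 0, (-1); split; [rewrite addr0 | | apply/Or44/Or32].
- by exists 1, (-1); split; [| | apply/Or44/Or33].
Qed.

Lemma edgeE s t q : nb s t -> s <> t -> edge (s, t) q <->
  exists2 r, 0 <= r <= 1 & q = point_on (start (s, t)) (stop (s, t)) r.
Proof.
move=> st nst; suff H : edge (s, t) q <-> exists2 r, 0 <= r <= 1 &
    q.1 = (start (s, t)).1 + r * ((stop (s, t)).1 - (start (s, t)).1) /\
    q.2 = (start (s, t)).2 + r * ((stop (s, t)).2 - (start (s, t)).2).
  by rewrite H; split=> -[r r01 /point_onE ?]; exists r.
case: q => x y.
rewrite /edge /hex /start /stop /corner /left /right /=.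
rewrite !(intrD, mulrNz); have [a [b [-> -> ab]]] := nb_real st nst.
move: (s.1%:~R) (s.2%:~R) => X Y; split.
- move=> [/= [/andP[a1 a2] /andP[b1 b2] /andP[c1 c2]] [/andP[d1 d2] /andP[e1 e2] /andP[f1 f2]]].
  case: ab => [[ea eb]|[ea eb]|[ea eb]|[[ea eb]|[ea eb]|[ea eb]]]; subst a b.
  + by exists (1 / 2 + 3 / 2 * (y - Y)); [|split]; lra.
  + by exists (1 / 2 - 3 / 2 * (x - X)); [|split]; lra.
  + by exists (1 / 2 + 3 / 2 * (- (y - Y) - (x - X))); [|split]; lra.
  + by exists (1 / 2 - 3 / 2 * (y - Y)); [|split]; lra.
  + by exists (1 / 2 + 3 / 2 * (x - X)); [|split]; lra.
  + by exists (1 / 2 + 3 / 2 * ((y - Y) + (x - X))); [|split]; lra.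
- move=> [r r01 [-> ->]].
  by case: ab => [[-> ->]|[-> ->]|[-> ->]|[[-> ->]|[-> ->]|[-> ->]]]; split; split; lra.
Qed.

Lemma start_stop s t : nb s t -> s <> t -> start (s, t) <> stop (s, t).
Proof.
move=> st nst; rewrite /start /stop /corner /left /right /= !(intrD, mulrNz).
have [a [b [-> -> ab]]] := nb_real st nst.
move: (s.1%:~R) (s.2%:~R) => X Y [].
by case: ab => [[-> ->]|[-> ->]|[-> ->]|[[-> ->]|[-> ->]|[-> ->]]]; lra.
Qed.

Lemma triple_corner s t q : nb s t -> s <> t -> hex s q -> hex t q ->
  (hex (left s t) q -> q = stop (s, t)) /\ (hex (right s t) q -> q = start (s, t)).
Proof.
move=> st nst; case: q => x y.
rewrite /start /stop /corner /left /right /hex /= !(intrD, mulrNz).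
have [a [b [-> -> ab]]] := nb_real st nst.
move: (s.1%:~R) (s.2%:~R) => X Y.
move=> [/andP[a1 a2] /andP[b1 b2] /andP[c1 c2]] [/andP[d1 d2] /andP[e1 e2] /andP[f1 f2]].
by case: ab => [[ea eb]|[ea eb]|[ea eb]|[[ea eb]|[ea eb]|[ea eb]]]; subst a b;
  split=> -[/andP[g1 g2] /andP[h1 h2] /andP[i1 i2]]; congr pair; lra.
Qed.

(** Sides of the boundary meet only at the common vertex of consecutive darts. *)
Lemma edge_meet (F : set site) p p' q : dart F p -> dart F p' -> p <> p' ->
  edge p q -> edge p' q ->
  (p' = next F p /\ q = stop p) \/ (p = next F p' /\ q = stop p').
Proof.
move=> dp dp' pp' [p1 p2] [p1' p2'].
have tri x : dart F x -> hex x.1 q -> hex x.2 q -> hex (next F x).1 q ->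
    hex (next F x).2 q -> q = stop x.
  move=> dx h1 h2; have [hx _ _] := dx; have nx := dart_neq dx.
  rewrite {1 2}(surjective_pairing x) in dx *.
  case: x dx h1 h2 hx nx => s t dx /= h1 h2 hx nx; rewrite /next /=.
  have [] := triple_corner hx nx h1 h2 => H _.
  by case: asboolP => _ /= h3 h4; apply: H.
have [e|e] := dart_meet dp dp' pp' (hex_nb p1 p1') (hex_nb p1 p2') (hex_nb p2 p1') (hex_nb p2 p2').
  by left; split=> //; apply: tri => //; rewrite -e.
by right; split=> //; apply: tri => //; rewrite -e.
Qed.

Lemma stop_next (F : set site) p : start (next F p) = stop p.
Proof.
case: p => s t; rewrite /next /start /stop /=; case: asboolP => _ /=.
  by rewrite right_left /corner; congr pair; rewrite addrAC.
by rewrite right_left2 /corner; congr pair; congr (_ / 3); lra.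
Qed.

End Hexagons.

(** * The plane inside the sphere *)

Section Plane.
Context {R : realType}.
Local Open Scope complex_scope.
Implicit Types (p q : R * R) (z w : R[i]^o) (h r : R).

Definition cplx (p : R * R) : R[i]^o := p.1 +i* p.2.
Definition coords (z : R[i]^o) : R * R := (complex.Re z, complex.Im z).

Lemma cplxK : cancel cplx coords. Proof. by case. Qed.
Lemma coordsK : cancel coords cplx. Proof. by case. Qed.

Definition sqdist p q : R := (p.1 - q.1) ^+ 2 + (p.2 - q.2) ^+ 2.

Lemma sqdist_ge0 p q : 0 <= sqdist p q.
Proof. by rewrite addr_ge0 // sqr_ge0. Qed.

Lemma norm_cplxB p q : `|cplx p - cplx q| = (Num.sqrt (sqdist p q))%:C.
Proof. by rewrite normc_def. Qed.

Lemma norm_cplx_lt p q r : 0 < r ->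
  (`|cplx p - cplx q| < r%:C) = (sqdist p q < r ^+ 2).
Proof.
move=> r0; rewrite norm_cplxB ltcR.
have {1}-> : r = Num.sqrt (r ^+ 2) by rewrite sqrtr_sqr gtr0_norm.
by rewrite ltr_sqrt // exprn_gt0.
Qed.

Lemma norm_cplx_le p q r : 0 <= r ->
  (`|cplx p - cplx q| <= r%:C) = (sqdist p q <= r ^+ 2).
Proof.
move=> r0; rewrite norm_cplxB lecR.
have {1}-> : r = Num.sqrt (r ^+ 2) by rewrite sqrtr_sqr ger0_norm.
by rewrite ler_sqrt // sqr_ge0.
Qed.

Lemma norm_cplx_eq p q r : 0 <= r ->
  (`|cplx p - cplx q| = r%:C) <-> (sqdist p q = r ^+ 2).
Proof.
move=> r0; rewrite norm_cplxB; split=> [[<-]|->].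
  by rewrite sqr_sqrtr // sqdist_ge0.
by rewrite sqrtr_sqr ger0_norm.
Qed.

Lemma complex_pos (e : R[i]) : 0 < e -> exists2 r : R, 0 < r & e = r%:C.
Proof. by case: e => a b; rewrite ltcE /= => /andP[/eqP -> a0]; exists a. Qed.

Lemma cplx_continuous : continuous cplx.
Proof.
move=> p U /nbhs_ballP[e /= /complex_pos[r r0 ->]] H.
apply/nbhs_ballP; exists (r / 2); first by rewrite /=; lra.
move=> q /= [pq1 pq2]; apply: H; rewrite -ball_normE /= norm_cplx_lt // /sqdist.
move: pq1 pq2; rewrite /ball /= !ltr_norml => /andP[a1 a2] /andP[b1 b2].
by nra.
Qed.

Lemma sqr_sum_lt (x y r : R) : 0 < r -> x ^+ 2 + y ^+ 2 < r ^+ 2 -> `|x| < r.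
Proof.
move=> r0 H; rewrite ltr_norml; apply/andP; split; rewrite ltNge; apply/negP => h.
  by have := sqr_ge0 y; nra.
by have := sqr_ge0 y; nra.
Qed.

Lemma coords_continuous : continuous coords.
Proof.
move=> z U /nbhs_ballP[r /= r0] H.
apply/nbhs_ballP; exists (r%:C); first by rewrite /= ltcR.
move=> w; rewrite -ball_normE /= -(coordsK z) -(coordsK w) norm_cplx_lt // /sqdist.
rewrite coordsK => zw; apply: H; move: zw; case: z => a b; case: w => c d /= zw.
by split; rewrite /ball /=; [apply: (sqr_sum_lt r0 zw)|apply: (@sqr_sum_lt _ (a - c))]; rewrite // addrC.
Qed.

(** The lattice of mesh h in the sphere: the geometry of hexagons is done at unit
scale and transported by this embedding. *)
Definition emb (h : R) (q : R * R) : sphere R := Some (cplx (h *: q)).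

Lemma scaled_cplx_continuous h : continuous (fun q => cplx (h *: q)).
Proof.
move=> q; apply: (@continuous_comp _ _ _ (fun q => h *: q) cplx q).
  exact: scaler_continuous.
exact: cplx_continuous.
Qed.

Lemma emb_continuous h : continuous (emb h).
Proof.
move=> q U nU; exact: (@scaled_cplx_continuous h q (Some @^-1` U) nU).
Qed.

Lemma emb_inj h : h != 0 -> injective (emb h).
Proof.
move=> h0 p q [/(mulfI h0) e1 /(mulfI h0) e2].
by case: p q e1 e2 => [? ?] [? ?] /= -> ->.
Qed.

Lemma emb_surj h (x : sphere R) : h != 0 -> x <> infty -> exists q, x = emb h q.
Proof.
move=> h0; case: x => [z|] //= _; exists (h^-1 *: coords z).
by rewrite /emb scalerA mulfV // scale1r coordsK.
Qed.

Lemma emb_open h (U : set (R * R)) : h != 0 -> open U -> open (emb h @` U).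
Proof.
move=> h0 oU.
have -> : emb h @` U = Some @` (coords @^-1` ((fun q => h^-1 *: q) @^-1` U)).
  apply/seteqP; split=> [_ [q Uq <-]|_ [z Uz <-]].
    exists (cplx (h *: q)) => //=.
    by rewrite cplxK scalerA mulVf // scale1r.
  exists (h^-1 *: coords z) => //.
  by rewrite /emb scalerA mulfV // scale1r coordsK.
apply: one_point_compactification_open_some; apply: open_comp.
  by move=> z _; exact: coords_continuous.
by apply: open_comp => // q _; exact: scaler_continuous.
Qed.

(** A compact plane set is closed in the plane and its complement is, by
definition, a neighbourhood of infinity. *)
Lemma emb_compact_open h (A : set (R * R)) : compact A -> open (~` (emb h @` A)).
Proof.
move=> cA; pose B : set R[i]^o := (fun q => cplx (h *: q)) @` A.
have cB : compact B.
  apply: continuous_compact => //; apply: continuous_subspaceT.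
  exact: scaled_cplx_continuous.
have clB : closed B by apply: compact_closed => //; exact: norm_hausdorff.
have -> : emb h @` A = Some @` B.
  by rewrite /B -image_comp.
rewrite openE => -[z|] /= nB.
  have /= oB := one_point_compactification_open_some _ (closed_openC clB).
  apply: (@filterS _ _ _ (Some @` (~` B))); last first.
    by apply: open_nbhs_nbhs; split=> //; exists z => // Bz; apply: nB; exists z.
  by move=> _ [w nBw <-] [w' Bw' [e]]; apply: nBw; rewrite -e.
exists B => // _ [[w nBw <-] [w' Bw' [e]]|-> [//]].
by apply: nBw; rewrite -e.
Qed.

End Plane.

(** * Polygonal arcs and Jordan curves *)

Section Arcs.
Context {R : realType}.
Local Notation plane := (R * R)%type.
Implicit Types (A : set plane) (a b c q : plane) (r : R).

Definition segment a b : set plane := [set q | exists2 r, 0 <= r <= 1 & q = point_on a b r].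

Definition arc A a b : Prop := exists g : R -> plane,
  [/\ continuous g, forall r r', 0 <= r <= 1 -> 0 <= r' <= 1 -> g r = g r' -> r = r',
      g 0 = a, g 1 = b & forall q, A q <-> exists2 r, 0 <= r <= 1 & q = g r].

Lemma point_on0 a b : point_on a b 0 = a.
Proof. by rewrite /point_on scale0r addr0. Qed.

Lemma point_on1 a b : point_on a b 1 = b.
Proof. by rewrite /point_on scale1r addrC subrK. Qed.

Lemma point_on_rev a b r : point_on a b r = point_on b a (1 - r).
Proof. by rewrite /point_on scalerBl scale1r addrA (addrC b) subrK -scalerN opprB. Qed.

Lemma point_on_inj a b r r' : a <> b -> point_on a b r = point_on a b r' -> r = r'.
Proof.
move=> ab /addrI /eqP; rewrite -subr_eq0 -scalerBl scaler_eq0 !subr_eq0.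
by move=> /orP[/eqP //|/eqP ba]; case: ab.
Qed.

Lemma point_on_continuous a b : continuous (point_on a b).
Proof.
move=> r; apply: cvgD; first exact: cvg_cst.
by apply: cvgZr_tmp; exact: cvg_id.
Qed.

Lemma arc_segment a b : a <> b -> arc (segment a b) a b.
Proof.
move=> ab; exists (point_on a b); split=> //.
- exact: point_on_continuous.
- by move=> r r' _ _; exact: point_on_inj.
- exact: point_on0.
- exact: point_on1.
Qed.

(** Traverse g twice as fast and then the segment. The formula with minimum and
maximum is continuous by composition, without any gluing. *)
Lemma arc_cat A a b c : arc A a b -> b <> c ->
  (forall q, A q -> segment b c q -> q = b) -> arc (A `|` segment b c) a c.
Proof.
move=> [g [gc gi g0 g1 gA]] bc Ab.
pose f r := g (Num.min (2 * r) 1) + Num.max (2 * r - 1) 0 *: (c - b).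
have fl r : r <= 1 / 2 -> f r = g (2 * r).
  move=> rle; rewrite /f (min_l (_ : 2 * r <= 1)); last lra.
  rewrite (max_r (_ : 2 * r - 1 <= 0)); last lra.
  by rewrite scale0r addr0.
have fr r : 1 / 2 <= r -> f r = point_on b c (2 * r - 1).
  move=> rge; rewrite /f (min_r (_ : 1 <= 2 * r)); last lra.
  by rewrite (max_l (_ : 0 <= 2 * r - 1)) ?g1 //; last lra.
exists f; split.
- move=> r; apply: cvgD.
    apply: (@continuous_comp _ _ _ (fun r : R => Num.min (2 * r) 1) g); last exact: gc.
    apply: (@continuous_min _ _ (fun r : R => 2 * r) (fun=> 1) r); last exact: cvg_cst.
    by apply: cvgMl_tmp; exact: cvg_id.
  apply: cvgZr_tmp; apply: (@continuous_max _ _ (fun r : R => 2 * r - 1) (fun=> 0) r); last exact: cvg_cst.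
  apply: cvgB; last exact: cvg_cst.
  by apply: cvgMl_tmp; exact: cvg_id.
- have cross r r' : 0 <= r <= 1 / 2 -> 1 / 2 < r' <= 1 -> f r <> f r'.
    move=> h h'; rewrite fl ?fr; [|lra|lra] => e.
    have Aq : A (g (2 * r)) by apply/gA; exists (2 * r) => //; lra.
    have Sq : segment b c (g (2 * r)) by rewrite e; exists (2 * r' - 1) => //; lra.
    have := Ab _ Aq Sq; rewrite e -{2}(point_on0 b c) => /(point_on_inj bc); lra.
  move=> r r' h h' e; have [l|l] := leP r (1 / 2); have [l'|l'] := leP r' (1 / 2).
  + by move: e; rewrite !fl // => /gi; lra.
  + by exfalso; apply: (cross r r') => //; lra.
  + by exfalso; apply: (cross r' r) => //; lra.
  + by move: e; rewrite !fr; [|lra|lra] => /(point_on_inj bc); lra.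
- by rewrite fl ?mulr0; [|lra].
- by rewrite fr; [|lra]; rewrite (_ : 2 * 1 - 1 = 1) ?point_on1 //; lra.
- move=> q; split.
    move=> [/gA[r r01 ->]|[r r01 ->]].
      exists (r / 2); first lra.
      by rewrite fl; [congr g; lra|lra].
    exists ((r + 1) / 2); first lra.
    by rewrite fr; [congr point_on; lra|lra].
  move=> [r r01 ->]; have [l|l] := leP r (1 / 2).
    by left; apply/gA; exists (2 * r); [lra|rewrite fl].
  by right; exists (2 * r - 1); [lra|rewrite fr //; lra].
Qed.

Local Open Scope complex_scope.

Lemma Re_continuous : continuous (fun z : R[i]^o => complex.Re z : R).
Proof.
move=> z; apply: (@continuous_comp _ _ _ (@coords R) fst z).
  exact: coords_continuous.
exact: cvg_fst.
Qed.

Lemma Im_continuous : continuous (fun z : R[i]^o => complex.Im z : R).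
Proof.
move=> z; apply: (@continuous_comp _ _ _ (@coords R) snd z).
  exact: coords_continuous.
exact: cvg_snd.
Qed.

Lemma unit_circleP (z : R[i]^o) : euclidean_circle 0 1 z <->
  complex.Re z ^+ 2 + complex.Im z ^+ 2 = 1.
Proof.
rewrite /euclidean_circle /= -(coordsK z) (_ : 0 = cplx (0, 0)) //.
by rewrite norm_cplx_eq // /sqdist /= !subr0 expr1n.
Qed.

(** Parametrize the arc by the upper half of the unit circle and the closing
segment by its lower half, both through the real part; the two halves agree at
the points 1 and -1. *)
Lemma jordan_of_arc (h : R) A a b : h != 0 -> arc A a b -> a <> b ->
  (forall q, A q -> segment b a q -> q = a \/ q = b) ->
  jordan_curve (emb h @` (A `|` segment b a)).
Proof.
move=> h0 [g [gc gi g0 g1 gA]] ab meet.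
pose u (z : R[i]^o) := emb h (g ((1 + complex.Re z) / 2)).
pose l (z : R[i]^o) := emb h (point_on a b ((1 + complex.Re z) / 2)).
pose f (z : R[i]^o) := if 0 <= complex.Im z then u z else l z.
have Rec z : continuous_at z (fun z : R[i]^o => (1 + complex.Re z) / 2 : R).
  exact: (cvgMr_tmp (cvgD (cvg_cst (1 : R)) (@Re_continuous z))).
have hgc : continuous (emb h \o g).
  by move=> r; apply: continuous_comp; [exact: gc | exact: emb_continuous].
have hpc : continuous (emb h \o point_on a b).
  by move=> r; apply: continuous_comp; [exact: point_on_continuous | exact: emb_continuous].
have uc : continuous u by move=> z; exact: (continuous_comp (Rec z) (@hgc _)).
have lc : continuous l by move=> z; exact: (continuous_comp (Rec z) (@hpc _)).
have cir (z : R[i]^o) : euclidean_circle 0 1 z -> complex.Im z = 0 ->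
    complex.Re z = 1 \/ complex.Re z = -1.
  move=> /unit_circleP + i0; rewrite i0 expr0n addr0 => /eqP.
  by rewrite sqrf_eq1 => /orP[] /eqP; [left|right].
have ends (z : R[i]^o) : euclidean_circle 0 1 z -> complex.Im z = 0 -> u z = l z.
  move=> cz i0; rewrite /u /l; have [->|->] := cir z cz i0.
    by rewrite (_ : (1 + 1) / 2 = 1 :> R) ?g1 ?point_on1 //; lra.
  by rewrite (_ : (1 - 1) / 2 = 0 :> R) ?g0 ?point_on0 //; lra.
have par (z : R[i]^o) : euclidean_circle 0 1 z -> 0 <= (1 + complex.Re z) / 2 <= 1.
  by move=> /unit_circleP; have := sqr_ge0 (complex.Im z); nra.
have cl1 : closed [set z : R[i]^o | 0 <= complex.Im z].
  apply: (@closed_comp _ _ (fun z : R[i]^o => complex.Im z : R) [set x | 0 <= x]).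
    by move=> z _; exact: Im_continuous.
  exact: closed_ge.
have cl2 : closed [set z : R[i]^o | complex.Im z <= 0].
  apply: (@closed_comp _ _ (fun z : R[i]^o => complex.Im z : R) [set x | x <= 0]).
    by move=> z _; exact: Im_continuous.
  exact: closed_le.
have clc : closed (euclidean_circle (0 : R[i]^o) 1).
  have -> : euclidean_circle (0 : R[i]^o) (1 : R) = (fun z : R[i]^o =>
     (complex.Re z ^+ 2 + complex.Im z ^+ 2) : R) @^-1` [set 1].
    by apply/seteqP; split=> z /unit_circleP.
  apply: closed_comp; last exact: closed_eq.
  have sqc (k : R[i]^o -> R) : continuous k -> continuous (fun z => k z ^+ 2 : R).
    by move=> kc z; exact: (continuous_comp (kc z) (@exprn_continuous _ 2 _)).
  by move=> z _; exact: (cvgD (@sqc _ Re_continuous z) (@sqc _ Im_continuous z)).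
have E : euclidean_circle (0 : R[i]^o) (1 : R) =
    (euclidean_circle 0 1 `&` [set z : R[i]^o | 0 <= complex.Im z]) `|`
    (euclidean_circle 0 1 `&` [set z : R[i]^o | complex.Im z <= 0]).
  rewrite -setIUr; apply/esym/setIidPl => z _ /=.
  by have [?|/ltW ?] := leP 0 (complex.Im z); [left|right].
exists f; split.
- rewrite E; apply: withinU_continuous; [exact: closedI|exact: closedI| |].
    have e : {in euclidean_circle (0 : R[i]^o) (1 : R) `&` [set z : R[i]^o | 0 <= complex.Im z], u =1 f}.
      by move=> z /set_mem [_ i0]; rewrite /f ifT.
    exact: (subspace_eq_continuous e (continuous_subspaceT uc)).
  have e : {in euclidean_circle (0 : R[i]^o) (1 : R) `&` [set z : R[i]^o | complex.Im z <= 0], l =1 f}.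
    move=> z /set_mem [cz /= i0]; rewrite /f; case: ifP => // i1.
    by rewrite ends //; apply/eqP; rewrite eq_le i0.
  exact: (subspace_eq_continuous e (continuous_subspaceT lc)).
- have same (z w : R[i]^o) : euclidean_circle 0 1 z -> euclidean_circle 0 1 w ->
      complex.Re z = complex.Re w -> (0 <= complex.Im z) = (0 <= complex.Im w) -> z = w.
    move=> /unit_circleP cz /unit_circleP cw e s.
    suff : complex.Im z = complex.Im w.
      by case: z e {cz s} => ? ?; case: w {cw} => ? ? /= -> ->.
    have : complex.Im z ^+ 2 = complex.Im w ^+ 2 by move: cz cw; rewrite e; lra.
    move/eqP; rewrite eqf_sqr => /orP[/eqP //|/eqP e'].
    by move: s; rewrite e'; case: leP => i1 /esym; [move=> i2|move/negbT; rewrite -ltNge => i2]; lra.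
  have half (r r' : R) : (1 + r) / 2 = (1 + r') / 2 -> r = r' by lra.
  have cross (z w : R[i]^o) : euclidean_circle 0 1 z -> euclidean_circle 0 1 w ->
     0 <= complex.Im z -> complex.Im w < 0 -> u z <> l w.
    move=> cz cw iz iw /(emb_inj h0) e.
    have Aq : A (g ((1 + complex.Re z) / 2)) by apply/gA; exists ((1 + complex.Re z) / 2) => //; exact: par.
    have Sq : segment b a (g ((1 + complex.Re z) / 2)).
      rewrite e; exists (1 - (1 + complex.Re w) / 2); first by have := par w cw; lra.
      exact: point_on_rev.
    move: cw => /unit_circleP cw.
    have [e1|e1] := meet _ Aq Sq; move: e1; rewrite e.
      by rewrite -{2}(point_on0 a b) => /(point_on_inj ab) h1; clear -h1 cw iw; nra.
    by rewrite -{2}(point_on1 a b) => /(point_on_inj ab) h1; clear -h1 cw iw; nra.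
  move=> z w /set_mem cz /set_mem cw; rewrite /f.
  case: (leP 0 (complex.Im z)) => iz; case: (leP 0 (complex.Im w)) => iw.
  + move=> /(emb_inj h0) /gi e; apply: same => //; last by rewrite iz iw.
    by apply: half; apply: e; exact: par.
  + by move=> /(cross _ _ cz cw iz iw).
  + by move=> /esym /(cross _ _ cw cz iw iz).
  + move=> /(emb_inj h0) /(point_on_inj ab) /half e; apply: same => //.
    by rewrite !leNgt iz iw.
- have mk (r : R) (s : bool) : 0 <= r <= 1 -> exists z : R[i]^o,
      [/\ euclidean_circle 0 1 z, (1 + complex.Re z) / 2 = r &
          if s then 0 <= complex.Im z else complex.Im z <= 0].
    move=> r01; pose x := 2 * r - 1; pose y := Num.sqrt (1 - x ^+ 2).
    have y2 : y ^+ 2 = 1 - x ^+ 2 by rewrite sqr_sqrtr //; rewrite /x; nra.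
    exists (x +i* (if s then y else - y)); split.
    + by apply/unit_circleP => /=; case: s; rewrite ?sqrrN y2; lra.
    + by rewrite /x /=; lra.
    + by case: s => /=; rewrite ?oppr_le0 sqrtr_ge0.
  apply/seteqP; split.
    move=> _ [q [/gA[r r01 ->]|[r r01 ->]] <-].
      have [z [cz zr iz]] := mk r true r01.
      by exists z => //; rewrite /f iz /u zr.
    have [|z [cz zr iz]] := mk (1 - r) false; first lra.
    exists z => //; have -> : f z = l z.
      by rewrite /f; case: ifP => // i1; rewrite ends //; apply/eqP; rewrite eq_le iz.
    by rewrite /l zr -point_on_rev.
  move=> _ [z cz <-]; rewrite /f; case: ifP => iz.
    exists (g ((1 + complex.Re z) / 2)) => //; left; apply/gA.
    by exists ((1 + complex.Re z) / 2) => //; exact: par.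
  exists (point_on a b ((1 + complex.Re z) / 2)) => //; right.
  exists (1 - (1 + complex.Re z) / 2); first by have := par z cz; lra.
  exact: point_on_rev.
Qed.

End Arcs.

(** * The boundary of a set of hexagons *)

Lemma edge_segment {R : realType} F p : dart F p ->
  @edge R p = segment (start p) (stop p).
Proof.
case: p => s t dp; have [st _ _] := dp; have nst := dart_neq dp.
by apply/seteqP; split=> q /(edgeE q st nst).
Qed.

Lemma next_inj F p q : dart F p -> dart F q -> next F p = next F q -> p = q.
Proof. by move=> dp dq e; rewrite -(nextK dp) e nextK. Qed.

Lemma iter_dart F p n : dart F p -> dart F (iter n (next F) p).
Proof. by move=> dp; elim: n => //= n; exact: next_dart. Qed.

Section Orbits.
Context {R : realType}.
Variables (F : set site).
Implicit Types (p : site * site).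
Local Notation "p ^@ i" := (iter i (next F) p) (at level 30).

(** The boundary polygon followed for n + 1 steps from the dart p. *)
Definition run p n : set (R * R) := [set q | exists2 i, (i <= n)%N & edge (p ^@ i) q].

(** The new side may meet an earlier one only if the two are consecutive, that is
at the end of the polygon, as long as the polygon does not close up at the next
step; this is why distinctness is assumed one step further. *)
Lemma run_arc p n : dart F p ->
  (forall i j, (i < j <= n.+1)%N -> p ^@ i <> p ^@ j) ->
  arc (run p n) (start p) (stop (p ^@ n)).
Proof.
move=> dp; elim: n => [|n IHn] H.
  have -> : run p 0 = edge p.
    apply/seteqP; split=> q; first by move=> [i +]; rewrite leqn0 => /eqP ->.
    by exists 0%N.
  rewrite (edge_segment dp); apply: arc_segment.
  case: p dp {H} => s t dp; have [st _ _] := dp; apply: start_stop => //.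
  exact: dart_neq dp.
have dn := iter_dart n dp; have dn1 := iter_dart n.+1 dp.
have -> : run p n.+1 = run p n `|` segment (stop (p ^@ n)) (stop (p ^@ n.+1)).
  have -> : stop (p ^@ n) = start (p ^@ n.+1) :> R * R by rewrite /= stop_next.
  rewrite -(edge_segment dn1); apply/seteqP; split=> q.
    by move=> [i +]; rewrite leq_eqVlt => /orP[/eqP->|]; [right|left; exists i].
  by move=> [[i ilt ?]|?]; [exists i => //; exact: leqW|exists n.+1].
apply: arc_cat.
- by apply: IHn => i j /andP[ij jn]; apply: H; rewrite ij /= leqW.
- rewrite -(stop_next F (p ^@ n)) -/(p ^@ n.+1).
  case: (p ^@ n.+1) dn1 => s t d1; have [st _ _] := d1; apply: start_stop => //.
  exact: dart_neq d1.
move=> q [i ilt iq]; rewrite -(stop_next F (p ^@ n)) -/(p ^@ n.+1) -(edge_segment dn1) => nq.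
have di := iter_dart i dp.
have neq : p ^@ i <> p ^@ n.+1 by apply: H; rewrite ltnS ilt /= leqW.
have [[e ->]|[e _]] := edge_meet di dn1 neq iq nq; last first.
  by exfalso; apply: (H i n.+2 _ e); rewrite ltnS leqW //=.
by rewrite /= stop_next; congr stop; apply: (next_inj di dn); rewrite -e.
Qed.

Lemma cycle_jordan (h : R) p n : h != 0 -> dart F p -> (0 < n)%N ->
  p ^@ n = p -> (forall i j, (i < j < n)%N -> p ^@ i <> p ^@ j) ->
  jordan_curve (emb h @` [set q | exists2 i, (i < n)%N & edge (p ^@ i) q]).
Proof.
move=> h0 dp; case: n => [//|[|n]] _ cyc H; first by case: (next_neq dp).
have dn1 := iter_dart n.+1 dp.
have close : stop (p ^@ n.+1) = start p :> R * R.
  by rewrite -{2}cyc /= stop_next.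
have open : stop (p ^@ n) = start (p ^@ n.+1) :> R * R by rewrite /= stop_next.
have -> : [set q : R * R | exists2 i, (i < n.+2)%N & edge (p ^@ i) q] =
    run p n `|` segment (stop (p ^@ n)) (start p).
  rewrite open -close -(edge_segment dn1); apply/seteqP; split=> q.
    by move=> [i +]; rewrite ltnS leq_eqVlt => /orP[/eqP->|]; [right|left; exists i].
  by move=> [[i ilt ?]|?]; [exists i => //; rewrite ltnS leqW|exists n.+1].
apply: jordan_of_arc => //.
- by apply: run_arc => // i j /andP[ij jn]; apply: H; rewrite ij.
- rewrite open -close.
  case: (p ^@ n.+1) dn1 => s t d1; have [st _ _] := d1; apply/nesym/start_stop => //.
  exact: dart_neq d1.
rewrite open -close -(edge_segment dn1) => q [i ilt iq] nq.
have di := iter_dart i dp.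
have neq : p ^@ i <> p ^@ n.+1 by apply: H; rewrite ltnS ilt /=.
have [[e ->]|[_ ->]] := edge_meet di dn1 neq iq nq; last by left.
right; rewrite -open; congr stop; apply: (next_inj di (iter_dart n dp)).
by rewrite -e.
Qed.

End Orbits.

Section BoundaryCurves.
Context {R : realType}.
Variables (F : set site) (N : nat).
Hypothesis FN : forall s, F s -> ~ outside N%:Z s.

Definition ints (n : nat) : seq int := [seq k%:Z - n%:Z | k <- iota 0 (n + n).+1].

Lemma mem_ints (n : nat) (i : int) : - n%:Z <= i <= n%:Z -> i \in ints n.
Proof.
move=> h; apply/mapP; exists (absz (i + n%:Z)); last by lia.
by rewrite mem_iota; lia.
Qed.

Definition sites (n : nat) : seq site := [seq (i, j) | i <- ints n, j <- ints n].

Lemma mem_sites n s : ~ outside n%:Z s -> s \in sites n.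
Proof.
case: s => i j H; apply: allpairs_f; apply: mem_ints.
  have : ~ (i < - n%:Z) by move=> h; apply: H; apply: Or31.
  have : ~ (n%:Z < i) by move=> h; apply: H; apply: Or32.
  by lia.
have : ~ (j < - n%:Z) by move=> h; apply: H; apply: Or33; left.
have : ~ (n%:Z < j) by move=> h; apply: H; apply: Or33; right.
by lia.
Qed.

Definition darts : seq (site * site) :=
  [seq p <- [seq (s, t) | s <- sites N.+1, t <- sites N] | `[< dart F p >]].

Lemma mem_darts p : p \in darts <-> dart F p.
Proof.
rewrite mem_filter; split=> [/andP[/asboolP]//|dp]; rewrite asboolT // andTb.
case: p dp => s t [[h1 h2 h3] _ /FN ot]; rewrite /= in h1 h2 h3 ot.
apply/flatten_mapP; exists s; last by apply/mapP; exists t => //; exact: mem_sites.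
apply: mem_sites => os; apply: ot; case: os => [h|h|[h|h]].
- by apply: Or31; lia.
- by apply: Or32; lia.
- by apply: Or33; left; lia.
- by apply: Or33; right; lia.
Qed.

Lemma next_darts (x : seq_sub darts) : next F (ssval x) \in darts.
Proof. by apply/mem_darts; apply: next_dart; apply/mem_darts; exact: ssvalP. Qed.

Definition snext (x : seq_sub darts) : seq_sub darts := SeqSub (next_darts x).

Lemma snext_inj : injective snext.
Proof.
move=> x y [e]; apply: val_inj; apply: next_inj e; apply/mem_darts; exact: ssvalP.
Qed.

Lemma iter_snext n x : ssval (iter n snext x) = iter n (next F) (ssval x).
Proof. by elim: n => //= n ->. Qed.

(** [next] is a permutation of the finite set of darts. Each of its orbits is a
closed polygon that is simple by [run_arc], and sides of different orbits do not
meet by [edge_meet]. *)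
Lemma boundary_curves (h : R) : h != 0 ->
  exists (n : nat) (J : 'I_n -> set (sphere R)),
    [/\ forall k, jordan_curve (J k), trivIset setT J &
        \bigcup_k J k = emb h @` [set q | exists2 p, dart F p & edge p q]].
Proof.
move=> h0; pose T := seq_sub darts.
pose roots := enum (froots snext); pose n := size roots.
pose rt (k : 'I_n) : T := tnth (in_tuple roots) k.
have rootK k : froot snext (rt k) = rt k.
  have : rt k \in roots by exact: mem_tnth.
  by rewrite mem_enum => /eqP.
pose E (k : 'I_n) : set (R * R) :=
  [set q | exists2 x : T, froot snext x = rt k & edge (ssval x) q].
exists n, (fun k => emb h @` E k); split.
- move=> k; pose x := rt k; pose m := order snext x.
  have -> : E k = [set q | exists2 i, (i < m)%N & edge (iter i (next F) (ssval x)) q].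
    apply/seteqP; split=> q.
      move=> [y ry yq]; have xy : fconnect snext x y.
        by rewrite -(root_connect (fconnect_sym snext_inj)) ry /x rootK.
      exists (findex snext x y); first exact: findex_max.
      by rewrite -iter_snext iter_findex.
    move=> [i _ iq]; exists (iter i snext x); last by rewrite iter_snext.
    rewrite -[RHS]rootK; apply/eqP; rewrite root_connect; last exact: fconnect_sym snext_inj.
    by rewrite (fconnect_sym snext_inj); exact: fconnect_iter.
  apply: cycle_jordan => //.
  + by apply/mem_darts; exact: ssvalP.
  + exact: order_gt0.
  + by rewrite -iter_snext /m iter_order //; exact: snext_inj.
  move=> i j /andP[ij jm]; rewrite -!iter_snext => e.
  have {}e : iter i snext x = iter j snext x by apply: val_inj.
  have := orbit_uniq snext x; rewrite /orbit => /(uniqP x) /(_ i j).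
  rewrite !inE size_traject => /(_ (ltn_trans ij jm) jm).
  rewrite !nth_traject // ?(ltn_trans ij jm) // => /(_ e) eij.
  by move: ij; rewrite eij ltnn.
- move=> k k' _ _ [y [[q [x rx xq] <-] [q' [x' rx' xq'] e]]].
  have {e} e := emb_inj h0 e; subst q'.
  have dx : dart F (ssval x) by apply/mem_darts; exact: ssvalP.
  have dx' : dart F (ssval x') by apply/mem_darts; exact: ssvalP.
  have same : froot snext x = froot snext x'.
    have [exx'|nxx'] := pselect (ssval x = ssval x').
      by rewrite (val_inj exx').
    apply/eqP; rewrite root_connect; last exact: fconnect_sym snext_inj.
    have [[e _]|[e _]] := edge_meet dx dx' nxx' xq xq'.
      have -> : x' = snext x by exact: val_inj.
      exact: fconnect1.
    have -> : x = snext x' by exact: val_inj.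
    by rewrite (fconnect_sym snext_inj); exact: fconnect1.
  have : rt k = rt k' by rewrite -rx -rx'.
  rewrite /rt !(tnth_nth x) /= => /eqP.
  by rewrite nth_uniq ?enum_uniq ?ltn_ord // => /eqP; exact: val_inj.
- apply/seteqP; split.
    move=> _ [k _ [q [x _ xq] <-]]; exists q => //; exists (ssval x) => //.
    by apply/mem_darts; exact: ssvalP.
  move=> _ [q [p /mem_darts dp pq] <-]; pose x : T := SeqSub dp.
  have xr : froot snext x \in roots.
    by rewrite mem_enum; apply: roots_root; exact: fconnect_sym snext_inj.
  have ilt : (index (froot snext x) roots < n)%N by rewrite index_mem.
  exists (Ordinal ilt) => //; exists q => //; exists x => //.
  by rewrite /rt (tnth_nth x) /= nth_index.
Qed.

End BoundaryCurves.

(** * Topology of unions of hexagons *)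

Section ConnectedExtra.
Context {T : topologicalType}.

(** Any separation of B leaves A on one side, and then also B, which is contained
in the closure of A. *)
Lemma connected_between (A B : set T) : connected A -> A `<=` B -> B `<=` closure A ->
  connected B.
Proof.
move=> cA AB BA; apply/connectedP => E [E0 EB sE].
have incl (E' : bool -> set T) : (forall b, E' b !=set0) -> B = E' false `|` E' true ->
    separated (E' false) (E' true) -> ~ A `<=` E' false.
  move=> E'0 E'B [s1 _] AE; have [x Ex] := E'0 true.
  have : (closure (E' false) `&` E' true) x.
    by split=> //; apply: closureS AE _ _; apply: BA; rewrite E'B; right.
  by rewrite s1.
have AE : A `<=` E false `|` E true by rewrite -EB.
have [|AE'] := connected_subset sE AE cA; first exact: incl.
apply: (incl (E \o negb)) AE'; [by move=> b; exact: E0|by rewrite EB setUC|by rewrite separatedC].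
Qed.

Lemma all_linked_connected (A : set T) x : (forall y, A y -> connected_component A x y) ->
  connected A.
Proof.
move=> H; suff -> : A = connected_component A x by exact: component_connected.
by apply/seteqP; split=> //; exact: connected_component_sub.
Qed.

End ConnectedExtra.

Section Tiles.
Context {R : realType}.
Local Notation plane := (R * R)%type.
Implicit Types (F : set site) (q : plane) (s t : site).

Lemma closed_halfplane (a b c : R) : closed [set q : plane | a * q.1 + b * q.2 <= c].
Proof.
apply: (@closed_comp _ _ (fun q : plane => a * q.1 + b * q.2 : R) [set x | x <= c]).
  move=> q _; apply: cvgD; apply: cvgMl_tmp; [exact: cvg_fst|exact: cvg_snd].
exact: closed_le.
Qed.

Lemma closed_hex s : closed (@hex R s).
Proof.
set X : R := s.1%:~R; set Y : R := s.2%:~R.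
have -> : @hex R s =
  [set q : plane | 2 * q.1 + 1 * q.2 <= 1 + 2 * X + Y] `&`
  [set q : plane | -2 * q.1 + -1 * q.2 <= 1 - 2 * X - Y] `&`
  [set q : plane | 1 * q.1 + 2 * q.2 <= 1 + X + 2 * Y] `&`
  [set q : plane | -1 * q.1 + -2 * q.2 <= 1 - X - 2 * Y] `&`
  [set q : plane | 1 * q.1 + -1 * q.2 <= 1 + X - Y] `&`
  [set q : plane | -1 * q.1 + 1 * q.2 <= 1 - X + Y].
  apply/seteqP; split=> q /=; rewrite /hex /= -/X -/Y.
    by move=> [/andP[? ?] /andP[? ?] /andP[? ?]]; do 5? split; lra.
  by move=> [[[[[? ?] ?] ?] ?] ?]; split; lra.
by do ![apply: closedI | apply: closed_halfplane].
Qed.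

Lemma hex_bound s q : hex s q ->
  `|q.1 - s.1%:~R| <= 2 / 3 /\ `|q.2 - s.2%:~R| <= 2 / 3.
Proof.
move=> [/andP[? ?] /andP[? ?] /andP[? ?]]; rewrite !ler_norml.
by split; apply/andP; split; lra.
Qed.

Lemma compact_box (a b c d : R) :
  compact [set q : plane | a <= q.1 <= b /\ c <= q.2 <= d].
Proof.
have -> : [set q : plane | a <= q.1 <= b /\ c <= q.2 <= d] = `[a, b] `*` `[c, d].
  by apply/seteqP; split=> q /=; rewrite !in_itv /=.
by apply: compact_setX; exact: segment_compact.
Qed.

Lemma compact_hex s : compact (@hex R s).
Proof.
apply: subclosed_compact (@compact_box (s.1%:~R - 1) (s.1%:~R + 1) (s.2%:~R - 1) (s.2%:~R + 1)) _.
  exact: closed_hex.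
move=> q /hex_bound []; rewrite !ler_norml => /andP[? ?] /andP[? ?] /=.
by split; apply/andP; split; lra.
Qed.

Definition tiles F : set plane := [set q | exists2 s, F s & hex s q].

Lemma compact_tiles_seq (l : seq site) F :
  compact (tiles (F `&` [set` l])).
Proof.
elim: l => [|s l IHl].
  have -> : tiles (F `&` [set` [::]]) = set0.
    by rewrite -subset0 => q [s [_ /=]]; rewrite in_nil.
  exact: compact0.
have [Fs|nFs] := pselect (F s); last first.
  suff -> : tiles (F `&` [set` s :: l]) = tiles (F `&` [set` l]) by [].
  apply/seteqP; split=> q [t [Ft /= tl] qt]; exists t => //; split=> //=.
    by move: tl; rewrite inE => /orP[/eqP e|//]; case: nFs; rewrite -e.
  by rewrite inE tl orbT.
have -> : tiles (F `&` [set` s :: l]) = hex s `|` tiles (F `&` [set` l]).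
  apply/seteqP; split=> q.
    move=> [t [Ft /=]]; rewrite inE => /orP[/eqP ->|tl] qt; [by left|right].
    by exists t.
  move=> [qs|[t [Ft /= tl] qt]]; first by exists s => //; split=> //=; rewrite mem_head.
  by exists t => //; split=> //=; rewrite inE tl orbT.
by apply: compactU => //; exact: compact_hex.
Qed.

Lemma compact_tiles F (N : nat) : (forall s, F s -> ~ outside N%:Z s) -> compact (tiles F).
Proof.
move=> FN; suff -> : F = F `&` [set` sites N] by exact: compact_tiles_seq.
by apply/seteqP; split=> [s Fs|s []//]; split=> //=; apply: mem_sites; exact: FN.
Qed.

Lemma hex_star s q (r : R) : hex s q -> 0 <= r <= 1 -> hex s (point_on (centre s) q r).
Proof.
move=> [/andP[a1 a2] /andP[b1 b2] /andP[c1 c2]] /andP[r0 r1].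
have /point_onE[e1 e2] : point_on (centre s) q r = point_on (centre s) q r by [].
have sc (L : R) : -1 <= L -> L <= 1 -> -1 <= r * L <= 1 by move=> *; apply/andP; split; nra.
move: (point_on (centre s) q r) e1 e2 => p e1 e2.
rewrite /hex /= e1 e2 /centre /=; split.
- by have := sc _ a1 a2; lra.
- by have := sc _ b1 b2; lra.
- by have := sc _ c1 c2; lra.
Qed.

(** Points of a hexagon that are strictly closer to the centre than some point of
it are interior. *)
Lemma hex_star_inner s t q (r : R) : hex s q -> 0 <= r < 1 ->
  hex t (point_on (centre s) q r) -> t = s.
Proof.
move=> hs r01 ht; have hs' : hex s (point_on (centre s) q r).
  by apply: hex_star => //; case/andP: r01 => -> /ltW ->.
have st := hex_nb hs' ht; apply/esym; apply: contrapT => nst.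
have [a [b [et1 et2 ab]]] := nb_real (R := R) st nst; move: r01 => /andP[r0 r1].
move: hs => [/andP[a1 a2] /andP[b1 b2] /andP[c1 c2]].
have /point_onE[e1 e2] : point_on (centre s) q r = point_on (centre s) q r by [].
have sc (L : R) : -1 <= L -> L <= 1 -> -1 < r * L < 1 by move=> *; apply/andP; split; nra.
clear hs' st nst; move: (point_on (centre s) q r) e1 e2 ht => p e1 e2.
rewrite /hex /= e1 e2 /centre /= et1 et2; clear e1 e2.
have /andP[f1 f2] := sc _ a1 a2; have /andP[g1 g2] := sc _ b1 b2; have /andP[h1 h2] := sc _ c1 c2.
move: f1 f2 g1 g2 h1 h2; move: (s.1%:~R) (s.2%:~R) (q.1 - s.1%:~R) (q.2 - s.2%:~R) => X Y x y.
have -> : X + r * x - (X + a) = r * x - a by lra.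
have -> : Y + r * y - (Y + b) = r * y - b by lra.
rewrite !mulrDr !(mulrCA r) mulrN; move: (r * x) (r * y) => {}x {}y; clear a1 a2 b1 b2 c1 c2.
move=> f1 f2 g1 g2 h1 h2 [/andP[i1 i2] /andP[j1 j2] /andP[k1 k2]].
by case: ab => [[ea eb]|[ea eb]|[ea eb]|[[ea eb]|[ea eb]|[ea eb]]]; subst a b; lra.
Qed.

(** The midpoint of the side common to two adjacent hexagons, through which one
passes from one to the other without meeting a third hexagon. *)
Definition middle s t : plane := point_on (centre s) (centre t) (1 / 2).

Lemma middle_edge s t : nb s t -> s <> t -> middle s t = point_on (start (s, t)) (stop (s, t)) (1 / 2).
Proof.
move=> st nst; apply/point_onE.
have /point_onE[-> ->] : middle s t = point_on (centre s) (centre t) (1 / 2) by [].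
rewrite /start /stop /corner /left /right /centre /= !(intrD, mulrNz).
by have [a [b [-> -> _]]] := nb_real (R := R) st nst; split; lra.
Qed.

Lemma hex_middle s t : nb s t -> s <> t -> edge (s, t) (middle s t).
Proof.
move=> st nst; rewrite middle_edge //; apply/edgeE => //; exists (1 / 2) => //; lra.
Qed.

Lemma hex_middle_only s t u : nb s t -> s <> t -> hex u (middle s t) -> u = s \/ u = t.
Proof.
move=> st nst hu; have [hs ht] := hex_middle st nst.
apply: contrapT => /not_orP[us ut].
have [tl tr] := triple_corner st nst hs ht.
have ss := start_stop (R := R) st nst.
have [e|e] := nb_third st nst (hex_nb hs hu) (hex_nb ht hu) us ut; move: hu; rewrite e.
  move/tl; rewrite middle_edge // -{2}(point_on1 (start (s, t)) (stop (s, t))).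
  by move/(point_on_inj ss); lra.
move/tr; rewrite middle_edge // -{2}(point_on0 (start (s, t)) (stop (s, t))).
by move/(point_on_inj ss); lra.
Qed.

Lemma point_on_connected q q' : connected (segment q q').
Proof.
have -> : segment q q' = point_on q q' @` `[0, 1].
  apply/seteqP; split=> x; first by move=> [r r01 ->]; exists r => //=; rewrite in_itv.
  by move=> [r /=]; rewrite in_itv /= => r01 <-; exists r.
apply: connected_continuous_connected; first exact: segment_connected.
by apply: continuous_subspaceT; exact: point_on_continuous.
Qed.

Lemma segment_component (A : set plane) q q' : segment q q' `<=` A ->
  connected_component A q q'.
Proof.
move=> sA; exists (segment q q'); last by exists 1; rewrite ?point_on1 //; lra.
split=> //; last exact: point_on_connected.
by exists 0; rewrite ?point_on0 //; lra.
Qed.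

Lemma connected_tiles F : sconnected F -> connected (tiles F).
Proof.
move=> cF; have [[q [s Fs sq]]|] := pselect (exists q, tiles F q); last first.
  move=> n; have -> : tiles F = set0 by rewrite -subset0 => q Fq; apply: n; exists q.
  exact: connected0.
have tocentre t p : F t -> hex t p -> connected_component (tiles F) (centre t) p.
  move=> Ft tp; apply: segment_component => _ [r r01 ->].
  by exists t => //; exact: hex_star.
apply: (@all_linked_connected _ _ (centre s)) => p [t Ft tp].
apply: (connected_component_trans _ (tocentre _ _ Ft tp)).
have := cF _ _ Fs Ft; move: (t); apply: linked_ind.
  by apply: connected_component_refl; exists s => //; exact: hex_centre.
move=> u v su cu Fv uv; have [->//|nuv] := pselect (v = u).
have Fu := linked_r su; have [hu hv] := hex_middle uv (nesym nuv).
apply: (connected_component_trans cu).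
apply: (connected_component_trans (tocentre _ _ Fu hu)).
by apply: connected_component_sym; exact: tocentre.
Qed.

(** A point of the complement is joined to the centre of its hexagon by a segment
of interior points, and centres of adjacent hexagons through the middle of the
common side. *)
Lemma connected_untiled F (o : site) : (forall s, ~ F s -> linked nb (~` F) s o) ->
  connected (~` tiles F).
Proof.
move=> lF; have tocentre s q : ~ F s -> hex s q -> ~ tiles F q ->
    connected_component (~` tiles F) (centre s) q.
  move=> nFs sq nq; apply: segment_component => _ [r r01 ->] [t Ft].
  have [r1|r1] := ltP r 1.
    move=> ht; apply: nFs; rewrite -(hex_star_inner sq _ ht) //.
    by case/andP: r01 => ->.
  have -> : r = 1 by lra.
  by rewrite point_on1 => tq; apply: nq; exists t.
have ncentre s : ~ F s -> ~ tiles F (centre s).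
  move=> nFs [t Ft ht]; apply: nFs; suff -> : s = t by [].
  apply/esym; apply: (@hex_star_inner s t (centre s) 0 (hex_centre s)); first lra.
  by rewrite point_on0.
apply: (@all_linked_connected _ _ (centre o)) => q nq.
have [s sq] := hex_cover q; have nFs : ~ F s by move=> Fs; apply: nq; exists s.
apply: connected_component_trans (tocentre _ _ nFs sq nq).
have := linked_sym nb_sym (lF _ nFs); move: (s); apply: linked_ind.
  apply: connected_component_refl; apply: ncentre; exact: linked_r (lF _ nFs).
move=> u v ou cu nFv uv; have [->//|nuv] := pselect (v = u).
have nFu := linked_r ou; have [hu hv] := hex_middle uv (nesym nuv).
have nm : ~ tiles F (middle u v).
  by move=> [t Ft /(hex_middle_only uv (nesym nuv))[e|e]]; [apply: nFu|apply: nFv]; rewrite -e.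
apply: (connected_component_trans cu).
apply: (connected_component_trans (tocentre _ _ nFu hu nm)).
by apply: connected_component_sym; exact: tocentre.
Qed.

End Tiles.

(** * Complements of finite unions of hexagons in the sphere *)

Section Region.
Context {R : realType}.
Local Notation plane := (R * R)%type.
Variables (h : R) (F : set site) (N : nat) (o : site).
Hypothesis h0 : h != 0.
Hypothesis FN : forall s, F s -> ~ outside N%:Z s.
Hypothesis linkF : forall s, ~ F s -> linked nb (~` F) s o.

Definition region : set (sphere R) := ~` (emb h @` tiles F).

Lemma region_open : open region.
Proof. apply: emb_compact_open => //; exact: compact_tiles FN. Qed.

Lemma region_infty : region infty.
Proof. by move=> [q _]. Qed.

Lemma region_emb q : region (emb h q) <-> ~ tiles F q.
Proof.
split=> [nq Fq|nq [q' Fq' e]]; first by apply: nq; exists q.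
by apply: nq; rewrite -(emb_inj h0 e).
Qed.

(** The finite part is connected and infinity belongs to its closure, because both
the removed set and any compact set are bounded. *)
Lemma region_connected : connected region.
Proof.
apply: (@connected_between _ (emb h @` (~` tiles F))).
- apply: connected_continuous_connected; first exact: connected_untiled linkF.
  by apply: continuous_subspaceT; exact: emb_continuous.
- by move=> _ [q nq <-]; apply/region_emb.
move=> x Gx; have [->|xi] := pselect (x = infty); last first.
  have [q e] := emb_surj h0 xi; rewrite e in Gx *.
  by apply: subset_closure; exists q => //; apply/region_emb.
move=> B [U [cU _] UB].
have cV : compact (@coords R @` U).
  by apply: continuous_compact => //; apply: continuous_subspaceT; exact: coords_continuous.
have [M [_ MV]] := compact_bounded cV.
have [M' [_ MT]] := compact_bounded (compact_tiles (R := R) FN).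
pose a : R := Num.max 1 (M + 1); pose b : R := Num.max 1 (M' + 1).
have [a1 aM] : 1 <= a /\ M < a.
  by split; rewrite /a ?le_max ?lt_max ?lexx //; apply/orP; right; lra.
have [b1 bM] : 1 <= b /\ M' < b.
  by split; rewrite /b ?le_max ?lt_max ?lexx //; apply/orP; right; lra.
have nh0 : 0 < `|h| by rewrite normr_gt0.
pose c : R := b + a / `|h| + 1.
have ah0 : 0 < a / `|h| by apply: divr_gt0 => //; lra.
pose q : plane := (c, 0).
have c0 : 0 < c by rewrite /c; lra.
exists (emb h q); split.
  exists q => // Tq; have : `|q| <= b := MT _ bM q Tq.
  rewrite prod_normE /= ge_max (gtr0_norm c0) => /andP[+ _].
  by rewrite /c; lra.
apply: UB; left; exists (cplx (h *: q)) => // Uq.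
have Vq : (@coords R @` U) (h *: q) by exists (cplx (h *: q)) => //; rewrite cplxK.
have : `|h *: q| <= a := MV _ aM _ Vq.
rewrite normrZ prod_normE /= normr0 (gtr0_norm c0) (max_l (ltW c0)).
have : `|h| * (a / `|h|) = a by rewrite mulrC divfK // gt_eqF.
by rewrite /c; nra.
Qed.

Lemma region_domain : domain region.
Proof.
split; [by exists infty; exact: region_infty | exact: region_open |
  exact: region_connected].
Qed.

(** Near q only finitely many hexagons matter, and those outside F, being closed,
stay away from q. *)
Lemma tiles_neighbourhood (q : plane) : tiles F q -> (forall s, hex s q -> F s) ->
  nbhs q (tiles F).
Proof.
move=> Fq only.
have [M Mq] : exists M : nat, `|q.1| + `|q.2| + 5 <= M%:R.
  by exists (Num.bound (`|q.1| + `|q.2| + 5)); apply/ltW/archi_boundP; rewrite !addr_ge0.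
pose B : set plane := tiles (~` F `&` [set` sites M]).
have cB : compact B by exact: compact_tiles_seq.
have clB : closed B by apply: compact_closed => //; exact: norm_hausdorff.
have nB : (~` B) q by move=> [s [nFs _] /only].
have : nbhs q (~` B `&` ball q 1).
  apply: filterI; last exact: nbhsx_ballx.
  by apply: open_nbhs_nbhs; split=> //; exact: closed_openC.
apply: filterS => p [nBp [p1 p2]]; have [s sp] := hex_cover p; exists s => //.
apply: contrapT => nFs; apply: nBp; exists s => //; split=> //=.
apply: mem_sites => out; have [s1 s2] := hex_bound sp.
move: p1 p2; rewrite /ball /= => p1 p2.
have b1 : `|s.1%:~R| < M%:R - 1 :> R.
  move: s1 p1 Mq; rewrite !ltr_norml !ler_norml => /andP[? ?] /andP[? ?].
  have := ler_norm q.1; have := ler_norm (- q.1); rewrite normrN.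
  by have := normr_ge0 q.2 => *; apply/andP; split; lra.
have b2 : `|s.2%:~R| < M%:R - 1 :> R.
  move: s2 p2 Mq; rewrite !ltr_norml !ler_norml => /andP[? ?] /andP[? ?].
  have := ler_norm q.2; have := ler_norm (- q.2); rewrite normrN.
  by have := normr_ge0 q.1 => *; apply/andP; split; lra.
have conv (i : int) : `|i%:~R| < M%:R - 1 :> R -> - M%:Z <= i <= M%:Z.
  rewrite ltr_norml => /andP[h1 h2]; apply/andP; split.
    by rewrite -(ler_int R) mulrNz -pmulrn; lra.
  by rewrite -(ler_int R) -pmulrn; lra.
by have := conv _ b1; have := conv _ b2; clear -out; case: out => [?|?|[?|?]]; lia.
Qed.

(** A point of a hexagon outside F is a limit of interior points of that hexagon;
conversely a point all of whose hexagons are in F has a neighbourhood covered by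
F. *)
Lemma region_boundary :
  boundary region = emb h @` [set q | exists2 p, dart F p & edge p q].
Proof.
rewrite /boundary (_ : interior region = region); last first.
  apply/seteqP; split; first exact: interior_subset.
  by move=> y Gy; apply: open_nbhs_nbhs; split=> //; exact: region_open.
apply/seteqP; split=> x.
  move=> [cx nx]; have [q Fq e] : (emb h @` tiles F) x by apply: contrapT.
  exists q => //; have [t Ft tq] := Fq; subst x.
  have [[s [nFs sq]]|only] := pselect (exists s, ~ F s /\ hex s q).
    by exists (s, t) => //; split=> //; exact: hex_nb sq tq.
  have nq : nbhs q (tiles F).
    apply: tiles_neighbourhood => // s sq; apply: contrapT => nFs.
    by apply: only; exists s.
  move: nq; rewrite nbhsE => -[U [oU Uq] UF].
  have [y [Gy [p Up e]]] : region `&` (emb h @` U) !=set0.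
    apply: cx; apply: open_nbhs_nbhs; split; last by exists q.
    exact: emb_open.
  by exfalso; apply: Gy; exists p => //; exact: UF.
move=> [q [[s t] [st nFs Ft] [/= sq tq]] <-]; split; last first.
  by move/region_emb; apply; exists t.
move=> B nB.
have c1 : continuous_at (1 : R) (emb h \o point_on (centre s) q).
  by apply: continuous_comp; [exact: point_on_continuous | exact: emb_continuous].
have : nbhs (1 : R) ((emb h \o point_on (centre s) q) @^-1` B).
  by apply: c1; rewrite /= point_on1.
move=> /nbhs_ballP[e /= e0 eB].
pose d := Num.min (e / 2) (1 / 2).
have [d1 d2] : d <= e / 2 /\ d <= 1 / 2 by rewrite /d !ge_min !lexx orbT.
have d0 : 0 < d by rewrite /d lt_min; apply/andP; split; lra.
exists (emb h (point_on (centre s) q (1 - d))); split.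
  apply/region_emb => -[u Fu hu]; apply: nFs.
  by rewrite -(hex_star_inner sq _ hu) //; lra.
by apply: eB; rewrite /ball /= opprB addrC subrK gtr0_norm //; lra.
Qed.

(** The hexagons of F that are not in F' form another compact set, disjoint from
those of F' because no adjacency joins them. *)
Lemma region_component (F' : set site) x : F' `<=` F -> sconnected F' ->
  (forall s t, F' s -> F t -> nb s t -> F' t) ->
  (emb h @` tiles F') x -> connected_component (~` region) x = emb h @` tiles F'.
Proof.
move=> F'F cF' closedF' F'x.
have F'N s : F' s -> ~ outside N%:Z s by move=> /F'F; exact: FN.
rewrite setCK; apply/seteqP; split.
  pose F2 := F `&` ~` F'.
  have F2N s : F2 s -> ~ outside N%:Z s by move=> [/FN].
  have cl1 : closed (emb h @` tiles F').
    by rewrite -openC; apply: emb_compact_open => //; exact: compact_tiles F'N.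
  have cl2 : closed (emb h @` tiles F2).
    by rewrite -openC; apply: emb_compact_open => //; exact: compact_tiles F2N.
  have disj : (emb h @` tiles F') `&` (emb h @` tiles F2) = set0.
    rewrite -subset0 => _ [[q [s F's sq] <-] [q' [t [Ft nF't] tq] e]].
    have {e} e := emb_inj h0 e; subst q'; apply: nF't.
    exact: closedF' F's Ft (hex_nb sq tq).
  have sep : separated (emb h @` tiles F') (emb h @` tiles F2).
    by rewrite /separated -(closure_id _).1 // -(closure_id _).1.
  have cov : connected_component (emb h @` tiles F) x `<=`
      (emb h @` tiles F') `|` (emb h @` tiles F2).
    move=> y /connected_component_sub [q [s Fs sq] <-].
    have [F's|nF's] := pselect (F' s); [left|right]; exists q => //; exists s => //.
  have [//|H] := connected_subset sep cov (@component_connected _ _ x).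
  have xF : (emb h @` tiles F) x.
    by case: F'x => q [s F's sq] <-; exists q => //; exists s => //; exact: F'F.
  have : (emb h @` tiles F' `&` emb h @` tiles F2) x.
    by split=> //; apply: H; exact: connected_component_refl.
  by rewrite disj.
apply: connected_component_max => //.
  by move=> _ [q [s F's sq] <-]; exists q => //; exists s => //; exact: F'F.
apply: connected_continuous_connected; first exact: connected_tiles.
by apply: continuous_subspaceT; exact: emb_continuous.
Qed.

End Region.

(** * Clusters of a compact set *)

Section Chains.
Context {R : realType} {V : normedModType R}.
Implicit Types (S A B C : set V) (x y z u v : V) (r d eta sigma mu : R).

(** Compactness in the form used throughout: a property of small positive numbers
that holds locally uniformly holds uniformly. *)
Lemma compact_uniform A (P : R -> V -> Prop) : compact A ->
  (forall x, A x -> exists2 r, 0 < r &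
     forall y d, A y -> `|x - y| < r -> 0 < d < r -> P d y) ->
  exists2 r, 0 < r & forall d x, 0 < d < r -> A x -> P d x.
Proof.
move=> /compact_near_coveringP/near_covering_withinP cA H.
have : \forall d \near (0 : R)^'+, A `<=` P d.
  apply: cA => x Ax; have [r r0 Hr] := H x Ax.
  exists (ball x r, [set d | 0 < d < r]) => /=.
    split; first exact: nbhsx_ballx.
    near=> d; apply/andP; split; near: d; [exact: nbhs_right_gt | exact: nbhs_right_lt].
  move=> [y d] [/= xy dr] Ay; apply: Hr => //.
  by move: xy; rewrite -ball_normE.
move=> [r /= r0 Hr]; exists r => // d x /andP[d0 dr] Ax; apply: (Hr d) => //.
by rewrite /= sub0r normrN gtr0_norm.
Unshelve. all: by end_near. Qed.

Lemma ge_minl (a b : R) : Num.min a b <= a. Proof. by rewrite ge_min lexx. Qed.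

Lemma ge_minr (a b : R) : Num.min a b <= b. Proof. by rewrite ge_min lexx orbT. Qed.

Definition nbd A r : set V := [set z | exists2 a, A a & `|a - z| < r].

Lemma open_nbd A r : open (nbd A r).
Proof.
have -> : nbd A r = \bigcup_(a in A) ball a r.
  by rewrite -ball_normE; apply/seteqP; split=> z [a ? ?]; exists a.
by apply: bigcup_open => a _; exact: ball_open.
Qed.

Lemma openP A x : open A -> A x -> exists2 r, 0 < r & forall y, `|x - y| < r -> A y.
Proof.
move=> oA Ax; have /nbhs_ballP[r r0 H] : nbhs x A by exact: open_nbhs_nbhs.
by exists r => // y xy; apply: H; rewrite -ball_normE.
Qed.

Definition close eta (u v : V) : Prop := `|u - v| < eta.

Lemma close_sym eta u v : close eta u v -> close eta v u.
Proof. by rewrite /close distrC. Qed.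

(** The points of S reached from x by steps in S shorter than eta. *)
Definition chain S eta x : set V := linked (close eta) S x.

Lemma chain_sub S eta x : chain S eta x `<=` S.
Proof. by move=> y; apply: linked_r. Qed.

Lemma chain_mono S eta eta' x : eta <= eta' -> chain S eta x `<=` chain S eta' x.
Proof. by move=> le y; apply: linked_rel => u v uv; apply: lt_le_trans uv le. Qed.

Lemma chain_close S eta x y z : chain S eta x y -> S z -> `|y - z| < eta -> chain S eta x z.
Proof.
move=> xy Sz yz; apply: (linked_trans xy); apply: linked_step => //.
exact: linked_r xy.
Qed.

Lemma chain_eq S eta x y : chain S eta x y -> chain S eta x = chain S eta y.
Proof.
move=> xy; apply/seteqP; split=> z; last exact: linked_trans.
by apply: linked_trans; apply: linked_sym xy; exact: close_sym.
Qed.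

Lemma closed_chain S eta x : 0 < eta -> closed S -> closed (chain S eta x).
Proof.
move=> eta0 cS z cz; have Sz : S z.
  by rewrite (closure_id S).1 //; apply: closureS cz; exact: chain_sub.
have [y [xy yz]] := cz _ (nbhsx_ballx z _ eta0).
by apply: chain_close xy Sz _; move: yz; rewrite -ball_normE /= distrC.
Qed.

(** The chain is open and closed in S. *)
Lemma connected_chain S C eta x : 0 < eta -> connected C -> C `<=` S -> C x ->
  C `<=` chain S eta x.
Proof.
move=> eta0 cC CS Cx; suff CE : C `&` chain S eta x = C by rewrite -CE; apply: subIsetr.
apply: cC.
- by exists x; split=> //; apply: linked_refl; apply: CS.
- exists (nbd (chain S eta x) eta); first exact: open_nbd.
  apply/seteqP; split=> z [Cz]; last first.
    by move=> [y xy yz]; split=> //; apply: chain_close xy (CS _ Cz) yz.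
  by move=> xz; split=> //; exists z => //; rewrite subrr normr0.
- exists (~` nbd (S `\` chain S eta x) eta).
    by apply: open_closedC; exact: open_nbd.
  apply/seteqP; split=> z [Cz].
    move=> xz; split=> // -[y [Sy nxy] yz]; apply: nxy.
    by apply: chain_close xz Sy _; rewrite distrC.
  move=> nz; split=> //; apply: contrapT => nxz; apply: nz.
  by exists z; [split=> //; exact: CS|rewrite subrr normr0].
Qed.

Definition quasicomponent S x : set V := [set y | forall eta, 0 < eta -> chain S eta x y].

(** The chains decrease with eta and their complements are open, so finitely many
of them cover the compact part of S outside O. *)
Lemma chain_in_open S (O : set V) x : compact S -> open O -> quasicomponent S x `<=` O ->
  exists2 eta, 0 < eta & forall d, 0 < d < eta -> chain S d x `<=` O.
Proof.
move=> cS oO QO.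
have cSO : compact (S `&` ~` O).
  apply: compact_closedI => //; exact: open_closedC.
have [z [Sz nOz]|r r0 H] := @compact_uniform _ (fun d z => ~ chain S d x z) cSO.
  have /existsNP[eta /not_implyP[eta0 nxz]] : ~ quasicomponent S x z by move/QO.
  exists eta => // y d [Sy _] zy /andP[d0 de] xy; apply: nxz.
  have xy' : chain S eta x y by apply: chain_mono xy; exact: ltW.
  by apply: chain_close xy' Sz _; rewrite distrC.
exists r => // d dr z xz; apply: contrapT => nO; apply: (H d z dr) => //.
by split=> //; exact: chain_sub xz.
Qed.

(** If the quasicomponent split into two compact parts, these would be at some
distance r, and a chain with steps less than r / 3 that stays within r / 3 of
their union could not jump from one part to the other. *)
Lemma connected_quasicomponent S x : compact S -> connected (quasicomponent S x).
Proof.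
move=> cS; have clS : closed S by apply: compact_closed => //; exact: norm_hausdorff.
have clQ : closed (quasicomponent S x).
  move=> z cz eta eta0; rewrite (closure_id (chain S eta x)).1; last exact: closed_chain.
  by apply: closureS cz => y; apply.
have [Sx|nSx] := pselect (S x); last first.
  rewrite (_ : quasicomponent S x = set0); first exact: connected0.
  by rewrite -subset0 => z /(_ 1 ltr01) xz; apply: nSx; exact: linked_l xz.
have QS : quasicomponent S x `<=` S by move=> z /(_ 1 ltr01); exact: chain_sub.
have Qx : quasicomponent S x x by move=> eta _; apply: linked_refl.
apply/connectedP => E [E0 EU sE].
wlog Ex : E E0 EU sE / E false x.
  move=> G; have : quasicomponent S x x by [].
  rewrite EU => -[Ex|Ex]; first exact: G Ex.
  by apply: (G (E \o negb)) => //;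
    [case => /=|rewrite EU setUC|rewrite separatedC].
have Esub b : E b `<=` quasicomponent S x.
  by rewrite EU; case: b => z Ez; [right|left].
have clE b : closed (E b).
  move=> z cz; have Qz : quasicomponent S x z.
    by rewrite ((closure_id _).1 clQ); apply: closureS cz; exact: Esub.
  have [s1 s2] := sE; move: Qz; rewrite EU => -[] Ez; case: b cz => cz //; exfalso.
  - by have : (E false `&` closure (E true)) z; [split | rewrite s2].
  - by have : (closure (E false) `&` E true) z; [split | rewrite s1].
have [r r0 gap] : exists2 r, 0 < r & forall a b, E false a -> E true b -> r <= `|a - b|.
  have cE : compact (E false).
    by apply: subclosed_compact cS _ => //; apply: subset_trans QS; exact: Esub.
  have [a Ea|r r0 H] := @compact_uniform _
      (fun d a => forall b, E true b -> d <= `|a - b|) cE.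
    have nEa : (~` E true) a.
      by move=> Eb; have := separated_disjoint sE; apply/eqP/set0P; exists a.
    have [r r0 H] := openP (closed_openC (clE true)) nEa.
    exists (r / 2); first by lra.
    move=> a' d _ aa' /andP[d0 dr] b Eb; rewrite leNgt; apply/negP => a'b.
    apply: (H b) => //; apply: le_lt_trans (ler_distD a' _ _) _; lra.
  exists (r / 2) => [|a b Ea Eb]; first by lra.
  by apply: (H (r / 2) a) => //; lra.
pose O := nbd (E false) (r / 3) `|` nbd (E true) (r / 3).
have oO : open O by apply: openU; exact: open_nbd.
have QO : quasicomponent S x `<=` O.
  rewrite EU => z [] Ez; [left|right]; exists z => //; rewrite subrr normr0; lra.
have [eta eta0 HO] := chain_in_open cS oO QO.
pose d := Num.min (eta / 2) (r / 3).
have d0 : 0 < d by rewrite lt_min; apply/andP; split; lra.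
have [deta dr] : d < eta /\ d <= r / 3.
  by split; [apply: le_lt_trans (ge_minl _ _) _; lra | exact: ge_minr].
have [b Eb] := E0 true.
have xb : chain S d x b by apply: (Esub true).
have Bx : nbd (E false) (r / 3) x by exists x => //; rewrite subrr normr0; lra.
have nBb : ~ nbd (E false) (r / 3) b.
  by move=> [a Ea ab]; have := gap _ _ Ea Eb; lra.
have [u [v [xu [a Ea au] Sv nBv uv]]] := linked_frontier Bx nBb xb.
have xv : chain S d x v by apply: chain_close xu Sv uv.
have [//|[b' Eb' b'v]] : O v by apply: (HO d) => //; rewrite d0.
have := gap _ _ Ea Eb'; rewrite leNgt => /negP; apply.
apply: le_lt_trans (ler_distD v _ _) _; rewrite (distrC v b').
have := ler_distD u a v; rewrite /close in uv; lra.
Qed.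

(** The chains of x shrink to its quasicomponent, which is connected. *)
Lemma chain_near_component S x sigma : compact S -> 0 < sigma ->
  exists2 eta, 0 < eta & forall d, 0 < d < eta ->
    chain S d x `<=` nbd (connected_component S x) sigma.
Proof.
move=> cS sigma0; apply: chain_in_open => //; first exact: open_nbd.
move=> z Qz; exists z; last by rewrite subrr normr0.
have Sx : S x by exact: linked_l (Qz 1 ltr01).
exists (quasicomponent S x) => //; split; last exact: connected_quasicomponent.
  by move=> eta _; exact: linked_refl.
by move=> y /(_ 1 ltr01); exact: chain_sub.
Qed.

(** A chain uses finitely many steps, all shorter than eta, so each of its points
is reached with steps shorter than some eta' < eta; by compactness a single eta'
suffices. *)
Lemma chain_slack S x eta : compact S -> S x -> 0 < eta ->
  exists2 r, 0 < r & forall d, 0 < d < r -> chain S eta x `<=` chain S (eta - d) x.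
Proof.
move=> cS Sx eta0; have clS : closed S by apply: compact_closed => //; exact: norm_hausdorff.
have cC : compact (chain S eta x).
  apply: subclosed_compact cS _; [exact: closed_chain|exact: chain_sub].
have slack y : chain S eta x y -> exists2 r, 0 < r & chain S (eta - r) x y.
  move: y; apply: linked_ind.
    by exists 1 => //; apply: linked_refl.
  move=> u v xu [r r0 xru] Sv uv.
  pose s := Num.min r ((eta - `|u - v|) / 2).
  have uv' : `|u - v| < eta by [].
  have [sr su] : s <= r /\ s <= (eta - `|u - v|) / 2.
    by split; [exact: ge_minl|exact: ge_minr].
  exists s; first by rewrite lt_min r0 /=; lra.
  apply: (@chain_close _ _ _ u) => //; last by lra.
  by apply: chain_mono xru; lra.
have [y xy|r r0 H] := @compact_uniform _ (fun d y => chain S (eta - d) x y) cC.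
  have [r r0 xry] := slack y xy.
  pose s := Num.min r (eta / 2).
  have [sr su] : s <= r /\ s <= eta / 2 by split; [exact: ge_minl|exact: ge_minr].
  exists s; first by rewrite lt_min r0 /=; lra.
  move=> z d xz yz /andP[d0 ds].
  apply: (@chain_close _ _ _ y); [|exact: chain_sub xz|lra].
  by apply: chain_mono xry; lra.
by exists r => // d dr z xz; apply: H.
Qed.

Lemma uniform_slack (n : nat) (Q : nat -> R -> Prop) :
  (forall i, (i < n)%N -> exists2 r, 0 < r & forall d, 0 < d < r -> Q i d) ->
  exists2 r, 0 < r & forall i d, (i < n)%N -> 0 < d < r -> Q i d.
Proof.
elim: n => [|n IHn] H; first by exists 1.
have [|r r0 Hr] := IHn; first by move=> i ilt; apply: H; rewrite ltnW.
have [s s0 Hs] := H n (ltnSn n).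
exists (Num.min r s); first by rewrite lt_min r0.
move=> i d; rewrite ltnS leq_eqVlt lt_min => /orP[/eqP->|ilt] /and3P[d0 dr ds].
  by apply: Hs; rewrite d0.
by apply: Hr => //; rewrite d0.
Qed.

(** Cover S by finitely many chains, each close to the component it contains.
Chains of different scales are nested or disjoint, so the maximal ones form a
partition. Keeping whole chains, instead of cutting S at one uniform scale,
ensures that each part contains the component near which it lies. *)
Lemma cluster_partition S sigma : compact S -> 0 < sigma ->
  exists (n : nat) (D : set nat) (x : nat -> V) (eta : nat -> R),
  let U i := chain S (eta i) (x i) in
  [/\ D `<=` `I_n,
      forall i, D i -> [/\ S (x i), 0 < eta i < sigma &
        connected_component S (x i) `<=` U i /\
        U i `<=` nbd (connected_component S (x i)) sigma],
      forall y, S y -> exists2 i, D i & U i y,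
      forall i k u v, D i -> D k -> U i u -> U k v ->
        `|u - v| < Num.max (eta i) (eta k) -> U i = U k &
      exists2 mu, 0 < mu & forall i, D i -> 2 * mu < eta i /\
        U i `<=` chain S (eta i - 2 * mu) (x i)].
Proof.
move=> cS sigma0.
have /choice[e eP] (x : V) : exists eta : R, 0 < eta < sigma /\
    chain S eta x `<=` nbd (connected_component S x) sigma.
  have [r r0 H] := chain_near_component x cS sigma0.
  pose s := Num.min r sigma.
  have [sr su] : s <= r /\ s <= sigma by split; [exact: ge_minl|exact: ge_minr].
  have s0 : 0 < s by rewrite lt_min r0.
  by exists (s / 2); split; [lra|apply: H; lra].
have := cS; rewrite compact_cover => /(_ V S (fun x => nbd [set x] (e x))) [||F FS cov].
- by move=> x _; exact: open_nbd.
- move=> x Sx; exists x => //; exists x => //; rewrite subrr normr0.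
  by have [/andP[]] := eP x.
pose n := size (enum_fset F); pose x i := nth 0 (enum_fset F) i.
pose eta i := e (x i); pose U i := chain S (eta i) (x i).
have xS i : (i < n)%N -> S (x i).
  by move=> ilt; have /FS := mem_nth 0 ilt; move/set_mem.
have eta0 i : 0 < eta i by have [/andP[]] := eP (x i).
pose D := [set i | (i < n)%N /\ forall k z, (k < n)%N -> U k z -> U i z -> eta k <= eta i].
have Ueq i k z : D i -> D k -> U i z -> U k z -> U i = U k.
  move=> [ilt iM] [klt kM] iz kz; rewrite /U (chain_eq iz) (chain_eq kz).
  congr (chain S _ z); apply/eqP; rewrite eq_le; apply/andP; split.
    exact: kM ilt iz kz.
  exact: iM klt kz iz.
exists n, D, x, eta; split.
- by move=> i [].
- move=> i [ilt _]; have [e1 e2] := eP (x i); split=> //; first exact: xS.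
  split=> //; apply: connected_chain => //; first exact: component_connected.
    exact: connected_component_sub.
  by apply: connected_component_refl; exact: xS.
- move=> y Sy; have [i0 ilt0 iy0] : exists2 i, (i < n)%N & U i y.
    have [z /= zF [z' -> zy]] := cov y Sy.
    exists (index z (enum_fset F)); first by rewrite index_mem.
    rewrite /U /eta /x nth_index //.
    apply: (@chain_close _ _ _ z) => //; apply: linked_refl.
    by have /FS := zF; move/set_mem.
  have [||i [ilt iy imax]] := @ex_maximal n (fun i => U i y) (fun i k => eta i <= eta k) _ _
     (ex_intro2 _ _ i0 ilt0 iy0).
  + by move=> i.
  + by move=> j i k; apply: le_trans.
  exists i => //; split=> // k z klt kz iz; rewrite leNgt; apply/negP => lt.
  suff /(imax k klt) : U k y by move=> /(_ (ltW lt)); rewrite leNgt lt.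
  rewrite /U (chain_eq kz); apply: (chain_mono (ltW lt)).
  by rewrite -/(chain S (eta i) z) -(chain_eq iz).
- move=> i k u v Di Dk iu kv; rewrite lt_max => /orP[uv|uv].
    apply: (Ueq _ _ v) => //; apply: chain_close iu _ uv; exact: chain_sub kv.
  apply: (Ueq _ _ u) => //; apply: chain_close kv _ _; first exact: chain_sub iu.
  by rewrite distrC.
- have [|r r0 H] := @uniform_slack n (fun i d => d < eta i /\ U i `<=` chain S (eta i - d) (x i)).
    move=> i ilt; have [r r0 H] := chain_slack cS (xS _ ilt) (eta0 i).
    exists (Num.min r (eta i)); first by rewrite lt_min r0 eta0.
    by move=> d; rewrite lt_min => /and3P[d0 dr de]; split=> //; apply: H; rewrite d0.
  exists (r / 4) => [|i [ilt _]]; first by lra.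
  by apply: H => //; lra.
Qed.

End Chains.

Section ClusterFamily.
Context {R : realType} {V : normedModType R}.

(** Two different clusters are at distance at least the larger of their scales,
whereas each is connected by steps shorter than its scale by the margin 2 mu.
This room allows both to be thickened to connected sets that stay apart. *)
Record clusters (S : set V) (sigma : R) (n : nat) (x : nat -> V) (eta : nat -> R)
    (mu : R) : Prop := Clusters {
  cl_mu : 0 < mu;
  cl_mem : forall i, (i < n)%N -> S (x i);
  cl_eta : forall i, (i < n)%N -> 2 * mu < eta i < sigma;
  cl_component : forall i, (i < n)%N ->
    connected_component S (x i) `<=` chain S (eta i) (x i);
  cl_near : forall i, (i < n)%N ->
    chain S (eta i) (x i) `<=` nbd (connected_component S (x i)) sigma;
  cl_slack : forall i, (i < n)%N ->
    chain S (eta i) (x i) `<=` chain S (eta i - 2 * mu) (x i);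
  cl_cover : forall y, S y -> exists2 i, (i < n)%N & chain S (eta i) (x i) y;
  cl_sep : forall i k u v, (i < n)%N -> (k < n)%N ->
    chain S (eta i) (x i) u -> chain S (eta k) (x k) v ->
    `|u - v| < Num.max (eta i) (eta k) -> chain S (eta i) (x i) = chain S (eta k) (x k)
}.

Lemma clusters_exist (S : set V) (sigma : R) : compact S -> 0 < sigma ->
  exists n x eta mu, clusters S sigma n x eta mu.
Proof.
move=> cS sigma0.
have [n [D [x [eta [Dn prop cov sep [mu mu0 slack]]]]]] := cluster_partition cS sigma0.
pose l := [seq i <- iota 0 n | `[< D i >]]; pose f k := nth 0%N l k.
have fD k : (k < size l)%N -> D (f k).
  by move=> /(mem_nth 0%N); rewrite mem_filter => /andP[/asboolP].
exists (size l), (x \o f), (eta \o f), mu; split => //.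
- by move=> k /fD /prop[].
- by move=> k kl; have [_ /andP[_ ->] _] := prop _ (fD k kl); have [-> _] := slack _ (fD k kl).
- by move=> k /fD /prop[_ _ []].
- by move=> k /fD /prop[_ _ []].
- by move=> k /fD /slack[].
- move=> y /cov[i Di iy]; have il : i \in l.
    by rewrite mem_filter asboolT //= mem_iota /= (Dn i Di).
  by exists (index i l); rewrite ?index_mem //= /f nth_index.
- by move=> i k u v il kl; apply: sep; exact: fD.
Qed.

End ClusterFamily.

(** * The frontier of a circle domain *)

Section CircleDomains.
Context {R : realType}.
Local Notation plane := (R * R)%type.
Local Open Scope complex_scope.
Variable Omega : set (sphere R).
Hypothesis Ocircle : circle_domain Omega.
Hypothesis Oinfty : Omega infty.

Let h1 : (1 : R) != 0 := oner_neq0 R.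

Lemma emb1 (p : plane) : emb 1 p = Some (cplx p).
Proof. by rewrite /emb scale1r. Qed.

Lemma emb_scale (h : R) (q : plane) : emb h q = emb 1 (h *: q).
Proof. by rewrite emb1. Qed.

Lemma omega_open : open Omega. Proof. by case: Ocircle => -[]. Qed.
Lemma omega_connected : connected Omega. Proof. by case: Ocircle => -[]. Qed.

Lemma omega_boundaryE x : boundary Omega x <-> closure Omega x /\ ~ Omega x.
Proof.
split=> -[cx nx]; split=> //; last by move/interior_subset.
by move=> Ox; apply: nx; apply: open_nbhs_nbhs; split=> //; exact: omega_open.
Qed.

Definition frontier : set plane := [set p | boundary Omega (emb 1 p)].

Lemma boundary_frontier x : boundary Omega x -> exists2 p, frontier p & x = emb 1 p.
Proof.
move=> bx; have xi : x <> infty by move=> e; have [_] := (omega_boundaryE x).1 bx; rewrite e.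
by have [p e] := emb_surj h1 xi; exists p => //; rewrite /frontier /= -e.
Qed.

Lemma frontier_omega p : frontier p -> ~ Omega (emb 1 p).
Proof. by move=> /omega_boundaryE[]. Qed.

(** Off its boundary, Omega is open and closed. *)
Lemma connected_in_omega (G : set (sphere R)) : connected G -> G infty ->
  (forall x, G x -> ~ boundary Omega x) -> G `<=` Omega.
Proof.
move=> cG Gi Gb; suff <- : G `&` Omega = G by apply: subIsetr.
apply: cG; [by exists infty|by exists Omega => //; exact: omega_open|].
exists (closure Omega); first exact: closed_closure.
apply/seteqP; split=> x [Gx Ox]; split=> //; first exact: subset_closure.
by apply: contrapT => nOx; apply: (Gb x Gx); apply/omega_boundaryE.
Qed.

Lemma closed_frontier : closed frontier.
Proof.
have -> : frontier = emb 1 @^-1` (closure Omega `&` ~` Omega).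
  by apply/seteqP; split=> p /omega_boundaryE.
apply: closed_comp; first by move=> p _; exact: emb_continuous.
by apply: closedI; [exact: closed_closure | exact: open_closedC omega_open].
Qed.

Lemma omega_near_infty : exists2 K : set plane, compact K & forall p, ~ Omega (emb 1 p) -> K p.
Proof.
have [U [cU _] UO] : nbhs (infty : sphere R) Omega.
  by apply: open_nbhs_nbhs; split=> //; exact: omega_open.
exists (@coords R @` U).
  by apply: continuous_compact => //; apply: continuous_subspaceT; exact: coords_continuous.
move=> p nO; exists (cplx p); last by rewrite cplxK.
by apply: contrapT => nU; apply: nO; rewrite emb1; apply: UO; left; exists (cplx p).
Qed.

Lemma compact_frontier : compact frontier.
Proof.
have [K cK KO] := omega_near_infty; apply: subclosed_compact cK _; first exact: closed_frontier.
by move=> p /frontier_omega; exact: KO.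
Qed.

Definition unembed (x : sphere R) : plane := if x is Some z then coords z else 0.

Lemma unembed_connected (C : set (sphere R)) : connected C -> ~ C infty ->
  connected (unembed @` C).
Proof.
move=> cC Ci; apply: connected_continuous_connected => //.
apply: continuous_in_subspaceT => -[z|] /set_mem; last by move/Ci.
by move=> _ U nU; exact: (@coords_continuous _ z U nU).
Qed.

(** Lines are excluded because infinity is not a boundary point; a point is the
circle of radius 0. *)
Lemma component_circle (x : plane) : frontier x -> exists (z : plane) (r : R),
  0 <= r /\ connected_component frontier x = [set p | sqdist p z = r ^+ 2].
Proof.
move=> Sx; pose C := connected_component (boundary Omega) (emb 1 x).
have cC : is_component (boundary Omega) C by exists (emb 1 x).
have Cx : C (emb 1 x) by exact: connected_component_refl.
have Ci : ~ C infty.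
  by move=> /connected_component_sub /omega_boundaryE[_]; apply.
have sub p : connected_component frontier x p -> C (emb 1 p).
  move=> xp; apply: (@connected_component_max _ _ (emb 1 @` connected_component frontier x)).
  - by exists x => //; exact: connected_component_refl.
  - by move=> _ [q /connected_component_sub Sq <-].
  - apply: connected_continuous_connected; first exact: component_connected.
    by apply: continuous_subspaceT; exact: emb_continuous.
  - by exists p.
have [_ /(_ _ cC)] := Ocircle.
move=> [[p Cp]|[[z [r [r0 Cr]]]|[a [b [_ Cl]]]]].
- exists x, 0; split=> //; apply/seteqP; split=> q /=; rewrite expr0n /=.
    move=> /sub; rewrite Cp /= => e; move: Cx; rewrite Cp /= -e => /(emb_inj h1) ->.
    by rewrite /sqdist !subrr expr0n addr0.
  move=> e; have -> : q = x; last exact: connected_component_refl.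
  have h2 := sqr_ge0 (q.1 - x.1); have h3 := sqr_ge0 (q.2 - x.2).
  have /eqP : (q.1 - x.1) ^+ 2 = 0 by move: e; rewrite /sqdist; lra.
  have /eqP : (q.2 - x.2) ^+ 2 = 0 by move: e; rewrite /sqdist; lra.
  rewrite !sqrf_eq0 !subr_eq0; case: q x {e h2 h3 Sx C cC Cx Ci sub p Cp} => ? ? [? ?] /=.
  by move=> /eqP -> /eqP ->.
- have CE p : C (emb 1 p) <-> sqdist p (coords z) = r ^+ 2.
    rewrite -norm_cplx_eq ?ltW // coordsK Cr emb1; split; first by move=> [w cw [<-]].
    by move=> cp; exists (cplx p).
  exists (coords z), r; split; first exact: ltW.
  apply/seteqP; split=> p /=; first by move=> /sub /CE.
  move=> /CE Cp; apply: (@connected_component_max _ _ (unembed @` C)).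
  + by exists (emb 1 x) => //; rewrite emb1 /= cplxK.
  + move=> _ [y Cy <-]; have /connected_component_sub by_ := Cy.
    have [q Sq e] := boundary_frontier by_.
    by rewrite e emb1 /= cplxK.
  + by apply: unembed_connected => //; exact: component_connected.
  + by exists (emb 1 p) => //; rewrite emb1 /= cplxK.
- by exfalso; apply: Ci; rewrite Cl; right.
Qed.

Lemma sqdist_continuous (z : plane) : continuous (fun p => sqdist p z : R).
Proof.
have sqc (k : plane -> R) (c : R) : continuous k -> continuous (fun z => (k z - c) ^+ 2 : R).
  move=> kc w; have c1 : continuous_at w (fun z => k z - c : R).
    exact: (cvgB (kc w) (cvg_cst c)).
  exact: (continuous_comp c1 (@exprn_continuous _ 2 _)).
move=> p; apply: (cvgD (@sqc fst _ _ p) (@sqc snd _ _ p)) => q.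
  exact: cvg_fst.
exact: cvg_snd.
Qed.

Lemma compact_disk (z : plane) (r : R) : 0 <= r -> compact [set p | sqdist p z <= r ^+ 2].
Proof.
move=> r0; apply: subclosed_compact
  (@compact_box _ (z.1 - r) (z.1 + r) (z.2 - r) (z.2 + r)) _; last first.
  move=> p /=; rewrite /sqdist => h.
  have h2 := sqr_ge0 (p.1 - z.1); have h3 := sqr_ge0 (p.2 - z.2).
  by split; apply/andP; split; nra.
apply: (@closed_comp _ _ (fun p => sqdist p z : R) [set x | x <= r ^+ 2]); last exact: closed_le.
by move=> p _; exact: sqdist_continuous.
Qed.

Lemma open_disk (z : plane) (r : R) : open [set p | sqdist p z < r ^+ 2].
Proof.
apply: (@open_comp _ _ (fun p => sqdist p z : R) [set x | x < r ^+ 2]); last exact: open_lt.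
by move=> p _; exact: sqdist_continuous.
Qed.

(** The connected set Omega avoids the circle and contains infinity. *)
Lemma disk_omega (z : plane) (r : R) : 0 <= r ->
  (forall p, sqdist p z = r ^+ 2 -> frontier p) ->
  forall p, sqdist p z <= r ^+ 2 -> ~ Omega (emb 1 p).
Proof.
move=> r0 Sc p pz Op.
have noc q : Omega (emb 1 q) -> sqdist q z <= r ^+ 2 -> sqdist q z < r ^+ 2.
  move=> Oq; rewrite le_eqVlt => /orP[/eqP /Sc /frontier_omega //|//].
suff E : Omega `&` (emb 1 @` [set p | sqdist p z <= r ^+ 2]) = Omega.
  by move: Oinfty; rewrite -E => -[_ [q]].
apply: omega_connected.
- by exists (emb 1 p); split=> //; exists p.
- exists (emb 1 @` [set p | sqdist p z < r ^+ 2]).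
    by apply: emb_open => //; exact: open_disk.
  apply/seteqP; split=> x [Ox [q qz e]]; split=> //; exists q => //=.
    by apply: noc => //; rewrite e.
  exact: ltW.
- exists (emb 1 @` [set p | sqdist p z <= r ^+ 2]) => //.
  by rewrite -openC; apply: emb_compact_open; exact: compact_disk.
Qed.

End CircleDomains.

(** * Eroding classes of blocks *)

Section Blocks.
Context {J : Type} (lam : site -> J).

(** Groups of three by three sites; labels live on blocks. *)
Definition block (s : site) : site := ((s.1 %/ 3)%Z, (s.2 %/ 3)%Z).
Definition block_centre (a : site) : site := (3 * a.1 + 1, 3 * a.2 + 1).

(** Dropping the sites adjacent to another class makes different classes
non-adjacent, and blocks of side three survive the loss of a layer. *)
Definition eroded (j : J) : set site := [set s : site | forall t, nb s t -> lam (block t) = j].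

Lemma block_eq (s a : site) : 3 * a.1 <= s.1 <= 3 * a.1 + 2 -> 3 * a.2 <= s.2 <= 3 * a.2 + 2 ->
  block s = a.
Proof.
by move=> h1 h2; case: a h1 h2 => a b /= h1 h2; rewrite /block; congr pair; lia.
Qed.

Lemma blockP s : exists x y : int, [/\ 0 <= x <= 2, 0 <= y <= 2,
  s.1 = 3 * (block s).1 + x & s.2 = 3 * (block s).2 + y].
Proof.
exists (s.1 - 3 * (block s).1), (s.2 - 3 * (block s).2).
by rewrite /block /=; split; lia.
Qed.

Lemma eroded_block j s : eroded j s -> lam (block s) = j.
Proof. by apply; exact: nb_refl. Qed.

Lemma eroded_sep j k s t : eroded j s -> eroded k t -> nb s t -> eroded j = eroded k.
Proof. by move=> js /eroded_block <- /js ->. Qed.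

Lemma eroded_centre j a : lam a = j -> eroded j (block_centre a).
Proof.
move=> aj t [/= h1 h2 h3]; rewrite (@block_eq t a) //; lia.
Qed.

Lemma eroded_pair j a b s : lam a = j -> lam b = j ->
  (forall t, nb s t -> block t = a \/ block t = b) -> eroded j s.
Proof. by move=> aj bj H t /H[] ->. Qed.

(** The sites between the centres of two adjacent blocks have all their neighbours
in these two blocks. *)
Lemma eroded_step j a b : lam a = j -> lam b = j -> adj4 a b ->
  linked nb (eroded j) (block_centre a) (block_centre b).
Proof.
have horiz (i k : int) : lam (i, k) = j -> lam (i + 1, k) = j ->
    linked nb (eroded j) (block_centre (i, k)) (block_centre (i + 1, k)).
  move=> h1 h2; apply: linked_rel adj4_nb _; apply: linked_row => /=; first lia.
  move=> m hm; apply: (eroded_pair h1 h2) => t [/= h3 h4 h5].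
  have [h|h] : t.1 <= 3 * i + 2 \/ 3 * i + 3 <= t.1 by lia.
    by left; apply: block_eq => /=; lia.
  by right; apply: block_eq => /=; lia.
have vert (i k : int) : lam (i, k) = j -> lam (i, k + 1) = j ->
    linked nb (eroded j) (block_centre (i, k)) (block_centre (i, k + 1)).
  move=> h1 h2; apply: linked_rel adj4_nb _; apply: linked_col => /=; first lia.
  move=> m hm; apply: (eroded_pair h1 h2) => t [/= h3 h4 h5].
  have [h|h] : t.2 <= 3 * k + 2 \/ 3 * k + 3 <= t.2 by lia.
    by left; apply: block_eq => /=; lia.
  by right; apply: block_eq => /=; lia.
case: a b => [i k] [i' k'] h1 h2 [/= h3 h4].
have : (i' = i /\ k' = k) \/ (i' = i + 1 /\ k' = k) \/ (i = i' + 1 /\ k' = k) \/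
       (i' = i /\ k' = k + 1) \/ (i' = i /\ k = k' + 1) by lia.
move=> [[e1 e2]|[[e1 e2]|[[e1 e2]|[[e1 e2]|[e1 e2]]]]]; subst.
- by apply: linked_refl; exact: eroded_centre.
- exact: horiz.
- by apply: linked_sym; [exact: nb_sym | exact: horiz].
- exact: vert.
- by apply: linked_sym; [exact: nb_sym | exact: vert].
Qed.

(** All sites of a block are adjacent to its centre except two opposite corners.
If such a corner survives, then so does one of its neighbours, which is adjacent
to the centre, because its neighbours lie in blocks met by those of the corner. *)
Lemma eroded_to_centre j s : eroded j s ->
  linked nb (eroded j) s (block_centre (block s)).
Proof.
move=> js; have sj := eroded_block js; have ec := eroded_centre sj.
have [x [y [hx hy e1 e2]]] := blockP s; set a := block s in e1 e2 sj ec *.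
have [near|far] := pselect (nb s (block_centre a)); first exact: linked_step.
have mid (c : site) (s' : site) : lam c = j ->
    (forall t, nb s' t -> block t = a \/ block t = c) ->
    nb s s' -> nb s' (block_centre a) -> linked nb (eroded j) s (block_centre a).
  move=> cj H n1 n2; have es' := eroded_pair sj cj H.
  by apply: (@linked_trans _ _ _ s'); apply: linked_step.
have [[ex ey]|[ex ey]] : (x = 0 /\ y = 0) \/ (x = 2 /\ y = 2).
  apply: contrapT => H; apply: far; split; rewrite /= ?e1 ?e2; lia.
- apply: (mid (a.1, a.2 - 1) (s.1 + 1, s.2)).
  + rewrite -(@block_eq (s.1 + 1, s.2 - 1) (a.1, a.2 - 1)) /=; [|lia|lia].
    by apply: js; split => /=; lia.
  + move=> t [/= h1 h2 h3].
    have [h|h] : 3 * a.2 <= t.2 \/ t.2 <= 3 * a.2 - 1 by lia.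
      by left; apply: block_eq => /=; lia.
    by right; apply: block_eq => /=; lia.
  + by split => /=; lia.
  + by split => /=; lia.
- apply: (mid (a.1, a.2 + 1) (s.1 - 1, s.2)).
  + rewrite -(@block_eq (s.1 - 1, s.2 + 1) (a.1, a.2 + 1)) /=; [|lia|lia].
    by apply: js; split => /=; lia.
  + move=> t [/= h1 h2 h3].
    have [h|h] : t.2 <= 3 * a.2 + 2 \/ 3 * a.2 + 3 <= t.2 by lia.
      by left; apply: block_eq => /=; lia.
    by right; apply: block_eq => /=; lia.
  + by split => /=; lia.
  + by split => /=; lia.
Qed.

Lemma eroded_connected j :
  (forall a b, lam a = lam b -> linked adj4 [set c | lam c = lam a] a b) ->
  sconnected (eroded j).
Proof.
move=> lc s t js jt; apply: (linked_trans (eroded_to_centre js)).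
apply: (@linked_trans _ _ _ (block_centre (block t))); last first.
  by apply: linked_sym; [exact: nb_sym | exact: eroded_to_centre].
have sj := eroded_block js; have tj := eroded_block jt.
have := lc (block s) (block t); rewrite sj tj => /(_ erefl).
move: (block t); apply: linked_ind; first by apply: linked_refl; exact: eroded_centre.
move=> u v su cu /= vj uv; apply: (linked_trans cu); apply: eroded_step => //.
exact: linked_r su.
Qed.

End Blocks.

(** * Lattice neighbourhoods of clusters *)

Section Atoms.
Context {R : realType}.
Local Notation plane := (R * R)%type.

(** Closeness in the sup norm, with both coordinates at hand. *)
Definition cheb (p q : plane) (r : R) : Prop := `|p.1 - q.1| <= r /\ `|p.2 - q.2| <= r.

Lemma cheb_trans (p q t : plane) (a b : R) : cheb p q a -> cheb q t b -> cheb p t (a + b).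
Proof.
move=> [h1 h2] [h3 h4]; split.
  by have := ler_distD q.1 p.1 t.1; lra.
by have := ler_distD q.2 p.2 t.2; lra.
Qed.

Lemma cheb_sym (p q : plane) (a : R) : cheb p q a -> cheb q p a.
Proof. by move=> [h1 h2]; split; rewrite distrC. Qed.

Lemma cheb_le (p q : plane) (a b : R) : a <= b -> cheb p q a -> cheb p q b.
Proof. by move=> ab [h1 h2]; split; lra. Qed.

Lemma norm_cheb (u v : plane) (r : R) : `|u - v| <= r <-> cheb u v r.
Proof. by rewrite prod_normE /= ge_max; split=> [/andP[]|[-> ->]]. Qed.

Lemma norm_planeE (u v : plane) (r : R) : `|u - v| < r <->
  `|u.1 - v.1| < r /\ `|u.2 - v.2| < r.
Proof. by rewrite prod_normE /= gt_max; split=> [/andP[]|[-> ->]]. Qed.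

Variables (Fr : set plane) (sigma : R) (n : nat) (x : nat -> plane) (eta : nat -> R)
  (mu : R) (h : R).
Hypothesis cl : clusters Fr sigma n x eta mu.
Hypothesis h_gt0 : 0 < h.
Hypothesis h_mu : 10 * h <= mu.

Let U i := chain Fr (eta i) (x i).
(** A radius that is more than half the length of the steps inside the cluster i
and less than half its distance to the other clusters. *)
Let rho i := (eta i - mu) / 2.

Definition pos (a : site) : plane := h *: centre (block_centre a).

Lemma posE a : (pos a).1 = h * (3 * a.1%:~R + 1) /\ (pos a).2 = h * (3 * a.2%:~R + 1).
Proof. by rewrite /pos /centre /block_centre /= !(intrD, intrM). Qed.

Lemma pos_nearest (u : plane) : exists a, cheb (pos a) u (3 * h).
Proof.
have one (y : R) : exists i : int, `|h * (3 * i%:~R + 1) - y| <= 3 * h.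
  have /andP[] := floor_itv ((y / h - 1) / 3); set i := Num.floor _; rewrite intrD => h1 h2.
  exists i; rewrite ler_norml.
  have e : y = h * (y / h) by rewrite mulrC divfK // gt_eqF.
  set w := y / h in e h1 h2; rewrite e.
  have d0 : 0 <= h * (w - (3 * i%:~R + 1)) by apply: mulr_ge0; [exact: ltW|lra].
  have d3 : 0 <= h * (3 * i%:~R + 4 - w) by apply: mulr_ge0; [exact: ltW|lra].
  by clear e; apply/andP; split; lra.
have [i hi] := one u.1; have [j hj] := one u.2; exists (i, j).
by have [e1 e2] := posE (i, j); rewrite /cheb e1 e2.
Qed.

Lemma cheb_ball_linked (v : plane) (r : R) a b : cheb (pos a) v r -> cheb (pos b) v r ->
  linked adj4 [set c | cheb (pos c) v r] a b.
Proof.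
have conv (i k m : int) (y : R) : `|h * (3 * i%:~R + 1) - y| <= r ->
   `|h * (3 * k%:~R + 1) - y| <= r -> i <= m <= k \/ k <= m <= i ->
   `|h * (3 * m%:~R + 1) - y| <= r.
  rewrite !ler_norml => /andP[a1 a2] /andP[b1 b2] [] /andP[c1 c2].
    have {}c1 : h * i%:~R <= h * m%:~R by rewrite ler_pM2l // ler_int.
    have {}c2 : h * m%:~R <= h * k%:~R by rewrite ler_pM2l // ler_int.
    by apply/andP; split; lra.
  have {}c1 : h * k%:~R <= h * m%:~R by rewrite ler_pM2l // ler_int.
  have {}c2 : h * m%:~R <= h * i%:~R by rewrite ler_pM2l // ler_int.
  by apply/andP; split; lra.
case: a b => [i j] [k l]; rewrite /cheb.
have [-> ->] := posE (i, j); have [-> ->] := posE (k, l) => /= -[a1 a2] [b1 b2].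
apply: (@linked_trans _ _ _ (k, j)).
  apply: linked_row' => m hm; change (cheb (pos (m, j)) v r); rewrite /cheb.
  have [-> ->] := posE (m, j) => /=.
  by split=> //; apply: conv a1 b1 hm.
apply: linked_col' => m hm; change (cheb (pos (k, m)) v r); rewrite /cheb.
have [-> ->] := posE (k, m) => /=.
by split=> //; apply: conv a2 b2 hm.
Qed.

(** The index i serves to recover the scale of the cluster W, which determines the
radius of its neighbourhood. *)
Definition atom (W : set plane) : set site := [set a | exists i u,
  [/\ (i < n)%N, U i = W, U i u & cheb (pos a) u (rho i)]].

Lemma rho_bounds i : (i < n)%N -> 5 * h <= rho i <= sigma / 2.
Proof.
move=> ilt; have [/andP[e1 e2] m0] := (cl_eta cl ilt, cl_mu cl).
have hm := h_mu; have hg := h_gt0.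
by rewrite /rho; apply/andP; split; lra.
Qed.

Lemma atom_ball i u : (i < n)%N -> U i u ->
  [set a | cheb (pos a) u (rho i)] `<=` atom (U i).
Proof. by move=> ilt iu a au; exists i, u. Qed.

Lemma atom_cover i u a : (i < n)%N -> U i u -> cheb (pos a) u (5 * h) -> atom (U i) a.
Proof.
move=> ilt iu au; apply: (atom_ball ilt iu); apply: cheb_le au.
by have /andP[] := rho_bounds ilt.
Qed.

(** For a step from u to v, some block centre close to the midpoint is within
[rho] of both. *)
Lemma atom_centre_linked i a : (i < n)%N -> cheb (pos a) (x i) (3 * h) ->
  forall u, U i u -> forall c, cheb (pos c) u (3 * h) -> linked adj4 (atom (U i)) a c.
Proof.
move=> ilt ax u iu; have /andP[r1 r2] := rho_bounds ilt.
have h3 w b : cheb (pos b) w (3 * h) -> cheb (pos b) w (rho i).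
  by have hm := h_mu; have hg := h_gt0; apply: cheb_le; lra.
have Ux : U i (x i) by apply: linked_refl; exact: (cl_mem cl).
have inball v b d : U i v -> cheb (pos b) v (rho i) -> cheb (pos d) v (rho i) ->
    linked adj4 (atom (U i)) b d.
  by move=> iv bv dv; apply: linked_subset (atom_ball ilt iv) _; exact: cheb_ball_linked.
have mono : chain Fr (eta i - 2 * mu) (x i) `<=` U i.
  by apply: chain_mono; have := cl_mu cl; lra.
have := cl_slack cl ilt iu; move: u {iu}; apply: linked_ind.
  by move=> c cx; apply: (inball (x i)) => //; exact: h3.
move=> u v xu IH Sv uv c cv.
have iu : U i u by exact: mono.
have iv : U i v by apply: mono; apply: chain_close xu Sv uv.
have [b bu] := pos_nearest u.
pose m : plane := ((u.1 + v.1) / 2, (u.2 + v.2) / 2).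
have [w wm] := pos_nearest m.
have [uv1 uv2] := (norm_planeE _ _ _).1 uv.
have mu2 : cheb m u (eta i / 2 - mu).
  by move: uv1 uv2; rewrite /cheb /m /= !ltr_norml !ler_norml => /andP[? ?] /andP[? ?];
    split; apply/andP; split; lra.
have mv2 : cheb m v (eta i / 2 - mu).
  by move: uv1 uv2; rewrite /cheb /m /= !ltr_norml !ler_norml => /andP[? ?] /andP[? ?];
    split; apply/andP; split; lra.
have wu : cheb (pos w) u (rho i).
  by have hm := h_mu; have hg := h_gt0; apply: cheb_le (cheb_trans wm mu2); rewrite /rho; lra.
have wv : cheb (pos w) v (rho i).
  by have hm := h_mu; have hg := h_gt0; apply: cheb_le (cheb_trans wm mv2); rewrite /rho; lra.
apply: (linked_trans (IH b bu)).
apply: (@linked_trans _ _ _ w); first exact: (inball u) iu (h3 _ _ bu) wu.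
exact: (inball v) iv wv (h3 _ _ cv).
Qed.

Lemma atom_linked W a b : atom W a -> atom W b -> linked adj4 (atom W) a b.
Proof.
move=> [i [u [ilt e iu au]]] [k [v [klt ek kv bv]]]; subst W.
have [c cx] := pos_nearest (x i).
have /andP[r1 _] := rho_bounds ilt; have /andP[r2 _] := rho_bounds klt.
have [a' au'] := pos_nearest u; have [b' bv'] := pos_nearest v.
have la : linked adj4 (atom (U i)) a a'.
  apply: linked_subset (atom_ball ilt iu) _; apply: cheb_ball_linked => //.
  by have hm := h_mu; have hg := h_gt0; apply: cheb_le au'; lra.
have lb : linked adj4 (atom (U i)) b b'.
  rewrite -ek; apply: linked_subset (atom_ball klt kv) _; apply: cheb_ball_linked => //.
  by have hm := h_mu; have hg := h_gt0; apply: cheb_le bv'; lra.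
have iv : U i v by rewrite -ek.
apply: (linked_trans la); apply: linked_trans (linked_sym adj4_sym lb).
apply: (@linked_trans _ _ _ c).
  by apply: linked_sym; [exact: adj4_sym|apply: atom_centre_linked au'].
exact: atom_centre_linked bv'.
Qed.

Lemma atom_disjoint W W' a : atom W a -> atom W' a -> W = W'.
Proof.
move=> [i [u [ilt <- iu au]]] [k [v [klt <- kv av]]].
apply: (cl_sep cl ilt klt iu kv); apply: (@le_lt_trans _ _ (rho i + rho k)).
  by apply/norm_cheb; apply: cheb_trans av; exact: cheb_sym.
have := cl_mu cl; rewrite lt_max /rho; have [h1|h1] := leP (eta i) (eta k) => m0.
  by apply/orP; right; lra.
by apply/orP; left; lra.
Qed.

Lemma atom_near W a : atom W a ->
  exists i u, [/\ (i < n)%N, U i = W, U i u & cheb (pos a) u (sigma / 2)].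
Proof.
move=> [i [u [ilt e iu au]]]; exists i, u; split=> //; apply: cheb_le au.
by have /andP[] := rho_bounds ilt.
Qed.

End Atoms.

(** * Discs and filled sets *)

Section Discs.
Context {R : realType}.
Local Notation plane := (R * R)%type.
Local Open Scope complex_scope.
Implicit Types (p q z : plane) (a b r M : R).

Lemma sqr_le a b : 0 <= a -> a <= b -> a ^+ 2 <= b ^+ 2.
Proof. by move=> a0 ab; nra. Qed.

Lemma sqdist_triangle q p (t : plane) a b : 0 <= a -> 0 <= b ->
  sqdist p q <= a ^+ 2 -> sqdist q t <= b ^+ 2 -> sqdist p t <= (a + b) ^+ 2.
Proof.
move=> a0 b0; rewrite -!norm_cplx_le ?addr_ge0 // => pq qt.
by rewrite rmorphD /=; apply: le_trans (ler_distD (cplx q) _ _) (lerD pq qt).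
Qed.

(** 1.415 is slightly more than the square root of 2. *)
Lemma cheb_sqdist p q M : cheb p q M -> sqdist p q <= (1415 / 1000 * M) ^+ 2.
Proof.
move=> [h1 h2]; have M0 : 0 <= M := le_trans (normr_ge0 _) h1.
have sq (x : R) : `|x| <= M -> x ^+ 2 <= M ^+ 2.
  by rewrite ler_norml => /andP[? ?]; nra.
have := sq _ h1; have := sq _ h2; have := sqr_ge0 M.
by rewrite /sqdist exprMn; lra.
Qed.

Lemma sqdist_cheb p q a : 0 <= a -> sqdist p q <= a ^+ 2 -> cheb p q a.
Proof.
rewrite /sqdist => a0 h; have h2 := sqr_ge0 (p.1 - q.1); have h3 := sqr_ge0 (p.2 - q.2).
by split; rewrite ler_norml; apply/andP; split; nra.
Qed.

(** Move p towards the centre by the factor r / (r + W). *)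
Lemma disk_shrink z p r W : 0 <= r -> 0 < W -> sqdist p z <= (r + W) ^+ 2 ->
  exists2 k, sqdist k z <= r ^+ 2 & cheb p k W.
Proof.
move=> r0 W0 pz; pose t := r / (r + W).
have rW : 0 < r + W by lra.
have tE : t * (r + W) = r by rewrite /t divfK // gt_eqF.
have t0 : 0 <= t by rewrite /t divr_ge0 // ltW.
have t1 : t <= 1 by rewrite /t ler_pdivrMr // mul1r; lra.
clearbody t.
have /point_onE[e1 e2] : point_on z p t = point_on z p t by [].
exists (point_on z p t).
  have -> : sqdist (point_on z p t) z = t ^+ 2 * sqdist p z.
    by rewrite /sqdist e1 e2; ring.
  rewrite -[X in _ <= X ^+ 2]tE exprMn; apply: ler_wpM2l => //; exact: sqr_ge0.
have [c1 c2] := sqdist_cheb (ltW rW) pz.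
have tW : (1 - t) * (r + W) = W by rewrite mulrBl mul1r tE; ring.
have sc (x y : R) : `|x - y| <= r + W -> `|x - (y + t * (x - y))| <= W.
  move=> h; have -> : x - (y + t * (x - y)) = (1 - t) * (x - y) by ring.
  by rewrite normrM ger0_norm ?subr_ge0 // -tW; apply: ler_wpM2l => //; lra.
by split; rewrite ?e1 ?e2; apply: sc.
Qed.

Lemma hex_convex s p q r : hex s p -> hex s q -> 0 <= r <= 1 -> hex s (point_on p q r).
Proof.
move=> [/andP[a1 a2] /andP[b1 b2] /andP[c1 c2]] [/andP[d1 d2] /andP[e1 e2] /andP[f1 f2]] /andP[r0 r1].
have /point_onE[g1 g2] : point_on p q r = point_on p q r by [].
have sc (L L' : R) : -1 <= L -> L <= 1 -> -1 <= L' -> L' <= 1 -> -1 <= L + r * (L' - L) <= 1.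
  by move=> *; apply/andP; split; nra.
move: (point_on p q r) g1 g2 => u g1 g2.
rewrite /hex /= g1 g2; split.
- by have := sc _ _ a1 a2 d1 d2; lra.
- by have := sc _ _ b1 b2 e1 e2; lra.
- by have := sc _ _ c1 c2 f1 f2; lra.
Qed.

Lemma hex_cheb s q (h : R) : 0 < h -> hex s q -> cheb (h *: q) (h *: centre s) h.
Proof.
move=> h0 /hex_bound[b1 b2]; rewrite /cheb /centre /= -!mulrBr !normrM gtr0_norm //.
by split; nra.
Qed.

Lemma nb_cheb s t (h : R) : 0 < h -> nb s t -> cheb (h *: centre s) (h *: centre t) h.
Proof.
move=> h0 [n1 n2 _]; rewrite /cheb /centre /= -!mulrBr !normrM gtr0_norm //.
have conv (i j : int) : -1 <= j - i <= 1 -> `|i%:~R - j%:~R| <= 1 :> R.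
  move=> /andP[h1 h2]; rewrite ler_norml; apply/andP; split.
    have : i%:~R + -1 <= j%:~R :> R by rewrite -[-1]/((-1)%:~R) -intrD ler_int; lia.
    have : j%:~R <= i%:~R + 1 :> R by rewrite -[1]/(1%:~R) -intrD ler_int; lia.
    lra.
  have : i%:~R <= j%:~R + 1 :> R by rewrite -[1]/(1%:~R) -intrD ler_int; lia.
  lra.
by have := conv _ _ n1; have := conv _ _ n2; split; nra.
Qed.

Lemma block_cheb s (h : R) : 0 < h -> cheb (h *: centre s) (pos h (block s)) h.
Proof.
move=> h0; rewrite /pos /cheb /centre /= -!mulrBr !normrM gtr0_norm //.
have conv (i : int) : `|i%:~R - (3 * (i %/ 3)%Z + 1)%:~R| <= 1 :> R.
  have h1 : i <= (3 * (i %/ 3)%Z + 1) + 1 by lia.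
  have h2 : 3 * (i %/ 3)%Z + 1 <= i + 1 by lia.
  move: h1 h2; rewrite -!(ler_int R) [X in X <= _ -> _]/= [in X in _ -> X]intrD [in X in X -> _]intrD => h1 h2.
  rewrite ler_norml; apply/andP; split; lra.
have := conv s.1; have := conv s.2; split; nra.
Qed.

(** Outside a disc one goes to infinity along the horizontal ray that points away
from the centre, and then around a large box. *)
Lemma fill_disk (h A : R) z (P : set site) (N : nat) : 0 < h -> 0 <= A ->
  (forall s, P s -> sqdist (h *: centre s) z <= A ^+ 2) ->
  (forall s, P s -> ~ outside N%:Z s) ->
  forall s, fill (N%:Z + 1, N%:Z + 1) P s -> sqdist (h *: centre s) z <= A ^+ 2.
Proof.
move=> h0 A0 PA PN s Fs; rewrite leNgt; apply/negP => far; apply: Fs.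
have row (m : int) : (h * s.1%:~R - z.1) ^+ 2 <= (h * m%:~R - z.1) ^+ 2 -> ~ P (m, s.2).
  move=> le /PA; rewrite leNgt => /negP; apply; apply: lt_le_trans far _.
  by rewrite /sqdist /centre /= lerD2r.
have out (m : int) : outside N%:Z (m, s.2) -> linked nb (~` P) (m, s.2) (N%:Z + 1, N%:Z + 1).
  move=> om; apply: linked_subset (linked_outside _ om _); [|done|by apply: Or32 => /=; lia].
  by move=> t ot /PN.
have goto (m : int) : outside N%:Z (m, s.2) ->
    (forall k, s.1 <= k <= m \/ m <= k <= s.1 -> ~ P (k, s.2)) ->
    linked nb (~` P) s (N%:Z + 1, N%:Z + 1).
  move=> om path; apply: linked_trans (out m om); apply: linked_rel adj4_nb _.
  by rewrite {1}(surjective_pairing s); apply: linked_row'.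
have mono (i j : int) : i <= j -> h * i%:~R <= h * j%:~R.
  by move=> ij; rewrite ler_pM2l // ler_int.
have [zs|sz] := leP z.1 (h * s.1%:~R).
- apply: (goto (Num.max s.1 (N%:Z + 1))); first by apply: Or32 => /=; lia.
  move=> k [/andP[k1 _]|/andP[k1 k2]]; apply: row; last first.
    have -> : k = s.1 by lia.
    exact: lexx.
  by have := mono _ _ k1; nra.
- apply: (goto (Num.min s.1 (- N%:Z - 1))); first by apply: Or31 => /=; lia.
  move=> k [/andP[k1 k2]|/andP[_ k1]]; apply: row.
    have -> : k = s.1 by lia.
    exact: lexx.
  by have := mono _ _ k1; nra.
Qed.

(** No connected union of hexagons that avoids the circle contains points on both
of its sides, by the intermediate value theorem; so no path of hexagons escapes
from the disc. *)
Lemma circle_fill (h r : R) z (P : set site) (N : nat) : 0 < h -> 0 < r ->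
  (forall q s, sqdist (h *: q) z = r ^+ 2 -> hex s q -> P s) ->
  (forall s, P s -> ~ outside N%:Z s) ->
  forall q s, sqdist (h *: q) z <= r ^+ 2 -> hex s q -> fill (N%:Z + 1, N%:Z + 1) P s.
Proof.
move=> h0 r0 cP PN q s qz sq so.
have avoid t p : ~ P t -> hex t p -> sqdist (h *: p) z <> r ^+ 2.
  by move=> nP tp e; apply: nP; exact: cP tp.
have spread t p p' : ~ P t -> hex t p -> hex t p' -> sqdist (h *: p) z < r ^+ 2 ->
    sqdist (h *: p') z < r ^+ 2.
  move=> nP tp tp' lt; rewrite ltNge; apply/negP => ge.
  pose f (c : R) := sqdist (h *: point_on p p' c) z.
  have fE c : f c = (h * (p.1 + c * (p'.1 - p.1)) - z.1) ^+ 2 +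
      (h * (p.2 + c * (p'.2 - p.2)) - z.2) ^+ 2.
    have /point_onE[e1 e2] : point_on p p' c = point_on p p' c by [].
    by rewrite /f; move: (point_on p p' c) e1 e2 => w e1 e2; rewrite /sqdist /= e1 e2.
  have lin (a b k : R) : continuous (fun c : R => (h * (a + c * b) - k) ^+ 2 : R).
    move=> c; have c1 : continuous_at c (fun c : R => h * (a + c * b) - k : R).
      exact: (cvgB (cvgMl_tmp (cvgD (cvg_cst a) (cvgMr_tmp cvg_id))) (cvg_cst k)).
    exact: (continuous_comp c1 (@exprn_continuous _ 2 _)).
  have cf : continuous f.
    have -> : f = (fun c => (h * (p.1 + c * (p'.1 - p.1)) - z.1) ^+ 2 +
      (h * (p.2 + c * (p'.2 - p.2)) - z.2) ^+ 2) by apply/funext.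
    by move=> c; exact: (cvgD (@lin _ _ _ c) (@lin _ _ _ c)).
  have f0 : f 0 = sqdist (h *: p) z by rewrite /f point_on0.
  have f1 : f 1 = sqdist (h *: p') z by rewrite /f point_on1.
  have [||c] := @IVT R f 0 1 (r ^+ 2) ler01.
  + exact: continuous_subspaceT.
  + by rewrite ge_min le_max f0 f1 (ltW lt) ge orbT.
  rewrite in_itv /= => c01 fc; apply: (avoid t (point_on p p' c)) => //.
  exact: hex_convex.
have inside : forall t, linked nb (~` P) s t -> forall p, hex t p -> sqdist (h *: p) z < r ^+ 2.
  apply: linked_ind.
    move=> p sp; have nPs := linked_l so; apply: (spread s q) => //.
    by rewrite lt_neqAle qz andbT; apply/eqP; exact: avoid sq.
  move=> u v su IH nPv uv p vp; have [e|nuv] := pselect (u = v).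
    by apply: IH; rewrite e.
  have [hu hv] := hex_middle (R := R) uv nuv.
  exact: (spread v (middle u v)) (IH _ hu).
have := inside _ so _ (hex_centre _).
have [t tP] := hex_cover (h^-1 *: ((z.1 + r, z.2) : plane)).
have cz : sqdist (h *: (h^-1 *: ((z.1 + r, z.2) : plane))) z = r ^+ 2.
  by rewrite scalerA mulfV ?gt_eqF // scale1r /sqdist /= subrr expr0n addr0 addrAC subrr add0r.
have Pt := cP _ _ cz tP; have [b1 _] := hex_bound tP.
have t1 : t.1 <= N%:Z.
  by rewrite leNgt; apply/negP => ?; apply: (PN _ Pt); apply: Or32.
have t1' : t.1%:~R <= N%:Z%:~R :> R by rewrite ler_int.
move: b1; rewrite ler_norml => /andP[_ b1].
have {}b1 : h^-1 * (z.1 + r) - t.1%:~R <= 2 / 3 := b1.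
have e : h * (h^-1 * (z.1 + r)) = z.1 + r by rewrite mulrA mulfV ?mul1r // gt_eqF.
set y := h^-1 * (z.1 + r) in b1 e.
have hy : h * y <= h * (N%:Z%:~R + 2 / 3) by rewrite ler_pM2l //; lra.
rewrite /sqdist /centre /= intrD.
set M : R := N%:Z%:~R in hy *.
have far : r < h * (M + 1%:~R) - z.1 by move: hy; rewrite e; nra.
have := sqr_ge0 (h * (M + 1%:~R) - z.2).
have : r ^+ 2 < (h * (M + 1%:~R) - z.1) ^+ 2.
  by clear -r0 far; rewrite ltr_pXn2r ?nnegrE //; lra.
move=> h2 h3 h4.
have {}h4 : (h * (M + 1%:~R) - z.1) ^+ 2 + (h * (M + 1%:~R) - z.2) ^+ 2 < r ^+ 2 := h4.
by lra.
Qed.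

End Discs.

(** * Roundness of the filled classes *)

Section Level.
Context {R : realType}.
Local Notation plane := (R * R)%type.
Variables (Omega : set (sphere R)).
Hypotheses (Ocircle : circle_domain Omega) (Oinfty : Omega infty).
Variables (n : nat) (x : nat -> plane) (eta : nat -> R) (mu h : R) (m : nat).
(** The scale eps is 300 w, the clusters are 3 w thin, and the mesh h is much
smaller than w. In units of blocks, whose side is 3 h, the small atoms have
diameter d = 203 m and the cells have side l = 610 m: a cluster in a circle of
radius less than 300 w has diameter less than 600 w + 9 w = 203 * 3 w. *)
Let w : R := m%:R * h.
Let Fr := frontier Omega.
Hypothesis cl : clusters Fr (3 * w) n x eta mu.
Hypothesis h_gt0 : 0 < h.
Hypothesis h_mu : 10 * h <= mu.
Hypothesis m_ge10 : (10 <= m)%N.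

Let U i := chain Fr (eta i) (x i).
Let at_ := atom Fr n x eta mu h.
Let d : int := 203 * m%:Z.
Let l : int := 610 * m%:Z.

Variables (lam : site -> set plane + site) (a0 : nat -> site).
Hypothesis lam_atom : forall W s t, at_ W s -> at_ W t -> lam s = lam t.
Hypothesis lam_base : forall j s, base at_ l d j s -> lam s = j.
Hypothesis lam_near : forall s, base at_ l d (lam s) s \/ exists c c' b,
  [/\ hull at_ d (cell l c) s, hull at_ d (cell l c') b, base at_ l d (lam s) b & within 3 c c'].
Hypothesis a0_near : forall i, cheb (pos h (a0 i)) (x i) (3 * h).

Let P i := eroded lam (lam (a0 i)).

Lemma w_ge : 10 * h <= w.
Proof. by rewrite /w ler_pM2r // -[10]/(10%:R) ler_nat. Qed.

Lemma a0_atom i : (i < n)%N -> at_ (U i) (a0 i).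
Proof.
move=> ilt; apply: (atom_cover cl h_gt0 h_mu ilt).
  by apply: linked_refl; exact: (cl_mem cl).
by have hg := h_gt0; apply: cheb_le (a0_near i); lra.
Qed.

Lemma cover_eroded i u s : (i < n)%N -> U i u -> cheb (h *: centre s) u (2 * h) -> P i s.
Proof.
move=> ilt iu su t st; apply: (lam_atom (W := U i)); last exact: a0_atom.
have hg := h_gt0; apply: (atom_cover cl h_gt0 h_mu ilt iu).
have c1 := cheb_sym (block_cheb t h_gt0).
have c2 := cheb_sym (nb_cheb h_gt0 st).
by apply: cheb_le (cheb_trans (cheb_trans c1 c2) su); lra.
Qed.

Lemma within_cheb (k : int) s t : within k s t -> cheb (pos h s) (pos h t) (3 * h * k%:~R).
Proof.
move=> [k1 k2]; rewrite /cheb; have [-> ->] := posE h s; have [-> ->] := posE h t.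
have hg := h_gt0.
have conv (i j : int) : - k <= i - j <= k ->
    `|h * (3 * i%:~R + 1) - h * (3 * j%:~R + 1)| <= 3 * h * k%:~R.
  move=> /andP[a1 a2]; have e1 : i%:~R <= j%:~R + k%:~R :> R by rewrite -intrD ler_int; lia.
  have e2 : j%:~R <= i%:~R + k%:~R :> R by rewrite -intrD ler_int; lia.
  by rewrite ler_norml; apply/andP; split; nra.
by split; exact: conv.
Qed.

Lemma circle_of i : (i < n)%N -> exists (z : plane) (r : R), [/\ 0 <= r,
  (forall p, sqdist p z = r ^+ 2 -> U i p),
  (forall p, sqdist p z = r ^+ 2 -> Fr p) &
  forall u, U i u -> exists2 c, sqdist c z = r ^+ 2 & cheb u c (3 * w)].
Proof.
move=> ilt; have [z [r [r0 E]]] := component_circle Ocircle Oinfty (cl_mem cl ilt).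
exists z, r; split=> //.
- by move=> p pz; apply: (cl_component cl ilt); rewrite /Fr E.
- by move=> p pz; apply: (@connected_component_sub _ _ (x i)); rewrite E.
move=> u /(cl_near cl ilt)[c]; rewrite /Fr E => cz /norm_planeE[h1 h2].
by exists c => //; split; rewrite distrC; apply/ltW.
Qed.

Lemma small_atom i z (r : R) : (i < n)%N -> 0 <= r -> r < 300 * w ->
  (forall u, U i u -> exists2 c, sqdist c z = r ^+ 2 & cheb u c (3 * w)) ->
  small at_ d (U i).
Proof.
move=> ilt r0 rw near; have hg := h_gt0; have hw := w_ge.
have close a : at_ (U i) a -> cheb (pos h a) z (9 / 2 * w + r).
  move=> /(atom_near cl h_gt0 h_mu)[k [u [klt e ku au]]].
  have iu : U i u by rewrite -e.
  have [c cz uc] := near u iu.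
  have zc : cheb c z r by apply: sqdist_cheb => //; rewrite cz.
  by apply: cheb_le (cheb_trans (cheb_trans au uc) zc); lra.
move=> a b /close az /close bz.
have := cheb_trans az (cheb_sym bz); rewrite /cheb.
have [-> ->] := posE h a; have [-> ->] := posE h b => -[h1 h2].
have conv (i' j : int) : `|h * (3 * i'%:~R + 1) - h * (3 * j%:~R + 1)| <=
    9 / 2 * w + r + (9 / 2 * w + r) -> - d <= i' - j <= d.
  rewrite ler_norml => /andP[a1 a2]; have dE : d%:~R = 203 * m%:R :> R by rewrite /d intrM.
  have e1 : h * (i'%:~R - j%:~R) <= h * (203 * m%:R).
    have -> : h * (203 * m%:R) = 203 * w by rewrite /w; ring.
    by rewrite mulrBr; lra.
  have e2 : h * (j%:~R - i'%:~R) <= h * (203 * m%:R).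
    have -> : h * (203 * m%:R) = 203 * w by rewrite /w; ring.
    by rewrite mulrBr; lra.
  move: e1 e2; rewrite !ler_pM2l // => e1 e2.
  apply/andP; split; rewrite -(ler_int R) ?mulrNz intrB dE; lra.
by split; apply: conv.
Qed.

Let o (N : nat) : site := (N%:Z + 1, N%:Z + 1).

(** The filled class lies between the discs of radii r and A + 2 h, and the outer
disc is close to the complement of Omega. *)
Definition round_label i := exists (z : plane) (r A : R),
  [/\ 0 < r /\ 0 <= A, A + 2 * h <= 43 * r,
      (forall s, P i s -> sqdist (h *: centre s) z <= A ^+ 2),
      (forall N : nat, (forall s, P i s -> ~ outside N%:Z s) ->
        forall q s, sqdist (h *: q) z <= r ^+ 2 -> hex s q -> fill (o N) (P i) s) &
      (forall p, sqdist p z <= (A + 2 * h) ^+ 2 ->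
        exists2 k, ~ Omega (emb 1 k) & cheb p k (100 * (300 * w)))].

(** The label was born at a cluster W around a circle of radius r >= 300 w. Being
filled, its class contains the disc bounded by the circle. It lies within
4 l + 2 d blocks, that is 3 * 2846 w in the sup norm, of W, hence within
1.415 * 8550 w < 12100 w of the circle, and 12100 w + 2 h < 42 * 300 w <= 42 r. *)
Lemma big_label i W : (i < n)%N -> lam (a0 i) = inl W -> round_label i.
Proof.
move=> ilt lW; have hg := h_gt0; have hw := w_ge; have hm := h_mu.
have d0 : 0 <= d by rewrite /d; lia.
have ld : 2 * d + 3 <= l by rewrite /d /l; have := m_ge10; lia.
have aW : forall s, lam s = inl W -> exists b, [/\ ~ small at_ d W, at_ W b &
    within (4 * l + 2 * d) s b].
  move=> s sW; have := lam_near s; rewrite sW => -[[bW Ws]|[c [c' [b [h1 h2 [bW Wb] h3]]]]].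
    by exists s; split=> //; split; lia.
  by exists b; split=> //; exact: (hull_cell_dist d0 ld h1 h2 h3).
have [b [bW Wb _]] := aW _ lW.
have [k [u [klt eW _ _]]] := Wb; have eWk : U k = W by [].
have [z [r [r0 rU rF near]]] := circle_of klt.
have r300 : 300 * w <= r.
  rewrite leNgt; apply/negP => lt; apply: bW; rewrite -eWk; exact: small_atom near.
exists z, r, (r + 1210 * (10 * w)); split.
- by split; lra.
- by lra.
- move=> s Ps; have sW := eroded_block Ps; have [b' [_ Wb' sb]] := aW _ (etrans sW lW).
  have [k' [u' [k'lt e' k'u b'u]]] := atom_near cl h_gt0 h_mu Wb'.
  have ku' : U k u' by rewrite eWk -e'.
  have [c cz u'c] := near _ ku'.
  have lE : (4 * l + 2 * d)%:~R = 2846 * m%:R :> R.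
    by rewrite /l /d intrD !intrM; ring.
  have sc : cheb (h *: centre s) c (855 * (10 * w)).
    have := cheb_trans (cheb_trans (cheb_trans (block_cheb s h_gt0) (within_cheb sb)) b'u) u'c.
    apply: cheb_le; rewrite lE.
    have -> : 3 * h * (2846 * m%:R) = 3 * (2846 * w) by rewrite /w; ring.
    by lra.
  have s1 : sqdist (h *: centre s) c <= (1210 * (10 * w)) ^+ 2.
    by apply: (le_trans (cheb_sqdist sc)); apply: sqr_le; lra.
  have s2 : sqdist c z <= r ^+ 2 by rewrite cz.
  have w0 : 0 <= 1210 * (10 * w) by lra.
  by rewrite (addrC r); exact: (sqdist_triangle w0 r0 s1 s2).
- move=> N PN q s qz sq; apply: (circle_fill h_gt0 _ _ PN qz sq); first by lra.
  move=> q' s' e sq'; have ku : U k (h *: q') by exact: rU.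
  have Pk : P k s'.
    apply: (cover_eroded klt ku); apply: cheb_sym.
    by apply: cheb_le (hex_cheb h_gt0 sq'); lra.
  move=> t st; rewrite (Pk t st); rewrite lW.
  have [b' [_ Wb' _]] := aW _ lW.
  have Wk : at_ W (a0 k) by rewrite -eWk; exact: a0_atom.
  by apply: lam_base; split.
move=> p pz; have W0 : 0 < 1220 * (10 * w) by lra.
have pz' : sqdist p z <= (r + 1220 * (10 * w)) ^+ 2.
  by apply: (le_trans pz); apply: sqr_le; lra.
have [kk kz pk] := disk_shrink r0 W0 pz'.
exists kk; first by apply: (disk_omega Ocircle Oinfty r0 rF kz).
by apply: cheb_le pk; lra.
Qed.

(** The label was born in the core of a cell, whose half side is
l / 2 - d = 102 m blocks, so that the core contains a disc of radius 300 w with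
some room. Its class lies within 4 l + l / 2 + d blocks, about 3 * 2948 w, of the
centre in the sup norm, hence in a disc of radius
1.415 * 8860 w < 12600 w < 43 * 300 w. *)
Lemma small_label i c : (i < n)%N -> lam (a0 i) = inr c -> round_label i.
Proof.
move=> ilt lc; have hg := h_gt0; have hw := w_ge; have hm := h_mu.
have d0 : 0 <= d by rewrite /d; lia.
have ld : 2 * d + 3 <= l by rewrite /d /l; have := m_ge10; lia.
have range : forall s, lam s = inr c -> alive at_ l d c /\
    (c.1 * l - 4 * l - d <= s.1 <= c.1 * l + 5 * l + d /\
     c.2 * l - 4 * l - d <= s.2 <= c.2 * l + 5 * l + d).
  move=> s sc; have := lam_near s; rewrite sc => -[[ac hs]|[c1 [c' [b [h1 h2 [ac hb] h3]]]]].
    split; first exact: ac.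
    have [y [y1 y2] [y3 y4]] := hullP d0 ld hs.
    by split; lia.
  by split=> //; exact: (hull_core_dist d0 ld h1 h2 h3 hb).
have [ac _] := range _ lc.
(* The centre of the cell in units of sites: 915 m is half of 3 l. *)
pose Z : site := (3 * (c.1 * l) + 915 * m%:Z, 3 * (c.2 * l) + 915 * m%:Z).
pose z : plane := h *: centre Z.
have out s : P i s -> cheb (h *: centre s) z (886 * (10 * w)).
  move=> Ps; have := eroded_block Ps; rewrite lc => /range[_ [r1 r2]].
  have conv (ci si : int) : ci * l - 4 * l - d <= si <= ci * l + 5 * l + d ->
      `|h * (3 * si%:~R + 1) - h * (3 * (ci * l) + 915 * m%:Z)%:~R| <= 2950 * (3 * w).
    move=> hr; have e1 : 3 * si + 1 <= 3 * (ci * l) + 915 * m%:Z + 2950 * (3 * m%:Z).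
      by move: hr; rewrite /l /d; have := m_ge10; lia.
    have e2 : 3 * (ci * l) + 915 * m%:Z <= 3 * si + 1 + 2950 * (3 * m%:Z).
      by move: hr; rewrite /l /d; have := m_ge10; lia.
    have KE : (2950 * (3 * m%:Z))%:~R = 2950 * (3 * m%:R) :> R.
      by rewrite intrM rmorph_nat intrM rmorph_nat.
    move: (3 * (ci * l) + 915 * m%:Z) (2950 * (3 * m%:Z)) e1 e2 KE => zi K e1 e2 KE.
    have {}e1 : 3 * si%:~R + 1 <= zi%:~R + 2950 * (3 * m%:R) :> R.
      by move: e1; rewrite -KE -(ler_int R) 2!intrD intrM.
    have {}e2 : zi%:~R <= 3 * si%:~R + 1 + 2950 * (3 * m%:R) :> R.
      by move: e2; rewrite -KE -(ler_int R) 2!intrD intrM.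
    have wE : h * (2950 * (3 * m%:R)) = 2950 * (3 * w) by rewrite /w; ring.
    rewrite -(ler_pM2l h_gt0) !(mulrDr h) wE in e1.
    rewrite -(ler_pM2l h_gt0) !(mulrDr h) wE in e2.
    by rewrite !(mulrDr h) ler_norml; apply/andP; split; lra.
  have bz : cheb (pos h (block s)) z (2950 * (3 * w)).
    rewrite /cheb; have [-> ->] := posE h (block s).
    by split; [exact: conv r1 | exact: conv r2].
  by apply: cheb_le (cheb_trans (block_cheb s h_gt0) bz); lra.
exists z, (300 * w), (1260 * (10 * w)); split.
- by split; lra.
- by lra.
- move=> s /out sz; apply: (le_trans (cheb_sqdist sz)); apply: sqr_le; lra.
- move=> N PN q s qz sq; apply: sub_fill => t st; rewrite lc.
  apply: lam_base; split=> //; left.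
  have w0 : 0 <= 300 * w by lra.
  have c1 := sqdist_cheb w0 qz.
  have c2 := cheb_trans (cheb_sym (nb_cheb h_gt0 st))
     (cheb_trans (cheb_sym (hex_cheb h_gt0 sq)) c1).
  have conv (ti ci : int) : `|h * ti%:~R - h * (3 * (ci * l) + 915 * m%:Z)%:~R| <= h + (h + 300 * w) ->
      ci * l + d + 1 <= (ti %/ 3)%Z <= ci * l + l - d - 2.
    rewrite ler_norml => /andP[h1 h2].
    have KE : (300 * m%:Z)%:~R = 300 * m%:R :> R by rewrite intrM rmorph_nat.
    have wE : h * (300 * m%:R) = 300 * w by rewrite /w; ring.
    have e1 : ti <= 3 * (ci * l) + 915 * m%:Z + 300 * m%:Z + 2.
      move: (3 * (ci * l) + 915 * m%:Z) (300 * m%:Z) h1 h2 KE => zi K h1 h2 KE.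
      rewrite -(ler_int R) 2!intrD KE -(ler_pM2l h_gt0) !(mulrDr h) wE.
      by lra.
    have e2 : 3 * (ci * l) + 915 * m%:Z <= ti + 300 * m%:Z + 2.
      move: (3 * (ci * l) + 915 * m%:Z) (300 * m%:Z) h1 h2 KE => zi K h1 h2 KE.
      rewrite -(ler_int R) 2!intrD KE -(ler_pM2l h_gt0) !(mulrDr h) wE.
      by lra.
    by move: e1 e2 m_ge10; rewrite /l /d; clear; lia.
  by have [g1 g2] := c2; split; [exact: (conv _ _ g1) | exact: (conv _ _ g2)].
move=> p pz; exists (x i); first by apply: (frontier_omega Ocircle); exact: (cl_mem cl).
have w0 : 0 <= 1260 * (10 * w) + 2 * h by lra.
have pz' := sqdist_cheb w0 pz.
have sz := out _ (eroded_centre (erefl (lam (a0 i)))).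
apply: cheb_le (cheb_trans pz' (cheb_trans (cheb_sym sz) (a0_near i))).
by lra.
Qed.

Lemma all_round i : (i < n)%N -> round_label i.
Proof.
move=> ilt; case E : (lam (a0 i)) => [W|c]; first exact: big_label E.
exact: small_label E.
Qed.

End Level.

(** * One member of the exhaustion *)

Section Exhaustion.
Context {R : realType}.
Local Notation plane := (R * R)%type.
Variables (Omega : set (sphere R)).
Hypotheses (Ocircle : circle_domain Omega) (Oinfty : Omega infty).

(** A member of the exhaustion at scale eps; the last clause makes the removed set
shrink to the complement of Omega. *)
Definition admissible (eps : R) (G : set (sphere R)) : Prop :=
  [/\ domain G /\ G infty, closure G `<=` Omega,
      bounded_by_jordan_curves_in Omega G, quasiround_domain 43 G &
      forall p, ~ G (emb 1 p) -> exists2 k, ~ Omega (emb 1 k) & cheb p k (100 * eps)].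

Lemma common_bound (n : nat) (Q : nat -> nat -> Prop) :
  (forall i N N', (N <= N')%N -> Q i N -> Q i N') ->
  (forall i, (i < n)%N -> exists N, Q i N) -> exists N, forall i, (i < n)%N -> Q i N.
Proof.
move=> mono; elim: n => [|n IHn] H; first by exists 0%N.
have [|N HN] := IHn; first by move=> i ilt; apply: H; rewrite ltnW.
have [N' HN'] := H n (ltnSn n); exists (maxn N N') => i.
rewrite ltnS leq_eqVlt => /orP[/eqP->|ilt].
  by apply: mono HN'; exact: leq_maxr.
by apply: mono (HN i ilt); exact: leq_maxl.
Qed.

Lemma disk_bounded (h A : R) (z : plane) : 0 < h -> 0 <= A ->
  exists N : nat, forall s, sqdist (h *: centre s) z <= A ^+ 2 -> ~ outside N%:Z s.
Proof.
move=> h0 A0; pose B : R := (`|z.1| + `|z.2| + A) / h.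
have B0 : 0 <= B by rewrite divr_ge0 ?addr_ge0 // ltW.
exists (Num.bound B) => s /(sqdist_cheb A0)[]; set N := Num.bound B.
have BN : B < N%:R by exact: archi_boundP.
have hB : h * B = `|z.1| + `|z.2| + A by rewrite mulrC divfK // gt_eqF.
have hN : `|z.1| + `|z.2| + A < h * N%:R by rewrite -hB ltr_pM2l.
rewrite /centre /= => c1 c2.
have conv (i : int) (y : R) : `|y| <= `|z.1| + `|z.2| -> `|h * i%:~R - y| <= A ->
    - N%:Z <= i <= N%:Z.
  move=> yb hi; have : `|h * i%:~R| < h * N%:R.
    by have := ler_normD (h * i%:~R - y) y; rewrite subrK; lra.
  rewrite normrM gtr0_norm // ltr_pM2l // ltr_norml => /andP[h1 h2].
  apply/andP; split.
    by rewrite -(ler_int R) mulrNz -pmulrn ltW.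
  by rewrite -(ler_int R) -pmulrn ltW.
have g1 := conv s.1 z.1 _ c1; have g2 := conv s.2 z.2 _ c2.
have z1 : `|z.1| <= `|z.1| + `|z.2| by rewrite lerDl.
have z2 : `|z.2| <= `|z.1| + `|z.2| by rewrite lerDr.
by have := g1 z1; have := g2 z2; clear; move=> ? ? [?|?|[?|?]]; lia.
Qed.

(** The filled classes of the labels that occur at some cluster are removed. The
hexagons that remain are linked to the far site o by [janiszewski_bigcup], and
every hexagon that meets the frontier is removed, being well inside the class of
its cluster. *)
Lemma level (eps : R) : 0 < eps -> exists G, admissible eps G.
Proof.
move=> eps0; have s0 : 0 < eps / 100 by lra.
pose Fr := frontier Omega.
have cF : compact Fr by exact: compact_frontier.
have [n [x [eta [mu cl0]]]] := clusters_exist cF s0.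
have mu0 := cl_mu cl0.
(* The mesh must be small compared with the margin mu of the clusters, and eps
   must be a multiple of it. *)
pose m : nat := (Num.bound (eps / (30 * mu)) + 10)%N.
have m10 : (10 <= m)%N by rewrite /m leq_addl.
have em : 0 <= eps / (30 * mu) by rewrite divr_ge0 //; lra.
have mb : eps / (30 * mu) < m%:R.
  by apply: lt_le_trans (archi_boundP em) _; rewrite ler_nat leq_addr.
have m0 : 0 < m%:R :> R by rewrite ltr0n; apply: leq_trans m10.
clearbody m; pose h : R := eps / (300 * m%:R).
have m300 : 0 < 300 * m%:R :> R := mulr_gt0 (ltr0Sn R 299) m0.
have h0 : 0 < h by rewrite divr_gt0.
have hE : h * (300 * m%:R) = eps by rewrite /h divfK ?(gt_eqF m300).
have wE : m%:R * h = eps / 300 by move: hE; clear; lra.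
have hmu : 10 * h <= mu.
  have e1 : eps < mu * (30 * m%:R).
    have mu30 : 0 < 30 * mu by lra.
    have : eps / (30 * mu) * (30 * mu) = eps by rewrite divfK // gt_eqF.
    by move=> <-; rewrite [X in _ < X](_ : _ = m%:R * (30 * mu)) ?ltr_pM2r //; ring.
  have e2 : (10 * h) * (30 * m%:R) = eps by move: hE; clear; lra.
  have m30 : 0 < 30 * m%:R :> R by apply: mulr_gt0 => //; lra.
  by rewrite -(ler_pM2r m30) e2 ltW.
clearbody h.
have cl : clusters Fr (3 * (m%:R * h)) n x eta mu.
  by rewrite wE (_ : 3 * (eps / 300) = eps / 100) //; lra.
have d0 : 0 <= 203 * m%:Z by clear; lia.
have ld : 2 * (203 * m%:Z) + 3 <= 610 * m%:Z by clear -m10; lia.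
have [lam [lam_linked lam_atom lam_base lam_near]] :=
  coarse_labelling d0 ld (@atom_linked _ _ _ _ _ _ _ _ cl h0 hmu)
    (@atom_disjoint _ _ _ _ _ _ _ _ cl).
have /choice[a0 a0_near] (i : nat) : exists a, cheb (pos h a) (x i) (3 * h).
  exact: pos_nearest.
pose P i := eroded lam (lam (a0 i)).
have rnd := all_round Ocircle Oinfty cl h0 hmu m10 lam_atom lam_base lam_near a0_near.
have Psep i k a b : P i a -> P k b -> nb a b -> P i = P k by exact: eroded_sep.
have Pconn i : sconnected (P i) by apply: eroded_connected.
have P0 i : P i !=set0.
  by exists (block_centre (a0 i)); exact: eroded_centre.
have [N PN] : exists N : nat, forall i, (i < n)%N -> forall s, P i s -> ~ outside N%:Z s.
  apply: common_bound.
    move=> i M M' le H s /H ns os; apply: ns; move: os; clear -le => -[?|?|[?|?]].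
    - by apply: Or31; lia.
    - by apply: Or32; lia.
    - by apply: Or33; left; lia.
    - by apply: Or33; right; lia.
  move=> i ilt; have [z [r [A [[r0 A0] _ PA _ _]]]] := rnd i ilt.
  by have [M MP] := disk_bounded z h0 A0; exists M => s /PA /MP.
pose o : site := (N%:Z + 1, N%:Z + 1).
pose F : set site := [set s | exists2 i, (i < n)%N & fill o (P i) s].
have FN s : F s -> ~ outside N%:Z s.
  move=> [i ilt Fs] os; apply: Fs; apply: linked_subset (linked_outside _ os _).
  - by move=> t ot /(PN i ilt).
  - by [].
  - by apply: Or32 => /=; clear; lia.
have linkF s : ~ F s -> linked nb (~` F) s o.
  move=> nFs; have so : linked nb (~` \bigcup_(i in `I_n) P i) s o.
    apply: janiszewski_bigcup => // i ilt; apply: contrapT => nl; apply: nFs.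
    by exists i.
  apply: linked_sub (so) => t st [i ilt Ft]; apply: Ft.
  have to := linked_trans (linked_sym nb_sym st) so.
  by apply: linked_subset to => u nu Pu; apply: nu; exists i.
have hn0 : h != 0 by rewrite gt_eqF.
have FrF q s : Fr (h *: q) -> hex s q -> F s.
  move=> Fq sq; have [i ilt iq] := cl_cover cl Fq.
  exists i => //; apply: sub_fill.
  apply: (cover_eroded cl h0 hmu lam_atom a0_near ilt iq).
  by apply: cheb_sym; apply: cheb_le (hex_cheb h0 sq); clear -h0; lra.
have dom := region_domain hn0 FN linkF.
have bdry := region_boundary hn0 FN.
have bO y : boundary (region h F) y -> ~ boundary Omega y.
  rewrite bdry => -[q [p [_ nF _] [pq _]] <-] bq; apply: nF.
  by apply: FrF pq; rewrite /Fr /frontier /= -emb_scale.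
have sub : region h F `<=` Omega.
  have [_ _ cG] := dom; apply: (connected_in_omega Ocircle) => //.
    exact: region_infty.
  move=> y Gy by_; have [u Fu e] := boundary_frontier Ocircle Oinfty by_.
  have eu : u = h *: (h^-1 *: u) by rewrite scalerA mulfV // scale1r.
  have [s sq] := hex_cover (h^-1 *: u).
  move: Gy; rewrite e eu -emb_scale => /(region_emb F hn0); apply; exists s => //.
  by apply: FrF sq; rewrite -eu.
have clsub : closure (region h F) `<=` Omega.
  move=> y cy; have [Gy|nGy] := pselect (region h F y); first exact: sub.
  apply: contrapT => nOy; apply: (bO y).
    by split=> // /interior_subset.
  apply/(omega_boundaryE Ocircle); split=> //.
  exact: closureS sub _ cy.
exists (region h F); split=> //.
- by split=> //; exact: region_infty.
- have [k [J [Jc Jd JE]]] := boundary_curves FN hn0.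
  exists k, J; split=> //; last by rewrite bdry JE.
  move=> i; split=> // y Jy; apply: clsub.
  have : boundary (region h F) y by rewrite bdry -JE; exists i.
  by case.
- move=> E [y Gy ->] _; have [q [s Fs sq] e] : (emb h @` tiles F) y by apply: contrapT.
  have [i [ilt Fis imax]] := fill_maximal Psep (fun i _ => conj (Pconn i) (P0 i)) Fs.
  have FiF : fill o (P i) `<=` F by move=> t Ft; exists i.
  have Ei : connected_component (~` region h F) y = emb h @` tiles (fill o (P i)).
    apply: (region_component hn0 FN) => //.
    - exact: fill_connected.
    - by move=> a b Fa [k klt Fb] ab; exact: imax klt Fa Fb ab.
    - by exists q => //; exists s.
  have [z [r [A [[r0 A0] Ar PA inn near]]]] := rnd i ilt.
  rewrite Ei; exists ((fun q => cplx (h *: q)) @` tiles (fill o (P i))).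
    by rewrite image_comp.
  exists (cplx z), r; split=> //.
    move=> v; rewrite /closed_disk /= -(coordsK v) => vz0.
    have vz : sqdist (coords v) z <= r ^+ 2.
      by rewrite -norm_cplx_le; [exact: vz0 | exact: ltW].
    rewrite coordsK.
    exists (h^-1 *: coords v); last by rewrite scalerA mulfV // scale1r coordsK.
    have [t tq] := hex_cover (h^-1 *: coords v); exists t => //.
    apply: (inn N (PN i ilt) _ _ _ tq).
    by rewrite scalerA mulfV // scale1r.
  move=> _ [q' [t Ft tq] <-]; rewrite /closed_disk /= norm_cplx_le; last first.
    exact: mulr_ge0 (ler0n R 43) (ltW r0).
  have c1 := cheb_sqdist (hex_cheb h0 tq).
  have c2 := fill_disk h0 A0 PA (PN i ilt) Ft.
  have h2 : 0 <= 2 * h := mulr_ge0 (ler0n R 2) (ltW h0).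
  have c1' : sqdist (h *: q') (h *: centre t) <= (2 * h) ^+ 2.
    by apply: (le_trans c1); apply: sqr_le; clear -h0; lra.
  have c3 := sqdist_triangle h2 A0 c1' c2.
  by apply: (le_trans c3); apply: sqr_le; clear -h0 A0 Ar; lra.
move=> p; have ep : p = h *: (h^-1 *: p) by rewrite scalerA mulfV // scale1r.
rewrite {1}ep -emb_scale => nG.
have [t [i ilt Ft] tq] : tiles F (h^-1 *: p).
  by apply: contrapT => nt; apply: nG; apply/region_emb.
have [z [r [A [[r0 A0] Ar PA inn near]]]] := rnd i ilt.
have [|k nk pk] := near p.
  have c1 := cheb_sqdist (hex_cheb h0 tq).
  have c2 := fill_disk h0 A0 PA (PN i ilt) Ft.
  have h2 : 0 <= 2 * h := mulr_ge0 (ler0n R 2) (ltW h0).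
  have c1' : sqdist (h *: (h^-1 *: p)) (h *: centre t) <= (2 * h) ^+ 2.
    by apply: (le_trans c1); apply: sqr_le; clear -h0; lra.
  have := sqdist_triangle h2 A0 c1' c2.
  by rewrite -ep (addrC A).
exists k => //; apply: cheb_le pk; rewrite wE; clear -eps0; lra.
Qed.

End Exhaustion.

(** * The exhaustion *)

Section Sequence.
Context {R : realType}.
Local Notation plane := (R * R)%type.
Variables (Omega : set (sphere R)).
Hypotheses (Ocircle : circle_domain Omega) (Oinfty : Omega infty).

Lemma admissible_le (e e' : R) G : e <= e' -> admissible Omega e G -> admissible Omega e' G.
Proof.
move=> ee [h1 h2 h3 h4 near]; split=> // p /near[k nk pk]; exists k => //.
by apply: cheb_le pk; lra.
Qed.

Lemma compact_complement : compact [set p : plane | ~ Omega (emb 1 p)].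
Proof.
have [K cK KO] := omega_near_infty Ocircle Oinfty.
apply: subclosed_compact cK KO.
apply: (@closed_comp _ _ (emb 1) (~` Omega)); first by move=> p _; exact: emb_continuous.
by apply: open_closedC; exact: omega_open Ocircle.
Qed.

(** The complement of Omega is compact and disjoint from the closed set
[closure G]. *)
Lemma gap G : closure G `<=` Omega -> exists2 r : R, 0 < r &
  forall p k, G (emb 1 p) -> ~ Omega (emb 1 k) -> ~ cheb p k r.
Proof.
move=> GO.
have [k nk|r r0 H] := @compact_uniform _ _ _
    (fun d k => forall p, G (emb 1 p) -> ~ cheb p k d) compact_complement.
  have nO : (emb 1 @^-1` (~` closure G)) k by move=> /GO.
  have oO : open (emb (R := R) 1 @^-1` (~` closure G)).
    apply: open_comp; first by move=> p _; exact: emb_continuous.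
    by apply: closed_openC; exact: closed_closure.
  have [r r0 H] := openP oO nO; exists (r / 2); first by lra.
  move=> k' d _ kk' /andP[d0 dr] p Gp pk'; apply: (H p); last exact: subset_closure.
  have := (norm_cheb _ _ _).2 pk'; have := ler_distD k' k p.
  by rewrite (distrC p k'); lra.
exists (r / 2); first by lra.
by move=> p k Gp nk; apply: (H (r / 2) k) => //; lra.
Qed.

(** The removed set of G' can be kept within the distance of G to the complement
of Omega. *)
Lemma refine (e : R) G : 0 < e -> closure G `<=` Omega -> exists G', admissible Omega e G' /\ G `<=` G'.
Proof.
move=> e0 GO; have [r r0 far] := gap GO.
have m0 : 0 < Num.min e (r / 100) by rewrite lt_min e0; lra.
have [G' adm] := level Ocircle Oinfty m0.
exists G'; split; first by apply: admissible_le adm; exact: ge_minl.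
have [[_ Gi'] _ _ _ near] := adm => y Gy.
have [->//|yi] := pselect (y = infty).
have [p e1] := emb_surj (oner_neq0 R) yi; subst y.
apply: contrapT => nG; have [k nk pk] := near p nG; apply: (far p k) => //.
by apply: cheb_le pk; have := @ge_minr R e (r / 100); lra.
Qed.

Lemma exhausting_sequence : exists G : nat -> set (sphere R),
  (forall j, admissible Omega (j.+1%:R^-1) (G j)) /\ forall j, G j `<=` G j.+1.
Proof.
pose T := {G : set (sphere R) | closure G `<=` Omega}.
have /choice[f fP] (p : nat * T) : exists G' : T,
    admissible Omega (p.1.+1%:R^-1) (sval G') /\ sval p.2 `<=` sval G'.
  have j0 : 0 < p.1.+1%:R^-1 :> R by rewrite invr_gt0 ltr0n.
  have [G' [adm sub]] := refine j0 (svalP p.2).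
  by have [_ cl _ _ _] := adm; exists (exist _ G' cl).
have G0 : T by exists set0; rewrite closure0.
pose g := fix g (j : nat) : T := if j is i.+1 then f (j, g i) else f (0%N, G0).
exists (fun j => sval (g j)); split.
  by case=> [|j]; [exact: (fP (0%N, G0)).1 | exact: (fP (j.+1, g j)).1].
by move=> j; exact: (fP (j.+1, g j)).2.
Qed.

End Sequence.

Theorem theorem2p1 (R : realType) (Omega : set (sphere R)) :
  circle_domain Omega -> Omega infty ->
  exists Omega_ : nat -> set (sphere R),
    exhaustion Omega Omega_ /\ quasiround_sequence 43 Omega_.
Proof.
move=> Oc Oi; have [G [adm mono]] := exhausting_sequence Oc Oi.
have GO j : G j `<=` Omega.
  have [_ cl _ _ _] := adm j; apply: subset_trans cl; exact: subset_closure.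
exists G; split; last by move=> j; have [] := adm j.
split=> //.
  by move=> j; have [[dG _] _ bG _ _] := adm j; split=> //; exact: GO.
apply/seteqP; split=> [y Oy|y [j _ /GO]//].
have [->|yi] := pselect (y = infty); first by exists 0%N => //; have [[]] := adm 0%N.
have [p e] := emb_surj (oner_neq0 R) yi; subst y.
have oO : open (emb 1 @^-1` Omega).
  apply: open_comp; first by move=> q _; exact: emb_continuous.
  exact: omega_open Oc.
have [r r0 H] := openP oO Oy.
pose j := Num.bound (100 / r); exists j => //.
apply: contrapT => nG; have [_ _ _ _ near] := adm j; have [k nk pk] := near p nG.
apply: nk; apply: H; apply: le_lt_trans ((norm_cheb _ _ _).2 pk) _.
have b0 : 0 <= 100 / r by rewrite divr_ge0 // ltW.
have jb : 100 / r < j.+1%:R by apply: lt_trans (archi_boundP b0) _; rewrite ltr_nat.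
have j0 : 0 < j.+1%:R :> R by rewrite ltr0n.
by rewrite ltr_pdivrMr // mulrC -ltr_pdivrMr.
Qed.
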